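(* For every $k\ge2$, $\mathcal{R}_{U_k}(W_2)=\mathrm{NP}$.
   Context: The 2-way tape $W_2$ is the memory model with cells $0,1,2,\dots$, initial cell $0$, and from each cell $n$ an edge $n\to n+1$ marked $+$ and an edge $n\to n-1$ marked $-$ (at cell $0$ the $-$ edge is taken to be a loop). An $h$-head automaton with auxiliary memory of model $W_2$ has a finite state set, input alphabet with endmarkers, a finite memory alphabet $\Delta$, a transition function mapping (state, the $h$ symbols under its 2-way read-only input heads, the current memory symbol) to (new state, a move in $\{-1,0,+1\}$ per head, and $+$, $-$ or ''stay'' for the memory position), an initial state and accepting states; it starts with heads at the leftmost input symbol and memory at cell $0$ and runs deterministically for a fixed memory content. For $\Delta=\{0\}\cup\Delta'$, $U_k$ is the set of memory contents with at most $k$ cells containing symbols from $\Delta'$. The automaton accepts $w$ with a $U_k$-restricted guess iff it reaches an accepting state on some memory content in $U_k$; $\mathcal{R}_{U_k}(W_2)$ is the class of languages recognized in this sense (any number of heads). *)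

(* Defs.v *)
From HB Require Import structures.
From mathcomp Require Import all_boot all_order all_algebra.

Set Implicit Arguments.
Unset Strict Implicit.
Unset Printing Implicit Defensive.

Import GRing.Theory.

Definition language (Sigma : finType) := seq Sigma -> Prop.

(* Moves of input heads, of the memory position (MLeft is the edge marked -,
   MRight the edge marked +) and of Turing machine heads. *)
Inductive move := MLeft | MStay | MRight.

Definition option_of_move (d : move) : option bool :=
  match d with MLeft => Some false | MStay => None | MRight => Some true end.

Definition move_of_option (o : option bool) : move :=
  match o with
  | Some false => MLeft | None => MStay | Some true => MRight
  end.

Lemma option_of_moveK : cancel option_of_move move_of_option.
Proof. by case. Qed.

HB.instance Definition _ := Finite.copy move (can_type option_of_moveK).

Inductive input_symbol (Sigma : Type) :=
  LeftEnd | RightEnd | Letter of Sigma.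
Arguments LeftEnd {Sigma}.
Arguments RightEnd {Sigma}.

(* The input tape is LeftEnd, w, RightEnd, at positions 0, ..., size w + 1. *)
Definition read_input (Sigma : finType) (w : seq Sigma) (i : nat) :
    input_symbol Sigma :=
  nth RightEnd (LeftEnd :: map (@Letter Sigma) w) i.

(* A head that would leave the input tape stays where it is. *)
Definition move_head (Sigma : finType) (w : seq Sigma) (d : move) (i : nat) :
    nat :=
  match d with
  | MLeft => i.-1
  | MStay => i
  | MRight => minn i.+1 (size w).+1
  end.

(* The edges of W_2; 0.-1 = 0 makes the - edge at cell 0 a loop. *)
Definition W2_move (d : move) (m : nat) : nat :=
  match d with MLeft => m.-1 | MStay => m | MRight => m.+1 end.

(* The memory alphabet is option D, where D is Delta' and None is 0. *)
Definition memory_content (D : finType) := nat -> option D.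

Record automaton (Sigma : finType) (h : nat) := Automaton {
  state : finType;
  marks : finType;
  trans : state -> {ffun 'I_h -> input_symbol Sigma} -> option marks ->
          state * {ffun 'I_h -> move} * move;
  start : state;
  accepting : {set state}
}.

Record configuration (Sigma : finType) (h : nat) (A : automaton Sigma h) :=
  Configuration {
    cstate : state A;
    cheads : {ffun 'I_h -> nat};
    ccell : nat
  }.

Section AutomatonRun.
Variables (Sigma : finType) (h : nat) (A : automaton Sigma h).
Variables (w : seq Sigma) (mu : memory_content (marks A)).

Definition initial : configuration A := Configuration (start A) [ffun=> 0] 0.

Definition step (c : configuration A) : configuration A :=
  let: (q, ds, d) :=
    trans (cstate c) [ffun i => read_input w (cheads c i)] (mu (ccell c)) in
  Configuration q [ffun i => move_head w (ds i) (cheads c i)]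
    (W2_move d (ccell c)).

Definition run_accepts : Prop :=
  exists t : nat, cstate (iter t step initial) \in accepting A.

End AutomatonRun.

Definition U (k : nat) (D : finType) (mu : memory_content D) : Prop :=
  exists2 s : seq nat, size s <= k & forall i, mu i <> None -> i \in s.

Definition R_U_W2 (k : nat) (Sigma : finType) (L : language Sigma) : Prop :=
  exists (h : nat) (A : automaton Sigma h), 0 < h /\
    forall w, L w <->
      exists mu : memory_content (marks A), U k mu /\ run_accepts w mu.

(* Nondeterministic Turing machines with m + 1 two-way infinite tapes. A tape
   symbol is None (blank), Some (inl a) with a an input letter, or
   Some (inr g) with g an auxiliary symbol. *)
Definition tape_symbol (Sigma G : finType) := option (Sigma + G).

Record ntm (Sigma : finType) (m : nat) := NTM {
  tm_state : finType;
  tm_aux : finType;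
  tm_trans : tm_state -> {ffun 'I_m.+1 -> tape_symbol Sigma tm_aux} ->
    {set tm_state * {ffun 'I_m.+1 -> tape_symbol Sigma tm_aux * move}};
  tm_start : tm_state;
  tm_accepting : {set tm_state}
}.

Record tm_tape (T : Type) := TMTape { tm_pos : int; tm_cells : int -> T }.

Record tm_config (Sigma : finType) (m : nat) (M : ntm Sigma m) := TMConfig {
  tm_cstate : tm_state M;
  tm_tapes : 'I_m.+1 -> tm_tape (tape_symbol Sigma (tm_aux M))
}.

Definition tm_read (T : Type) (t : tm_tape T) : T := tm_cells t (tm_pos t).

Definition tm_move (d : move) (x : int) : int :=
  match d with
  | MLeft => (x - 1)%R
  | MStay => x
  | MRight => (x + 1)%R
  end.

Definition tm_write_move (T : Type) (a : T * move) (t : tm_tape T) :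
    tm_tape T :=
  TMTape (tm_move a.2 (tm_pos t))
         (fun x => if x == tm_pos t then a.1 else tm_cells t x).

Section TuringRun.
Variables (Sigma : finType) (m : nat) (M : ntm Sigma m).

Definition input_tape (w : seq Sigma) : tm_tape (tape_symbol Sigma (tm_aux M)) :=
  TMTape 0%R (fun x =>
    match x with
    | Posz n => nth None [seq Some (inl a) | a <- w] n
    | Negz _ => None
    end).

Definition blank_tape : tm_tape (tape_symbol Sigma (tm_aux M)) :=
  TMTape 0%R (fun=> None).

Definition tm_initial (w : seq Sigma) : tm_config M :=
  TMConfig (tm_start M)
    (fun i => if i == ord0 then input_tape w else blank_tape).

(* Some computation of exactly t steps from c ends in an accepting state. *)
Fixpoint tm_accepts_in (t : nat) (c : tm_config M) : Prop :=
  match t with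
  | 0 => tm_cstate c \in tm_accepting M
  | t'.+1 =>
      exists2 a, a \in tm_trans (tm_cstate c) [ffun i => tm_read (tm_tapes c i)]
        & tm_accepts_in t'
            (TMConfig a.1 (fun i => tm_write_move (a.2 i) (tm_tapes c i)))
  end.

End TuringRun.

(* Time of a nondeterministic machine is the length of a shortest accepting
   computation, on the words that it accepts. *)
Definition NP (Sigma : finType) (L : language Sigma) : Prop :=
  exists (m : nat) (M : ntm Sigma m) (p : {poly nat}),
    (forall w, L w <-> exists t, tm_accepts_in t (tm_initial M w)) /\
    (forall w, L w ->
       exists2 t, t <= (p.[size w])%R & tm_accepts_in t (tm_initial M w)).

(* Main.v *)
Require Import Defs.
From HB Require Import structures.
From mathcomp Require Import all_boot all_order all_algebra zify.

Set Implicit Arguments.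
Unset Strict Implicit.
Unset Printing Implicit Defensive.

Import GRing.Theory Num.Theory.

(** NP is contained in the class because two marks, at cells 0 and [a], provide
    the number [a]: walking between the marks while counting modulo [m] gives
    [a mod m] for every polynomial [m], and by the Chinese remainder theorem and
    a Chebyshev bound these residues can spell any computation of polynomial
    length. The automaton checks such a computation separately for every tape
    cell, by replaying it while remembering only the symbol in that cell.

    Conversely, on blank memory a run that covers more distance than there are
    pairs of a state and head positions has become periodic with a drift [d].
    Hence a long gap between marks matters only through its length modulo all
    small [d], so it may be shortened to exponential length, and an NP machine
    can guess that length in binary. It crosses the gap by reading the digits
    from the most significant one, keeping the remaining distance scaled: one
    period of the run executed at scale [2^j] stands for [2^j] periods. *)

(** * Residues of one number carry a word *)

(** The number given by two marks may be exponential while heads count only polynomially far, so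
    nothing but its residues is visible. The automaton need not know which moduli carry data: up to
    the bound that matters the other residues are arranged to be 0, which means skip. A false claim
    about a scanned symbol is noticed only in the sweep for the cell where it lies; hence one sweep
    per cell, over the same list of instructions.

    In the converse, even shortened gaps are exponentially long, so no head can hold a remaining
    distance. The drift [d] depends on the crossing, so a gap length is kept modulo the factorial of
    the number [P] of small configurations, which takes at most [P ^ 2] bits. The verifier may guess
    and waste time: a shortest accepting path through its polynomially many configurations is short
    anyway. It thus suffices that each of its moves keeps a meaning in terms of a real run, and that
    one accepting path exists. That path follows a real run up to its first acceptance, which
    excludes drifting periodically without end. *)

Lemma bin_double_ge n : 2 ^ n <= 'C(n.*2, n).
Proof.
elim: n => // n IHn; rewrite doubleS expnS.
suff: 2 * 'C(n.*2, n) <= 'C(n.*2.+2, n.+1).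
  by apply: leq_trans; rewrite leq_mul2l IHn orbT.
rewrite binS -[X in _ + X](@bin_sub n.*2.+1 n); last by lia.
have -> : n.*2.+1 - n = n.+1 by lia.
by rewrite binS; lia.
Qed.

(** By Legendre's formula the exponent is the sum over [i] of [(n.*2 %/ p ^ i) - 2 * (n %/ p ^ i)].
    Each term is 0 or 1, and the terms with [p ^ i > n.*2] vanish, so the exponent is at most
    [trunc_log p n.*2]. *)
Lemma logn_bin_double p n : prime p -> 0 < n ->
  p ^ logn p 'C(n.*2, n) <= n.*2.
Proof.
move=> pp n0; have p1 := prime_gt1 pp.
have nn : n <= n.*2 by lia.
have F : logn p (n.*2)`! = logn p 'C(n.*2, n) + (logn p n`!).*2.
  rewrite -(bin_fact nn) -addnn addnK !lognM ?muln_gt0 ?fact_gt0 ?bin_gt0 ?leq_addr //.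
  by rewrite -addnn.
have n2 : 0 < n.*2 by lia.
apply: leq_trans (trunc_logP p1 n2); rewrite leq_exp2l //.
set e := trunc_log p n.*2.
suff: logn p (n.*2)`! <= e + (logn p n`!).*2 by rewrite F leq_add2r.
have en : e <= n.*2.
  by apply: leq_trans (trunc_logP p1 n2); apply/ltnW/ltn_expl.
(* Both Legendre sums are cut at [e], beyond which all quotients are 0, so that they can be compared
   term by term. *)
have S k f : (forall i, e < i -> f i = 0) -> e <= k ->
    \sum_(1 <= i < k.+1) f i = \sum_(1 <= i < e.+1) f i.
  move=> f0 ek; rewrite (@big_cat_nat _ _ _ e.+1) //= [X in _ + X]big_nat_cond.
  by rewrite [X in _ + X]big1 ?addn0 // => i; rewrite andbT => /andP[/f0].
have L m i : 0 < m <= n.*2 -> e < i -> m %/ p ^ i = 0.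
  move=> /andP[m0 mn] ei; apply: divn_small; apply: leq_ltn_trans mn _.
  by apply: leq_trans (trunc_log_ltn _ p1) _; rewrite leq_exp2l.
have -> : (logn p n`!).*2 = \sum_(1 <= k < e.+1) (n %/ p ^ k).*2.
  rewrite logn_fact //.
  have -> : \sum_(1 <= k < n.+1) n %/ p ^ k = \sum_(1 <= k < n.*2.+1) n %/ p ^ k.
    rewrite [RHS](@big_cat_nat _ _ _ n.+1) ?ltnS //= [X in _ = _ + X]big_nat_cond.
    rewrite [X in _ = _ + X]big1 ?addn0 // => i; rewrite andbT => /andP[ni _].
    by apply: divn_small; apply: ltn_trans ni (ltn_expl _ p1).
  rewrite S // => [|i ei]; last by apply: L => //; rewrite n0.
  by rewrite -muln2 big_distrl /=; apply: eq_bigr => i _; rewrite muln2.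
rewrite logn_fact // S // => [|i]; last by apply: L; rewrite n2 /=.
have e1 : e = \sum_(1 <= k < e.+1) 1 by rewrite sum_nat_const_nat muln1 subn1.
rewrite [X in _ <= X + _]e1 -big_split /=; apply: leq_sum => i _.
have pi : 0 < p ^ i by rewrite expn_gt0 prime_gt0.
move: (divn_eq n (p ^ i)) (ltn_pmod n pi) => E M.
by rewrite -ltnS ltn_divLR //; nia.
Qed.

Definition prime_count n := count prime (iota 1 n).

(** Chebyshev's argument: with [n = 2 ^ e], the central binomial coefficient is at least [2 ^ n],
    and it is a product of prime powers of size at most [2 * n], one for each of its prime
    divisors. *)
Lemma prime_count_pow2 e : 2 ^ (2 ^ e) <= (2 ^ e.+1) ^ prime_count (2 ^ e.+1).
Proof.
apply: leq_trans (bin_double_ge _) _.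
have n0 : 0 < 2 ^ e by rewrite expn_gt0.
have -> : 2 ^ e.+1 = (2 ^ e).*2 by rewrite expnS mul2n.
set n := 2 ^ e in n0 *; set b := 'C(_, _).
have b0 : 0 < b by rewrite bin_gt0; lia.
rewrite {1}(prod_prime_decomp b0) prime_decompE big_map /=.
have sub : {subset primes b <= [seq p <- iota 1 n.*2 | prime p]}.
  move=> p; rewrite mem_primes mem_filter mem_iota => /and3P[pp _ pb].
  rewrite pp add1n ltnS prime_gt0 //=.
  apply: leq_trans (logn_bin_double pp n0); rewrite -{1}(expn1 p).
  by rewrite leq_exp2l ?prime_gt1 // logn_gt0 mem_primes pp b0.
have sz := uniq_leq_size (primes_uniq b) sub.
rewrite size_filter in sz.
apply: (@leq_trans (n.*2 ^ size (primes b))); last by rewrite leq_pexp2l //; lia.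
elim: (primes b) (all_prime_primes b) => [|p s IH] //=; first by rewrite big_nil.
case/andP=> pp /IH {}IH; rewrite big_cons expnS leq_mul //.
exact: logn_bin_double.
Qed.

(** Pigeonhole over the dyadic intervals up to [2 ^ e]: fewer than [K] primes in each would leave at
    most [K * e] primes in all, against [2 ^ e.-1 <= e * prime_count (2 ^ e)]. *)
Lemma dyadic_primes K e : 0 < e -> K * e ^ 2 < 2 ^ e.-1 ->
  exists2 i, i < e & K <= count prime (iota (2 ^ i).+1 (2 ^ i)).
Proof.
case: e => // e _ /= H.
case: (boolP [exists i : 'I_e.+1, K <= count prime (iota (2 ^ i).+1 (2 ^ i))]).
  by case/existsP=> i Hi; exists i.
rewrite negb_exists => /forallP small; exfalso.
have bound j : j <= e.+1 -> prime_count (2 ^ j) <= K * j.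
  elim: j => [|j IHj] je; first by [].
  rewrite expnS mul2n -addnn /prime_count iotaD count_cat add1n mulnS addnC.
  apply: leq_add; last exact: IHj (ltnW je).
  by have := small (Ordinal je); rewrite -ltnNge => /ltnW.
have := prime_count_pow2 e; rewrite -expnM leq_exp2l // => le1.
have := bound e.+1 (leqnn _) => le2.
have : 2 ^ e <= e.+1 * (K * e.+1) by apply: leq_trans le1 _; rewrite leq_mul2l le2 orbT.
by move: H; rewrite -mulnn; lia.
Qed.

Lemma chinese_seq (s : seq nat) (f : nat -> nat) :
  uniq s -> {in s &, forall p q, p != q -> coprime p q} ->
  exists a, forall p, p \in s -> a = f p %[mod p].
Proof.
elim: s => [|p s IH] /=; first by exists 0.
case/andP=> ps us cop; case: IH => // [x y xs ys|b Hb].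
  by apply: cop; rewrite inE ?xs ?ys orbT.
have cps : coprime p (\prod_(q <- s) q).
  rewrite coprime_sym big_seq; elim/big_ind: _ => [|x y|q qs]; first exact: coprime1n.
    by rewrite coprimeMl => -> ->.
  rewrite coprime_sym; apply: cop; rewrite ?inE ?eqxx ?qs ?orbT //.
  by apply: contraNneq ps => ->.
exists (chinese p (\prod_(q <- s) q) (f p) b) => q; rewrite inE => /predU1P[->|qs].
  exact: chinese_modl.
have qd : q %| \prod_(q <- s) q by rewrite (big_rem q) //= dvdn_mulr.
by rewrite -(Hb q qs) -(modn_dvdm _ qd) chinese_modr // modn_dvdm.
Qed.

(* The moduli that carry a symbol are the primes in a dyadic interval: every
   other modulus up to the end of that interval is coprime to all of them. *)
Lemma residues_encode K e codes : 0 < e -> K * e ^ 2 < 2 ^ e.-1 ->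
  size codes <= K -> all (fun c => 0 < c < K) codes ->
  exists a B, [/\ 0 < a, B <= 2 ^ e &
    [seq x <- [seq a %% m | m <- iota 1 B] | x != 0] = codes].
Proof.
move=> e0 He szc /allP codes_ok; have [i ie Ki] := dyadic_primes e0 He.
set S := [seq p <- iota (2 ^ i).+1 (2 ^ i) | prime p].
have SE p : (p \in S) = prime p && (2 ^ i < p <= 2 ^ i + 2 ^ i).
  by rewrite mem_filter mem_iota addSn ltnS.
have szS : K <= size S by rewrite size_filter.
set B := 2 ^ i + 2 ^ i.
set Q := \prod_(m <- iota 1 B | m \notin S) m.
have Q0 : 0 < Q.
  rewrite /Q big_seq_cond; elim/big_ind: _ => // [x y|m].
    by rewrite muln_gt0 => -> ->.
  by rewrite mem_iota => /andP[/andP[]].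
have copQ p : p \in S -> coprime p Q.
  rewrite SE => /and3P[pp p1 p2]; rewrite prime_coprime // /Q big_seq_cond.
  elim/big_ind: _ => [|x y|m]; first by rewrite dvdn1 neq_ltn prime_gt1 ?orbT.
    by rewrite Euclid_dvdM // negb_or => -> ->.
  rewrite mem_iota SE => /andP[/andP[m1 m2]]; apply: contra.
  case/dvdnP=> k mE; suff /eqP -> : m == p by rewrite pp p1.
  (* As [p] exceeds [2 ^ i], already [2 * p] exceeds [B]; the only multiple of [p] among the moduli
     is [p] itself, which belongs to [S]. *)
  have : k < 2 by rewrite /B in m2; nia.
  by case: k mE => [|[|]] // mE _; [rewrite mE in m1|rewrite mE mul1n].
have US : uniq S by rewrite filter_uniq ?iota_uniq.
have copS : {in S &, forall p q, p != q -> coprime p q}.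
  move=> p q; rewrite !SE => /and3P[pp _ _] /and3P[qq _ _] pq.
  by rewrite prime_coprime // dvdn_prime2.
have [b Hb] := chinese_seq (fun p => nth 0 codes (index p S)) US copS.
have copP : coprime (\prod_(p <- S) p) Q.
  rewrite big_seq; elim/big_ind: _ => [|x y|p pS]; first exact: coprime1n.
    by rewrite coprimeMl => -> ->.
  exact: copQ.
set P := \prod_(p <- S) p in copP.
have P0 : 0 < P.
  rewrite /P big_seq; elim/big_ind: _ => // [x y|p].
    by rewrite muln_gt0 => -> ->.
  by rewrite SE => /andP[/prime_gt0].
(* Adding [P * Q] changes no residue and makes [a] positive, so that a mark at [a] differs from the
   mark at cell 0. *)
pose a := chinese P Q b 0 + P * Q.
have aS p : p \in S -> a %% p = nth 0 codes (index p S).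
  move=> pS; have pP : p %| P by rewrite /P (big_rem p) //= dvdn_mulr.
  rewrite /a -modnDmr (eqP (dvdn_mulr _ pP)) addn0.
  rewrite -(modn_dvdm _ pP) chinese_modl // modn_dvdm // Hb // modn_small //.
  (* A code is smaller than [K <= size S <= 2 ^ i < p], hence equal to its residue modulo [p]. The
     primes left over after the last code get residue 0. *)
  case: (ltnP (index p S) (size codes)) => [lt|ge].
    have /andP[_ cK] := codes_ok _ (mem_nth 0 lt); apply: leq_trans cK _.
    move: pS; rewrite SE => /and3P[_ p1 _]; apply: leq_trans Ki _.
    by apply: leq_trans (count_size _ _) _; rewrite size_iota ltnW.
  by rewrite nth_default //; move: pS; rewrite SE => /andP[/prime_gt0].
have a0 m : m \in iota 1 B -> m \notin S -> a %% m = 0.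
  move=> mB mS; have mQ : m %| Q by rewrite /Q (big_rem m) //= mS dvdn_mulr.
  rewrite /a -modnDmr (eqP (dvdn_mull _ mQ)) addn0.
  by rewrite -(modn_dvdm _ mQ) chinese_modr // modn_dvdm // mod0n.
exists a, B; split; first by rewrite /a addn_gt0 muln_gt0 P0 Q0 orbT.
  by rewrite /B addnn -mul2n -expnS leq_pexp2l.
have E : [seq m <- iota 1 B | a %% m != 0] = [seq p <- S | a %% p != 0].
  rewrite /B iotaD filter_cat /S -filter_predI.
  have -> : [seq m <- iota 1 (2 ^ i) | a %% m != 0] = [::].
    apply/eqP; rewrite -(negbK (_ == _)) -has_filter; apply/hasPn => m mi.
    rewrite negbK; apply/eqP/a0; rewrite /B ?iotaD ?mem_cat ?mi // SE.
    by move: mi; rewrite mem_iota; lia.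
  rewrite cat0s add1n; apply: eq_in_filter => m mi /=.
  have [//|pm] := boolP (prime m); first by rewrite andbT.
  rewrite andbF; apply/negbTE; rewrite negbK; apply/eqP/a0.
    by rewrite /B iotaD mem_cat add1n mi orbT.
  by rewrite SE (negPf pm).
rewrite filter_map [filter _ _]E -(filter_map (modn a) (fun x => x != 0)).
have -> : [seq a %% m | m <- S] = [seq nth 0 codes j | j <- iota 0 (size S)].
  apply: (@eq_from_nth _ 0); first by rewrite !size_map size_iota.
  rewrite size_map => j jS; rewrite !(nth_map 0) ?size_iota // nth_iota // add0n.
  by rewrite aS ?mem_nth // index_uniq.
have -> : size S = size codes + (size S - size codes).
  by rewrite subnKC //; exact: leq_trans szc szS.
rewrite iotaD map_cat filter_cat.
have -> : [seq nth 0 codes j | j <- iota 0 (size codes)] = codes.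
  by apply: mkseq_nth.
rewrite (all_filterP _); last first.
  by apply/allP=> c /codes_ok /andP[]; rewrite lt0n.
rewrite -[RHS]cats0; congr (_ ++ _); apply/eqP.
rewrite -(negbK (_ == _)) -has_filter; apply/hasPn => c /mapP[j].
by rewrite mem_iota add0n => /andP[jc _] ->; rewrite nth_default.
Qed.

(** * Counters on input heads *)

(** The first digit satisfying [can] absorbs the carry and the digits before it wrap from [N.-1] to
    0; [N ^ c] is the overflow. [can] is abstract, and [r] and [r'] are merely related, so that a
    borrow is the same statement with [r] and [r'] exchanged. *)
Lemma ripple N (r r' : nat -> nat) (can : pred nat) c : 0 < N ->
  (forall l, l < c -> r' l = if has can (iota 0 l) then r l
                             else if can l then (r l).+1 else 0) ->
  (forall l, l < c -> ~~ has can (iota 0 l) -> ~~ can l -> r l = N.-1) ->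
  \sum_(l < c) r' l * N ^ l + (if has can (iota 0 c) then 0 else N ^ c) =
  (\sum_(l < c) r l * N ^ l).+1.
Proof.
move=> N0; elim: c => [|c IHc] Hr HN; first by rewrite !big_ord0.
have -> : has can (iota 0 c.+1) = has can (iota 0 c) || can c.
  by rewrite -addn1 iotaD has_cat /= orbF.
rewrite !big_ord_recr /= (Hr c (leqnn _)).
have := HN c (leqnn _).
have := IHc (fun l lc => Hr l (ltnW lc)) (fun l lc => HN l (ltnW lc)).
case: ifP => [_|_] /= IH HNc; first by rewrite !addn0 in IH *; lia.
case: ifP HNc => [cc _|cc ->] //; first by rewrite mulSn; lia.
by rewrite mul0n expnS; case: N N0 IH {Hr HN IHc} => // N _; rewrite mulSn /=; lia.
Qed.

Lemma digits_lt N c (f : 'I_c -> nat) :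
  (forall l, f l < N) -> \sum_(l < c) f l * N ^ l < N ^ c.
Proof.
elim: c f => [|c IH] f fN; first by rewrite big_ord0.
rewrite big_ord_recr /= expnS; apply: (@leq_trans ((f ord_max).+1 * N ^ c)).
  by rewrite mulSn ltn_add2r; apply: IH.
by rewrite leq_mul2r fN orbT.
Qed.

Section CounterMachine.

Variables (Sigma : finType) (Q I : finType) (dg : I -> nat).
Variable tr : Q -> {ffun I -> option bool} -> input_symbol Sigma -> bool ->
  Q * {ffun I -> move} * move * move.
Variables (ov : Q -> Q) (q0 : Q) (acc : {set Q}).

Record cconf := CConf {
  cq : Q; cv : {ffun I -> int}; chd : nat; cmem : nat }.

Definition cap (w : seq Sigma) i := (size w).+2 ^ dg i - 1.

Definition isgn (v : int) : option bool :=
  if v == 0%R then None else Some (0 < v)%R.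

Section Step.
Variables (w : seq Sigma) (mark : nat -> bool).

(** A step that would push a counter beyond its capacity is not performed and only changes the
    state, by [ov]. Reaching the bound is thus an event to which a program can react, which gives
    loops of polynomial length. *)
Definition cstep (c : cconf) : cconf :=
  let: (q', ds, dh, dm) :=
    tr (cq c) [ffun i => isgn (cv c i)] (read_input w (chd c)) (mark (cmem c)) in
  let v' := [ffun i => tm_move (ds i) (cv c i)] in
  if [forall i, `|v' i|%N <= cap w i]
  then CConf q' v' (move_head w dh (chd c)) (W2_move dm (cmem c))
  else CConf (ov (cq c)) (cv c) (chd c) (cmem c).

Definition cinit : cconf := CConf q0 [ffun=> 0%R] 0 0.
Definition caccepts c := exists t, cq (iter t cstep c) \in acc.

End Step.

Local Notation J := {i : I & 'I_(dg i)}.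
Local Notation h := #|{: option J}|.
Local Notation hd j := (enum_rank (j : option J)).

Definition at_left (s : input_symbol Sigma) := if s is LeftEnd then true else false.
Definition at_right (s : input_symbol Sigma) := if s is RightEnd then true else false.

(* A counter is stored in base [size w + 2], one head per digit; the direction
   bit of a digit tells whether the digit is the head position or its
   complement, so a carry flips bits instead of moving heads back. *)
Definition can_move up (d : bool) (s : input_symbol Sigma) :=
  if up == d then ~~ at_right s else ~~ at_left s.

Definition qs := (Q * {ffun I -> bool} * {ffun J -> bool})%type.

Section Trans.
Variables (sg : {ffun I -> bool}) (dr : {ffun J -> bool}).
Variable (s : {ffun 'I_h -> input_symbol Sigma}).

Definition canj up (j : J) := can_move up (dr j) (s (hd (Some j))).
Definition can_i up i := [exists l : 'I_(dg i), canj up (Tagged _ l)].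
Definition touched up (j : J) :=
  [forall l : 'I_(dg (tag j)), (l < tagged j) ==> ~~ canj up (Tagged _ l)].
Definition sgn_i i := if can_i false i then Some (sg i) else None.

(** A counter is a sign and a magnitude, and 0 may carry either sign. The result tells whether the
    magnitude grows; from 0 it grows in both directions, so the sign bit counts only together with
    [can_i false i], a nonzero magnitude. *)
Definition op_i (d : move) i : option bool :=
  match d with
  | MStay => None
  | MRight => Some (sg i || ~~ can_i false i)
  | MLeft => Some (~~ (sg i && can_i false i))
  end.

Definition new_sg (d : move) i :=
  match d with
  | MStay => sg i
  | MRight => sg i || ~~ can_i false i
  | MLeft => sg i && can_i false i
  end.

Definition ok_i d i := if op_i d i is Some up then can_i up i else true.

Definition new_dr (ds : {ffun I -> move}) (j : J) :=
  if op_i (ds (tag j)) (tag j) is Some up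
  then dr j (+) (touched up j && ~~ canj up j) else dr j.

Definition head_mv (ds : {ffun I -> move}) (j : J) : move :=
  if op_i (ds (tag j)) (tag j) is Some up
  then if touched up j && canj up j then (if up == dr j then MRight else MLeft)
       else MStay
  else MStay.
End Trans.

Definition ctrans (q : qs) (s : {ffun 'I_h -> input_symbol Sigma}) (m : option unit) :
    qs * {ffun 'I_h -> move} * move :=
  let: (q, sg, dr) := q in
  let: (q', ds, dh, dm) := tr q [ffun i => sgn_i sg dr s i] (s (hd None)) (isSome m) in
  if [forall i, ok_i sg dr s (ds i) i]
  then ((q', [ffun i => new_sg sg dr s (ds i) i], [ffun j => new_dr sg dr s ds j]),
        [ffun a : 'I_h => if enum_val a is Some j then head_mv sg dr s ds j else dh], dm)
  else ((ov q, sg, dr), [ffun _ : 'I_h => MStay], MStay).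

Definition cautomaton : automaton Sigma h :=
  @Automaton Sigma h qs unit ctrans (q0, [ffun=> true], [ffun=> true])
    [set q | q.1.1 \in acc].

Section Simulation.
Variables (w : seq Sigma) (mu : memory_content unit).
Let mark c := isSome (mu c).
Let N := (size w).+2.

Definition rv (d : bool) (p : nat) := if d then p else N.-1 - p.

Definition gval (dr : {ffun J -> bool}) (hs : {ffun 'I_h -> nat}) i :=
  \sum_(l < dg i) rv (dr (Tagged _ l)) (hs (hd (Some (Tagged _ l)))) * N ^ l.

Definition sval (b : bool) (v : nat) : int := if b then Posz v else (- Posz v)%R.

Definition simul (c : configuration cautomaton) (d : cconf) :=
  let: (q, sg, dr) := cstate c in
  [/\ q = cq d, (forall a, cheads c a < N),
      forall i, cv d i = sval (sg i) (gval dr (cheads c) i),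
      cheads c (hd None) = chd d & ccell c = cmem d].

Lemma read_left p : at_left (read_input w p) = (p == 0).
Proof.
rewrite /read_input; case: p => [|p] //=.
case: (ltnP p (size w)) => pw; last by rewrite nth_default ?size_map.
elim: w p pw => //= x s IH [|p] //= /IH; exact.
Qed.

Lemma read_right p : p < N -> at_right (read_input w p) = (p == N.-1).
Proof.
rewrite /read_input /N; case: p => [|p] //= pN; rewrite eqSS.
case: (ltnP p (size w)) => pw.
  rewrite ltn_eqF //; elim: w p pw {pN} => //= x s IH [|p] //= /IH; exact.
rewrite nth_default ?size_map //=; lia.
Qed.

Lemma canjE dr (hs : {ffun 'I_h -> nat}) (up : bool) (j : J) :
  (forall a, hs a < N) ->
  canj dr [ffun a : 'I_h => read_input w (hs a)] up j =
  if up == dr j then hs (hd (Some j)) < N.-1 else 0 < hs (hd (Some j)).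
Proof.
move=> hN; rewrite /canj /can_move ffunE read_left read_right //.
by case: ifP => _; [have := hN (hd (Some j)); rewrite /N /=; lia|lia].
Qed.

Section Counter.
Variables (sg : {ffun I -> bool}) (dr : {ffun J -> bool}) (hs : {ffun 'I_h -> nat}).
Hypothesis hN : forall a, hs a < N.
Variable ds : {ffun I -> move}.
Let s := [ffun a : 'I_h => read_input w (hs a)].
Let hs' : {ffun 'I_h -> nat} := [ffun a : 'I_h =>
  if enum_val a is Some j then move_head w (head_mv sg dr s ds j) (hs a) else 0].
Let dr' : {ffun J -> bool} := [ffun j => new_dr sg dr s ds j].

Let ex {i} (f : 'I_(dg i) -> nat) l := if insub l is Some l' then f l' else 0.
Let exb {i} (f : pred 'I_(dg i)) l := if insub l is Some l' then f l' else false.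

Lemma has_exb i (f : pred 'I_(dg i)) (c : nat) : c <= dg i ->
  has (exb f) (iota 0 c) = ~~ [forall l : 'I_(dg i), (l < c) ==> ~~ f l].
Proof.
move=> ci; rewrite negb_forall; apply/hasP/existsP => [[l]|[l]].
  rewrite mem_iota add0n /exb /= => lc; case: insubP => // l' _ E fl.
  by exists l'; rewrite negb_imply E lc negbK.
rewrite negb_imply negbK => /andP[lc fl]; exists (val l); rewrite ?mem_iota //.
by rewrite /exb valK.
Qed.

(** Both cases are instances of [ripple] on the digits as seen through the direction bits, with old
    and new digits exchanged when counting down. [ex] and [exb] extend families on ['I_(dg i)] to
    [nat]. *)
Lemma gval_up i up : op_i sg dr s (ds i) i = Some up ->
  if up then gval dr' hs' i + (if can_i dr s true i then 0 else N ^ dg i)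
             = (gval dr hs i).+1
  else gval dr hs i + (if can_i dr s false i then 0 else N ^ dg i)
             = (gval dr' hs' i).+1.
Proof.
move=> opi.
pose r (l : 'I_(dg i)) := rv (dr (Tagged _ l)) (hs (hd (Some (Tagged _ l)))).
pose r' (l : 'I_(dg i)) := rv (dr' (Tagged _ l)) (hs' (hd (Some (Tagged _ l)))).
pose cn (l : 'I_(dg i)) := canj dr s up (Tagged _ l).
have S f : \sum_(l < dg i) f l * N ^ l = \sum_(l < dg i) ex f l * N ^ l.
  by apply: eq_bigr => l _; rewrite /ex valK.
have canE : has (exb cn) (iota 0 (dg i)) = can_i dr s up i.
  rewrite has_exb // negb_forall; apply: eq_existsb => l.
  by rewrite ltn_ord negbK.
have tE (l : 'I_(dg i)) : has (exb cn) (iota 0 l) = ~~ touched dr s up (Tagged _ l).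
  by rewrite has_exb // ltnW.
have new (l : 'I_(dg i)) :
    [/\ ~~ touched dr s up (Tagged _ l) -> r' l = r l,
        touched dr s up (Tagged _ l) -> cn l ->
          if up then r' l = (r l).+1 else r l = (r' l).+1 &
        touched dr s up (Tagged _ l) -> ~~ cn l ->
          if up then r l = N.-1 /\ r' l = 0 else r' l = N.-1 /\ r l = 0].
  rewrite /r' /r /cn /dr' /hs' !ffunE enum_rankK /new_dr /head_mv /= opi.
  have := hN (hd (Some (Tagged (fun i => 'I_(dg i)) l))).
  rewrite canjE // /rv; set p := hs _; set d := dr _ => pN.
  have NE : (size w).+1 = N.-1 by [].
  case: (touched _ _ _ _) => /=; split=> //; rewrite ?addbF //.
  - by case: up {opi cn canE tE} d => [] [] /= _ H; rewrite ?H /= ?NE; lia.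
  - by case: up {opi cn canE tE} d => [] [] /= _ H; rewrite ?(negPf H) /= ?NE; lia.
case: up opi @cn canE tE new => opi cn canE tE new.
- rewrite -canE /gval S [in RHS]S; apply: ripple => // l ld.
    rewrite -[l]/(val (Ordinal ld)) tE /ex /exb valK.
    have [n1 n2 n3] := new (Ordinal ld).
    case: (boolP (touched _ _ _ _)) => tl /=; last exact: n1.
    by case: ifPn => cl; [apply: n2|case: n3].
  rewrite -[l]/(val (Ordinal ld)) tE /ex /exb valK negbK => tl cl.
  by have [_ _ /(_ tl cl) []] := new (Ordinal ld).
- rewrite -canE /gval S [in RHS]S; apply: ripple => // l ld.
    rewrite -[l]/(val (Ordinal ld)) tE /ex /exb valK.
    have [n1 n2 n3] := new (Ordinal ld).
    case: (boolP (touched _ _ _ _)) => tl /=; last exact/esym/n1.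
    by case: ifPn => cl; [apply: n2|case: n3].
  rewrite -[l]/(val (Ordinal ld)) tE /ex /exb valK negbK => tl cl.
  by have [_ _ /(_ tl cl) []] := new (Ordinal ld).
Qed.

Lemma gval_stay i : op_i sg dr s (ds i) i = None -> gval dr' hs' i = gval dr hs i.
Proof.
move=> opi; apply: eq_bigr => l _; rewrite /dr' /hs' !ffunE enum_rankK.
by rewrite /new_dr /head_mv /= opi.
Qed.

End Counter.

Lemma gval_lt i (d : {ffun J -> bool}) (p : {ffun 'I_h -> nat}) :
  (forall a, p a < N) -> gval d p i < N ^ dg i.
Proof.
move=> pN; apply: digits_lt => l; have := pN (hd (Some (Tagged _ l))).
by rewrite /rv; case: ifP => _; rewrite /N; lia.
Qed.

Lemma eq_gval i d (p p' : {ffun 'I_h -> nat}) :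
  (forall j : J, p (hd (Some j)) = p' (hd (Some j))) -> gval d p i = gval d p' i.
Proof. by move=> E; apply: eq_bigr => l _; rewrite E. Qed.

Lemma isgn_sval b v : isgn (sval b v) = if v == 0 then None else Some b.
Proof. by case: v b => [|v] []. Qed.

Lemma simul_step c d : simul c d -> simul (@step Sigma h cautomaton w mu c) (cstep w mark d).
Proof.
case: c d => [[[q sg] dr] hs m] [dq dv dh dm]; rewrite {1}/simul /=.
case=> -> hN vE hh ->.
rewrite /step /cstep /= /ctrans.
set s := [ffun i => read_input w (hs i)].
have canF i : can_i dr s false i = (gval dr hs i != 0).
  apply/existsP/idP => [[l cl]|nz].
    rewrite -lt0n /gval (bigD1 l) //= addn_gt0 muln_gt0 expn_gt0 /= andbT.
    move: cl; rewrite canjE //= /rv; have := hN (hd (Some (Tagged (fun i => 'I_(dg i)) l))).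
    by case: (dr _) => /= H1 H2; rewrite /N in H1 H2 *; lia.
  apply/existsP; apply: contraR nz; rewrite negb_exists => /forallP nc.
  apply/eqP; rewrite /gval big1 // => l _.
  have := nc l; rewrite canjE //= /rv; have := hN (hd (Some (Tagged (fun i => 'I_(dg i)) l))).
  move=> H1 H2; apply/eqP; rewrite muln_eq0; apply/orP; left; move: H1 H2.
  by case: (dr _) => /= H1 H2; rewrite /N in H1 H2 *; lia.
have -> : [ffun i => isgn (dv i)] = [ffun i => sgn_i sg dr s i].
  by apply/ffunP => i; rewrite !ffunE vE isgn_sval /sgn_i canF; case: eqP.
have -> : s (hd None) = read_input w dh by rewrite ffunE hh.
case: (tr _ _ _ _) => [[[q' ds] dh'] dm'].
pose hs' : {ffun 'I_h -> nat} := [ffun a : 'I_h =>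
  if enum_val a is Some j then move_head w (head_mv sg dr s ds j) (hs a) else 0].
pose dr' : {ffun J -> bool} := [ffun j => new_dr sg dr s ds j].
have hN' a : hs' a < N.
  rewrite ffunE; case: (enum_val a) => // j; have := hN a; rewrite /N.
  by case: (head_mv _ _ _ _ _) => /=; lia.
(* Whether a carry finds a digit that can move is the same question as whether the new value
   respects the capacity: in [gval_up] the overflow contributes [N ^ dg i]. *)
have key i : ok_i sg dr s (ds i) i = (`|tm_move (ds i) (dv i)|%N <= cap w i) /\
    (ok_i sg dr s (ds i) i ->
     tm_move (ds i) (dv i) = sval (new_sg sg dr s (ds i) i) (gval dr' hs' i)).
  have up := @gval_up sg dr hs hN ds i; have st := @gval_stay sg dr hs ds i.
  have lt := gval_lt i dr hN; have lt' := gval_lt i dr' hN'.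
  rewrite -/hs' -/dr' -/s in up st.
  rewrite vE /cap -/N /ok_i; move: up st; rewrite /op_i /new_sg.
  have cF := canF i; rewrite cF; set v := gval dr hs i in lt cF *.
  set v' := gval dr' hs' i in lt' *.
  case: (ds i) => /= [/(_ _ erefl) + _|_ /(_ erefl) ->|/(_ _ erefl) + _].
  - case: (sg i) => /=; last first.
      by case: (can_i dr s true i) => U; split=> [|H]; rewrite /sval /=; lia.
    case: (v =P 0) => v0 /= U; last by rewrite cF; split=> [|H]; rewrite /sval /=; lia.
    by case: (can_i dr s true i) U => U; split=> [|H]; rewrite /sval /=; lia.
  - by split=> //; case: (sg i); rewrite /sval; lia.
  - case: (sg i) => /=.
      by case: (can_i dr s true i) => U; split=> [|H]; rewrite /sval /=; lia.
    case: (v =P 0) => v0 /= U; last by rewrite cF; split=> [|H]; rewrite /sval /=; lia.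
    by case: (can_i dr s true i) U => U; split=> [|H]; rewrite /sval /=; lia.
have -> : [forall i, `|[ffun i => tm_move (ds i) (dv i)] i|%N <= cap w i] =
          [forall i, ok_i sg dr s (ds i) i].
  by apply: eq_forallb => i; rewrite ffunE; case: (key i) => ->.
case: ifP => [/forallP allok|_]; last first.
  split=> //= [a|i|]; rewrite ?ffunE //= vE; congr sval.
  by apply: eq_gval => j; rewrite !ffunE.
split=> //= [a|i|].
- rewrite !ffunE; case: (enum_val a) => [j|]; last first.
    by have := hN a; rewrite /N; case: (dh') => /=; lia.
  by have := hN a; rewrite /N; case: (head_mv _ _ _ _ _) => /=; lia.
- rewrite !ffunE; case: (key i) => _ -> //; congr sval.
  by apply: eq_gval => j; rewrite !ffunE enum_rankK.
- by rewrite !ffunE enum_rankK hh.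
Qed.

Lemma simul_init : simul (initial cautomaton) cinit.
Proof.
split=> //= [a|i|]; rewrite ?ffunE //= /gval big1 // => l _.
by rewrite !ffunE mul0n.
Qed.

Lemma cautomaton_accepts :
  @run_accepts Sigma h cautomaton w mu <-> caccepts w mark cinit.
Proof.
have S t : simul (iter t (@step Sigma h cautomaton w mu) (initial cautomaton))
                 (iter t (cstep w mark) cinit).
  by elim: t => [|t IH]; [exact: simul_init|rewrite !iterS; apply: simul_step].
by split=> -[t Ht]; exists t; move: (S t) Ht; rewrite /simul;
  case: (cstate _) => [[q sg] dr] [-> _ _ _ _]; rewrite inE.
Qed.

End Simulation.
End CounterMachine.

(** * A deterministic check of a guessed computation *)

Section Program.
Variables (Sigma : finType) (m : nat) (M : ntm Sigma m) (dg : nat).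

Local Notation T := 'I_m.+1.
Local Notation S := (tape_symbol Sigma (tm_aux M)).
Definition instr := ({ffun T -> S} * (tm_state M * {ffun T -> S * move}))%type.
Local Notation C := #|{: instr}|.

(** Ranks are shifted by one so that residue 0 means no instruction. Residues above [C] are ignored
    as well, so a count of the residue may saturate at [C.+1]. *)
Definition decode (r : nat) : option instr :=
  if r is r'.+1 then omap enum_val (insub r' : option 'I_C) else None.

Lemma decode_inord r : decode (inord (minn r C.+1) : 'I_C.+2) = decode r.
Proof.
rewrite inordK; last by lia.
case: (leqP r C.+1) => // rC; case: r rC => // r rC /=.
by rewrite !insubN // -leqNgt; lia.
Qed.

Definition ctl := (bool * bool * bool)%type.
Definition swp := (ctl * tm_state M * {ffun T -> S})%type.

(* [ctl] is (phase of negative cells, direction of the next walk, register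
   that counts up); [swp] adds the simulated state and the symbols that the
   tapes carry at the cell under inspection. *)
Inductive pstate :=
  | Dead | Acc | Init | Seek
  | Begin of ctl | Next of swp | Walk of swp & bool | Drain of swp & 'I_C.+2
  | Fin of ctl | NextX of ctl | Back of ctl.

Definition pcode (q : pstate) :=
  match q with
  | Dead => inl (0 : 'I_4) | Acc => inl (1 : 'I_4) | Init => inl (2 : 'I_4)
  | Seek => inl (3 : 'I_4)
  | Begin c => inr (inl (0 : 'I_4, c)) | Fin c => inr (inl (1 : 'I_4, c))
  | NextX c => inr (inl (2 : 'I_4, c)) | Back c => inr (inl (3 : 'I_4, c))
  | Next d => inr (inr (inl d))
  | Walk d b => inr (inr (inr (inl (d, b))))
  | Drain d n => inr (inr (inr (inr (d, n))))
  end%R.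

Definition pdecode (c : 'I_4 + ('I_4 * ctl + (swp + (swp * bool + swp * 'I_C.+2)))) :=
  match c with
  | inl i => match val i with 0 => Dead | 1 => Acc | 2 => Init | _ => Seek end
  | inr (inl (i, c)) =>
      match val i with 0 => Begin c | 1 => Fin c | 2 => NextX c | _ => Back c end
  | inr (inr (inl d)) => Next d
  | inr (inr (inr (inl (d, b)))) => Walk d b
  | inr (inr (inr (inr (d, n)))) => Drain d n
  end.

Lemma pcodeK : cancel pcode pdecode. Proof. by case. Qed.
HB.instance Definition _ := Finite.copy pstate (can_type pcodeK).

(** The inspected cell ([rX]), the two parts of the current modulus ([rM]), the positions of the
    tape heads ([rP]) and their differences from the inspected cell ([rD]). The differences have
    registers of their own because only signs of registers can be tested. *)
Definition reg := (option bool + (T + T))%type.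
Definition rX : reg := inl None.
Definition rM (b : bool) : reg := inl (Some b).
Definition rP (j : T) : reg := inr (inl j).
Definition rD (j : T) : reg := inr (inr j).

(** The difference of two numbers bounded by the capacity may be twice as large; as the base is at
    least 2, one more digit is enough. *)
Definition digits (r : reg) : nat := if r is inr (inr _) then dg.+1 else dg.

Definition mv (x : move) (b : bool) (lo hi : move) (P D : T -> move) :
    {ffun reg -> move} :=
  [ffun r => match r with
   | inl None => x
   | inl (Some b') => if b' == b then lo else hi
   | inr (inl j) => P j
   | inr (inr j) => D j
   end].

Definition mv0 := mv MStay false MStay MStay (fun=> MStay) (fun=> MStay).

Definition letter_of (s : input_symbol Sigma) : S :=
  if s is Letter a then Some (inl a) else None.

Definition to0 (s : option bool) : move :=
  match s with None => MStay | Some true => MLeft | Some false => MRight end.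

Definition ptrans (q : pstate) (sg : {ffun reg -> option bool})
    (s : input_symbol Sigma) (mk : bool) : pstate * {ffun reg -> move} * move * move :=
  match q with
  | Dead => (Dead, mv0, MStay, MStay)
  | Acc => (Acc, mv0, MStay, MStay)
  | Init => (if mk then Seek else Dead, mv0, MStay, MRight)
  | Seek => if mk then (Begin (false, false, false), mv0, MRight, MStay)
            else (Seek, mv0, MStay, MRight)
  | Begin (neg, wd, o) =>
      (Next (neg, wd, o, tm_start M,
             [ffun j => if (j == ord0) && ~~ neg then letter_of s else None]),
       mv0, MStay, MStay)
  | Next (c, q, f) =>
      if q \in tm_accepting M then (Fin c, mv0, MStay, MStay)
      else (Walk (c, q, f) true,
            mv MStay c.2 MStay MRight (fun=> MStay) (fun=> MStay), MStay, MStay)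
  | Walk (neg, wd, o, q, f) first =>
      if sg (rM (~~ o)) == None then (Walk (neg, wd, ~~ o, q, f) first, mv0, MStay, MStay)
      else if mk && ~~ first then (Drain (neg, ~~ wd, o, q, f) ord0, mv0, MStay, MStay)
      else (Walk (neg, wd, o, q, f) false,
            mv MStay o MRight MLeft (fun=> MStay) (fun=> MStay), MStay,
            if wd then MRight else MLeft)
  | Drain (c, q, f) n =>
      if sg (rM c.2) == None then
        if decode n is Some (r, a) then
          if (a \in tm_trans q r) &&
             [forall j, (sg (rD j) == None) ==> (r j == f j)]
          then (Next (c, a.1, [ffun j => if sg (rD j) == None then (a.2 j).1 else f j]),
                mv MStay c.2 MStay MStay (fun j => (a.2 j).2) (fun j => (a.2 j).2),
                MStay, MStay)
          else (Dead, mv0, MStay, MStay)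
        else (Next (c, q, f), mv0, MStay, MStay)
      else (Drain (c, q, f) (inord (minn n.+1 C.+1)),
            mv MStay c.2 MLeft MRight (fun=> MStay) (fun=> MStay), MStay, MStay)
  | Fin c =>
      if (sg (rM (~~ c.2)) == None) && [forall j, sg (rP j) == None]
      then (NextX c, mv0, MStay, MStay)
      else (Fin c, mv MStay c.2 MStay (to0 (sg (rM (~~ c.2))))
                      (fun j => to0 (sg (rP j))) (fun j => to0 (sg (rP j))), MStay, MStay)
  | NextX (neg, wd, o) =>
      (Begin (neg, wd, o),
       mv (if neg then MLeft else MRight) o MStay MStay (fun=> MStay)
          (fun=> if neg then MRight else MLeft),
       if neg then MStay else MRight, MStay)
  | Back (neg, wd, o) =>
      if sg rX == None then (NextX (true, wd, o), mv0, MStay, MStay)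
      else (Back (neg, wd, o),
            mv MLeft o MStay MStay (fun=> MStay) (fun=> MRight), MStay, MStay)
  end.

(** Overflow of [rX] ends a phase: after the nonnegative cells the program returns to 0 for the
    negative ones, and after those every cell has passed. Overflow elsewhere, from an exhausted
    modulus or a tape head out of range, rejects. *)
Definition pov (q : pstate) : pstate :=
  match q with
  | Acc => Acc
  | NextX (neg, wd, o) => if neg then Acc else Back (neg, wd, o)
  | _ => Dead
  end.

Section Run.
Variables (w : seq Sigma) (mark : nat -> bool).
Let N := (size w).+2.
Let Cap := N ^ dg - 1.
Local Notation pconf := (cconf pstate reg).
Local Notation pstep := (cstep digits ptrans pov w mark).
Definition paccepts (c : pconf) := caccepts digits ptrans pov [set Acc] w mark c.
Definition preach (c c' : pconf) := exists t, iter t pstep c = c'.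

Lemma preach_refl c : preach c c. Proof. by exists 0. Qed.
Lemma preach_trans c1 c2 c3 : preach c1 c2 -> preach c2 c3 -> preach c1 c3.
Proof. by move=> [t1 <-] [t2 <-]; exists (t2 + t1); rewrite iterD. Qed.
Lemma preach_step c c' : preach (pstep c) c' -> preach c c'.
Proof. by move=> [t <-]; exists t.+1; rewrite iterSr. Qed.

Lemma pstep_sink c : cq c = Acc \/ cq c = Dead -> cq (pstep c) = cq c.
Proof. by rewrite /cstep; case=> -> /=; case: ifP. Qed.

Lemma paccepts_step c : paccepts (pstep c) <-> paccepts c.
Proof.
split=> -[t Ht]; first by exists t.+1; rewrite iterSr.
case: t Ht => [|t]; last by rewrite iterSr; exists t.
by rewrite inE => /eqP /= E; exists 0; rewrite inE /= pstep_sink ?E //; left.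
Qed.

Lemma preach_accepts c c' : preach c c' -> (paccepts c <-> paccepts c').
Proof.
by case=> t <-; elim: t => // t IH; rewrite iterS paccepts_step.
Qed.

Lemma paccepts_dead c : cq c = Dead -> ~ paccepts c.
Proof.
move=> cD [t]; have -> : cq (iter t pstep c) = Dead; last by rewrite inE.
by elim: t => // t IH; rewrite iterS pstep_sink ?IH //; right.
Qed.

(** [lo] is the content of the register [o] that counts up and [hi] that of the other one, so a swap
    of roles is [mkv_neg]. The registers [rD] are computed, which builds their invariant into the
    notation. *)
Definition mkv o (x lo hi : int) (P : T -> int) : {ffun reg -> int} :=
  [ffun r => match r with
   | inl None => x
   | inl (Some b) => if b == o then lo else hi
   | inr (inl j) => P j
   | inr (inr j) => (P j - x)%R
   end].

Lemma mkv_neg o x lo hi P : mkv (~~ o) x lo hi P = mkv o x hi lo P.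
Proof. by apply/ffunP => -[[[]|]|[j|j]]; rewrite !ffunE //; case: o. Qed.

Lemma eq_mkv o x lo hi P P' : P =1 P' -> mkv o x lo hi P = mkv o x lo hi P'.
Proof. by move=> E; apply/ffunP => -[[b|]|[j|j]]; rewrite !ffunE ?E. Qed.

Definition inb (x lo hi : int) (P : T -> int) :=
  [&& `|x|%N <= Cap, `|lo|%N <= Cap, `|hi|%N <= Cap & [forall j, `|P j|%N <= Cap]].

Lemma mkv_cap o x lo hi P :
  [forall r, `|mkv o x lo hi P r|%N <= cap digits w r] = inb x lo hi P.
Proof.
apply/forallP/and4P => [H|[Hx Hl Hh /forallP HP]].
  have Hb b := H (rM b); have := H rX; rewrite ffunE /= => HX.
  split=> //.
  - by have := Hb o; rewrite ffunE /= eqxx.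
  - by have := Hb (~~ o); rewrite ffunE /=; case: (o).
  - by apply/forallP => j; have := H (rP j); rewrite ffunE.
have N1 : 0 < N ^ dg by rewrite expn_gt0.
have N2 : 2 * N ^ dg <= N ^ dg.+1 by rewrite expnS leq_mul2r orbC.
case=> [[b|]|[j|j]]; rewrite ffunE /=; [by case: ifP|exact: Hx|exact: HP|].
by have := HP j; rewrite /cap /= -/N; rewrite /Cap in Hx *; lia.
Qed.

Definition pc q o x lo hi P hd mem : pconf := CConf q (mkv o x lo hi P) hd mem.

Lemma pstepE q o x lo hi P hd mem :
  pstep (pc q o x lo hi P hd mem) =
  let: (q', ds, dh, dm) :=
    ptrans q [ffun r => isgn (mkv o x lo hi P r)] (read_input w hd) (mark mem) in
  let v' := [ffun r => tm_move (ds r) (mkv o x lo hi P r)] in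
  if [forall r, `|v' r|%N <= cap digits w r]
  then CConf q' v' (move_head w dh hd) (W2_move dm mem)
  else CConf (pov q) (mkv o x lo hi P) hd mem.
Proof. by []. Qed.

Lemma move_mkv o x lo hi P dx dlo dhi (dP dD : T -> move) :
  (forall j, tm_move (dD j) (P j - x) = (tm_move (dP j) (P j) - tm_move dx x)%R) ->
  [ffun r => tm_move (mv dx o dlo dhi dP dD r) (mkv o x lo hi P r)] =
  mkv o (tm_move dx x) (tm_move dlo lo) (tm_move dhi hi) (fun j => tm_move (dP j) (P j)).
Proof.
by move=> E; apply/ffunP => -[[b|]|[j|j]]; rewrite !ffunE //; case: ifP.
Qed.

Lemma move_mkv0 o x lo hi P :
  [ffun r => tm_move (mv0 r) (mkv o x lo hi P r)] = mkv o x lo hi P.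
Proof. by apply/ffunP => -[[b|]|[j|j]]; rewrite !ffunE //; case: ifP. Qed.

Lemma isgn0 v : (isgn v == None) = (v == 0%R).
Proof. by rewrite /isgn; case: ifP. Qed.

Section Signs.
Variables (o : bool) (x lo hi : int) (P : T -> int).
Let sg := [ffun r => isgn (mkv o x lo hi P r)].
Lemma sg_lo : sg (rM o) = isgn lo. Proof. by rewrite !ffunE /= eqxx. Qed.
Lemma sg_hi : sg (rM (~~ o)) = isgn hi. Proof. by rewrite !ffunE /=; case: (o). Qed.
Lemma sg_X : sg rX = isgn x. Proof. by rewrite !ffunE. Qed.
Lemma sg_P j : sg (rP j) = isgn (P j). Proof. by rewrite !ffunE. Qed.
Lemma sg_D j : (sg (rD j) == None) = (P j == x).
Proof. by rewrite !ffunE isgn0 subr_eq0. Qed.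
End Signs.
Definition sgE := (sg_lo, sg_hi, sg_X, sg_P, sg_D, isgn0).

Lemma step_mv q q' o x lo hi P hd mem dx dlo dhi (dP dD : T -> move) dh dm :
  ptrans q [ffun r => isgn (mkv o x lo hi P r)] (read_input w hd) (mark mem) =
    (q', mv dx o dlo dhi dP dD, dh, dm) ->
  (forall j, tm_move (dD j) (P j - x) = (tm_move (dP j) (P j) - tm_move dx x)%R) ->
  pstep (pc q o x lo hi P hd mem) =
  if inb (tm_move dx x) (tm_move dlo lo) (tm_move dhi hi)
         (fun j => tm_move (dP j) (P j))
  then pc q' o (tm_move dx x) (tm_move dlo lo) (tm_move dhi hi)
          (fun j => tm_move (dP j) (P j)) (move_head w dh hd) (W2_move dm mem)
  else pc (pov q) o x lo hi P hd mem.
Proof. by move=> E ED; rewrite pstepE E /= move_mkv // mkv_cap. Qed.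

Lemma step_mv0 q q' o x lo hi P hd mem dh dm :
  ptrans q [ffun r => isgn (mkv o x lo hi P r)] (read_input w hd) (mark mem) =
    (q', mv0, dh, dm) -> inb x lo hi P ->
  pstep (pc q o x lo hi P hd mem) =
  pc q' o x lo hi P (move_head w dh hd) (W2_move dm mem).
Proof. by move=> E inP; rewrite pstepE E /= move_mkv0 mkv_cap inP. Qed.

Lemma inbE x (lo hi : nat) P : inb x lo hi P ->
  forall lo' hi' : nat, lo' <= Cap -> hi' <= Cap -> inb x lo' hi' P.
Proof. by case/and4P=> Hx _ _ HP lo' hi' Hl Hh; apply/and4P. Qed.

Lemma inb0 b (x : nat) : x <= Cap -> inb (sval b x) 0%N 0%N (fun=> 0%R).
Proof.
move=> xC; apply/and4P; split=> //; last by apply/forallP.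
by rewrite /sval; case: b => /=; lia.
Qed.

Lemma cinitE : cinit reg Init = pc Init false 0%N 0%N 0%N (fun=> 0%R) 0 0.
Proof.
by congr CConf; apply/ffunP => -[[b|]|[j|j]]; rewrite !ffunE //; case: ifP.
Qed.

(** [Init] rejects if cell 0 is unmarked, and [Seek] runs to the right forever if there is no second
    mark. *)
Lemma accepts_marks : paccepts (cinit reg Init) -> mark 0 /\ exists i, (0 < i) && mark i.
Proof.
rewrite cinitE -paccepts_step.
have [m0|m0] := boolP (mark 0); last first.
  rewrite (@step_mv0 _ Dead _ _ _ _ _ _ _ MStay MRight); first by move/paccepts_dead.
    by rewrite /= (negPf m0).
  exact: (@inb0 true 0).
rewrite (@step_mv0 _ Seek _ _ _ _ _ _ _ MStay MRight); first last.
- exact: (@inb0 true 0).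
- by rewrite /= m0.
case=> t Ht; split=> //.
case: (boolP [exists i : 'I_t.+1, mark i.+1]) => [/existsP[i mi]|]; first by exists i.+1.
rewrite negb_exists => /forallP nm; exfalso; move: Ht; rewrite /=.
have -> : iter t pstep (pc Seek false 0%N 0%N 0%N (fun=> 0%R) 0 1) =
          pc Seek false 0%N 0%N 0%N (fun=> 0%R) 0 t.+1; last by rewrite inE.
have /(_ t (leqnn _)) : forall j, j <= t ->
  iter j pstep (pc Seek false 0%N 0%N 0%N (fun=> 0%R) 0 1) =
  pc Seek false 0%N 0%N 0%N (fun=> 0%R) 0 j.+1; last by [].
elim=> // j IH jt; rewrite iterS IH; last by lia.
rewrite (@step_mv0 _ Seek _ _ _ _ _ _ _ MStay MRight) //.
  by rewrite /= (negPf (nm (Ordinal (ltnW jt : j < t.+1)))).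
exact: (@inb0 true 0).
Qed.

Variable a : nat.
Hypotheses (a0 : 0 < a) (mark0 : mark 0) (marka : mark a).
Hypothesis markN : forall i, 0 < i < a -> ~~ mark i.

(** The cell reached [i] steps after leaving a mark. By [markN] a walk stops at the opposite end of
    the stretch from 0 to [a], whatever marks lie further right. *)
Definition pos (wd : bool) i := if wd then i else a - i.

Section Walk.
Variables (neg : bool) (q : tm_state M) (f : {ffun T -> S}).
Variables (x : int) (P : T -> int) (hd : nat).
Variable (mo : nat).
Hypotheses (mo0 : 0 < mo) (moC : mo <= Cap) (inP : inb x 0 0 P).

(** [Walk] tests for an empty register before it tests for a mark. A full count has therefore become
    0 when the walk ends, and [Drain] starts from a residue smaller than the modulus. *)
Lemma walk_loop wd k i o : i + k = a -> exists o',
  preach (pc (Walk (neg, wd, o, q, f) (i == 0)) o x (i %% mo)%N (mo - i %% mo)%N P hd (pos wd i))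
    (pc (Drain (neg, ~~ wd, o', q, f) ord0) o' x (a %% mo)%N (mo - a %% mo)%N P hd (pos wd a)).
Proof.
elim: k i o => [|k IH] i o; rewrite ?addn0 ?addnS => iE.
  exists o; subst i; apply: preach_step; have rm := ltn_pmod a mo0.
  rewrite (@step_mv0 _ (Drain (neg, ~~ wd, o, q, f) ord0) _ _ _ _ _ _ _ MStay MStay).
  - exact: preach_refl.
  - rewrite /= !sgE ifF; last by lia.
    have -> : mark (pos wd a) by rewrite /pos; case: wd; rewrite ?subnn.
    by rewrite (_ : (a == 0) = false) //; lia.
  - by apply: (inbE inP); lia.
have rm := ltn_pmod i mo0.
have nm : mark (pos wd i) && ~~ (i == 0) = false.
  case: (i =P 0) => /= i0; first by rewrite andbF.
  by rewrite andbT; apply/negbTE/markN; rewrite /pos; case: (wd); lia.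
have E1 : pstep (pc (Walk (neg, wd, o, q, f) (i == 0)) o x (i %% mo)%N
      (mo - i %% mo)%N P hd (pos wd i)) =
    pc (Walk (neg, wd, o, q, f) false) o x (i %% mo).+1 (mo - i %% mo).-1 P hd (pos wd i.+1).
  rewrite (@step_mv _ (Walk (neg, wd, o, q, f) false) _ _ _ _ _ _ _ MStay MRight MLeft
     (fun=> MStay) (fun=> MStay) MStay (if wd then MRight else MLeft)) //; last first.
    by rewrite /= !sgE ifF ?nm //; lia.
  rewrite /= ifT.
    congr (pc _ _ _ _ _ _ _ _); try lia.
    by rewrite /pos; case: (wd) => /=; lia.
  have -> : (Posz (i %% mo)%N + 1 = Posz (i %% mo).+1)%R by lia.
  have -> : (Posz (mo - i %% mo)%N - 1 = Posz (mo - i %% mo).-1)%R by lia.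
  by apply: (inbE inP); lia.
have sE : i.+1 %% mo = if (i %% mo).+1 == mo then 0 else (i %% mo).+1.
  rewrite -addn1 -modnDml addn1; case: eqP => [->|ne]; first by rewrite modnn.
  by rewrite modn_small //; lia.
case: ((i %% mo).+1 =P mo) sE => [e1|ne1] sE.
  have [o' R] := IH i.+1 (~~ o) iE.
  exists o'; apply: preach_step; rewrite E1; apply: preach_step.
  rewrite (@step_mv0 _ (Walk (neg, wd, ~~ o, q, f) false) _ _ _ _ _ _ _ MStay MStay).
  - move: R; rewrite sE subn0 /pc mkv_neg /=.
    have -> : (mo - i %% mo).-1 = 0 by lia.
    by rewrite e1.
  - by rewrite /= !sgE ifT //; lia.
  - by apply: (inbE inP); lia.
have [o' R] := IH i.+1 o iE.
exists o'; apply: preach_step; rewrite E1; move: R; rewrite sE.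
have -> : (mo - (i %% mo).+1 = (mo - i %% mo).-1)%N by lia.
by [].
Qed.

Lemma drain_loop c r n hi mem : r + hi = mo -> n + r = (a %% mo)%N ->
  preach (pc (Drain (c, q, f) (inord (minn n C.+1))) c.2 x r hi P hd mem)
         (pc (Drain (c, q, f) (inord (minn (a %% mo) C.+1))) c.2 x 0%N mo P hd mem).
Proof.
elim: r n hi => [|r IH] n hi rE nE.
  by rewrite -nE addn0 -rE; apply: preach_refl.
apply: preach_step.
rewrite (@step_mv _ (Drain (c, q, f) (inord (minn n.+1 C.+1))) _ _ _ _ _ _ _ MStay MLeft MRight
     (fun=> MStay) (fun=> MStay) MStay MStay) //; last first.
  rewrite /= !sgE /=; congr (Drain _ _, _, _, _); congr inord.
  by rewrite inordK; lia.
rewrite /= (_ : (Posz r.+1 - 1 = Posz r)%R); last by lia.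
rewrite (_ : (Posz hi + 1 = Posz hi.+1)%R); last by lia.
rewrite ifT; last by apply: (inbE inP); lia.
by apply: IH; lia.
Qed.

End Walk.

Lemma fin_loop n c x (hi : nat) P hd mem : hi <= n -> (forall j, `|P j|%N <= n) ->
  inb x 0%N hi P ->
  preach (pc (Fin c) c.2 x 0%N hi P hd mem) (pc (NextX c) c.2 x 0%N 0%N (fun=> 0%R) hd mem).
Proof.
have stop P' : P' =1 (fun=> 0%R) -> inb x 0%N 0%N P' ->
  preach (pc (Fin c) c.2 x 0%N 0%N P' hd mem) (pc (NextX c) c.2 x 0%N 0%N (fun=> 0%R) hd mem).
  move=> P0 inP; apply: preach_step.
  rewrite (@step_mv0 _ (NextX c) _ _ _ _ _ _ _ MStay MStay) //.
    by rewrite /pc /= (eq_mkv _ _ _ _ P0); apply: preach_refl.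
  by rewrite /= !sgE /= ifT //; apply/forallP => j; rewrite !sgE P0.
elim: n hi P => [|n IH] hi P hn Pn inP.
  have hi0 : hi = 0 by lia.
  by rewrite hi0 in inP *; apply: stop => // j; have := Pn j; lia.
case: (boolP ((hi == 0) && [forall j, P j == 0%R])) => [/andP[/eqP h0 /forallP P0]|nz].
  by rewrite h0 in inP *; apply: stop => // j; apply/eqP.
apply: preach_step.
rewrite (@step_mv _ (Fin c) _ _ _ _ _ _ _ MStay MStay (to0 (isgn hi))
     (fun j => to0 (isgn (P j))) (fun j => to0 (isgn (P j))) MStay MStay); last first.
- by move=> j; case: (to0 _) => /=; lia.
- rewrite /= !sgE ifF; last first.
    apply/negbTE; apply: contra nz => /andP[h0 /forallP P0].
    by rewrite (_ : (hi == 0)) //=; apply/forallP => j; have := P0 j; rewrite !sgE.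
  congr (_, _, _, _); apply/ffunP => -[[b|]|[j|j]]; rewrite !ffunE //.
have hiE : tm_move (to0 (isgn hi)) hi = Posz hi.-1 by case: hi {hn inP nz} => [|hi] //=; lia.
have PE j : (`|tm_move (to0 (isgn (P j))) (P j)|%N <= `|P j|.-1)%N.
  by rewrite /isgn; case: eqP => [->|] //=; case: ltrP => /=; lia.
rewrite hiE ifT; last first.
  case/and4P: inP => Hx _ Hh /forallP HP; apply/and4P; split=> //=; first by lia.
  by apply/forallP => j; have := PE j; have := HP j; lia.
rewrite /=; apply: IH; first by lia.
  by move=> j; have := PE j; have := Pn j; lia.
case/and4P: inP => Hx _ Hh /forallP HP; apply/and4P; split=> //=; first by lia.
by apply/forallP => j; have := PE j; have := HP j; lia.
Qed.

(** A computation as seen from cell [x]: state, head positions and the symbols at [x] are tracked,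
    while symbols claimed to be read elsewhere are believed. Entries after an accepting state are
    not examined. *)
Fixpoint check (x : int) (q : tm_state M) (f : {ffun T -> S}) (P : T -> int)
    (l : seq (option instr)) : bool :=
  (q \in tm_accepting M) ||
  match l with
  | [::] => false
  | None :: l' => check x q f P l'
  | Some (r, b) :: l' =>
      [&& b \in tm_trans q r, [forall j, (P j == x) ==> (r j == f j)],
          [forall j, `|tm_move (b.2 j).2 (P j)|%N <= Cap] &
          check x b.1 [ffun j => if P j == x then (b.2 j).1 else f j]
            (fun j => tm_move (b.2 j).2 (P j)) l']
  end.

(** Between walks the register [hi] holds the last modulus used. Raising it beyond [Cap] overflows
    and rejects, which matches [check] coming to the end of its list. *)
Lemma sweep k neg wd o q f x (mo : nat) P hd : mo + k = Cap -> inb x 0%N mo P ->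
  let d := pc (Next (neg, wd, o, q, f)) o x 0%N mo P hd (pos wd 0) in
  if check x q f P [seq decode (a %% i)%N | i <- iota mo.+1 k]
  then exists wd' o', preach d
         (pc (NextX (neg, wd', o')) o' x 0%N 0%N (fun=> 0%R) hd (pos wd' 0))
  else ~ paccepts d.
Proof.
elim: k wd o q f mo P => [|k IH] wd o q f mo P moE inP d.
all: case: (boolP (q \in tm_accepting M)) => qa.
1,3: rewrite (_ : check _ _ _ _ _ = true); last (by rewrite /= qa).
1,2: exists wd, o; apply: preach_step;
  rewrite (@step_mv0 _ (Fin (neg, wd, o)) _ _ _ _ _ _ _ MStay MStay) //= ?qa //;
  apply: (@fin_loop Cap (neg, wd, o)) => //; first (by lia);
  by move=> j; case/and4P: inP => _ _ _ /forallP.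
  rewrite /= (negPf qa) /= -paccepts_step /d.
  rewrite (@step_mv _ (Walk (neg, wd, o, q, f) true)
    _ _ _ _ _ _ _ MStay MStay MRight (fun=> MStay) (fun=> MStay) MStay MStay) //=.
    rewrite ifF; first exact: paccepts_dead.
    by apply/negbTE/and4P => -[_ _ +]; lia.
  by rewrite (negPf qa).
have inP1 : inb x 0 0 P.
  by case/and4P: inP => ? ? ? ?; apply/and4P.
have moC : mo.+1 <= Cap by lia.
have [o' R1] := @walk_loop neg q f x P hd mo.+1 isT moC inP1 wd a 0 o (add0n _).
rewrite mod0n subn0 eqxx in R1.
have rm := ltn_pmod a (ltn0Sn mo).
have R2 := @drain_loop q f x P hd mo.+1 isT moC inP1 (neg, ~~ wd, o') (a %% mo.+1)%N 0
  (mo.+1 - a %% mo.+1) (pos wd a) (subnKC (ltnW rm)) (add0n _).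
have dE : inord (minn 0 C.+1) = ord0 :> 'I_C.+2.
  by apply: val_inj; rewrite /= inordK min0n.
rewrite dE in R2.
have R0 : preach d (pc (Walk (neg, wd, o, q, f) true) o x 0%N mo.+1 P hd (pos wd 0)).
  apply: preach_step; rewrite /d (@step_mv _ (Walk (neg, wd, o, q, f) true)
    _ _ _ _ _ _ _ MStay MStay MRight (fun=> MStay) (fun=> MStay) MStay MStay) //=.
    have -> : (Posz mo + 1 = Posz mo.+1)%R by lia.
    by rewrite ifT; [exact: preach_refl|apply: (inbE inP1)].
  by rewrite (negPf qa).
have pE : pos wd a = pos (~~ wd) 0 by rewrite /pos; case: (wd); rewrite /= ?subnn ?subn0.
have R := preach_trans R0 (preach_trans R1 R2); rewrite pE in R => {R0 R1 R2}.
have inP2 : inb x 0%N mo.+1 P by apply: (inbE inP1).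
rewrite /= (negPf qa) /=.
case E : (decode (a %% mo.+1)) => [[r b]|]; last first.
  have RN : preach d (pc (Next (neg, ~~ wd, o', q, f)) o' x 0%N mo.+1 P hd (pos (~~ wd) 0)).
    apply: preach_trans R _; apply: preach_step.
    rewrite (@step_mv0 _ (Next (neg, ~~ wd, o', q, f)) _ _ _ _ _ _ _ MStay MStay) //.
      exact: preach_refl.
    by rewrite /= !sgE /= decode_inord E.
  have := IH (~~ wd) o' q f mo.+1 P (etrans (addSnnS _ _) moE) inP2.
  case: ifP => _; last by move=> nA /(preach_accepts RN).
  by case=> wd1 [o1 R1]; exists wd1, o1; apply: preach_trans RN R1.
set P' := fun j => tm_move (b.2 j).2 (P j).
set f' := [ffun j => if P j == x then (b.2 j).1 else f j].
have sgD : (b \in tm_trans q r) && [forall j, (P j == x) ==> (r j == f j)] ->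
  pstep (pc (Drain (neg, ~~ wd, o', q, f) (inord (minn (a %% mo.+1) C.+1))) o' x 0%N mo.+1 P hd (pos (~~ wd) 0))
  = if inb x 0%N mo.+1 P' then pc (Next (neg, ~~ wd, o', b.1, f')) o' x 0%N mo.+1 P' hd (pos (~~ wd) 0)
    else pc Dead o' x 0%N mo.+1 P hd (pos (~~ wd) 0).
  move=> ok; rewrite (@step_mv _ (Next (neg, ~~ wd, o', b.1, f'))
    _ _ _ _ _ _ _ MStay MStay MStay (fun j => (b.2 j).2) (fun j => (b.2 j).2) MStay MStay) //=.
    rewrite !sgE /= decode_inord E.
    under eq_forallb => j do rewrite sg_D.
    rewrite ok; congr (Next (_, _, _), _, _, _).
    by apply/ffunP => j; rewrite !ffunE isgn0 subr_eq0.
  by move=> j; case: (b.2 j).2 => /=; lia.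
case: (boolP ((b \in _) && _)) sgD => [ok /(_ isT) sgD|nok _]; last first.
  rewrite andbA (negPf nok) /= (preach_accepts R) -paccepts_step.
  rewrite (@step_mv0 _ Dead _ _ _ _ _ _ _ MStay MStay) //=; first exact: paccepts_dead.
  rewrite !sgE /= decode_inord E; under eq_forallb => j do rewrite sg_D.
  by rewrite (negPf nok).
rewrite andbA ok /=; case: (boolP [forall j, _ <= _]) => [inC|ninC] /=; last first.
  rewrite (preach_accepts R) -paccepts_step sgD ifF; first exact: paccepts_dead.
  by rewrite /inb (negPf ninC) !andbF.
have inP3 : inb x 0%N mo.+1 P'.
  by case/and4P: inP2 => ? ? ? _; apply/and4P.
have RN : preach d (pc (Next (neg, ~~ wd, o', b.1, f')) o' x 0%N mo.+1 P' hd (pos (~~ wd) 0)).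
  by apply: preach_trans R _; apply: preach_step; rewrite sgD inP3; apply: preach_refl.
have := IH (~~ wd) o' b.1 f' mo.+1 P' (etrans (addSnnS _ _) moE) inP3.
case: ifP => _; last by move=> nA /(preach_accepts RN).
by case=> wd1 [o1 R1]; exists wd1, o1; apply: preach_trans RN R1.
Qed.

Definition initf neg (x : int) : {ffun T -> S} :=
  [ffun j => if (j == ord0) && ~~ neg then tm_cells (input_tape M w) x else None].

Definition prog := [seq decode (a %% i)%N | i <- iota 1 Cap].

(** The sweeps of different cells share [prog]; only the initial symbols in [initf] and the value of
    [x] vary. *)
Definition checkx neg x := check x (tm_start M) (initf neg x) (fun=> 0%R) prog.

Lemma begin_sweep neg wd o (x : nat) :
  x <= Cap ->
  let hd := if neg then (size w).+1 else minn x.+1 (size w).+1 in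
  let xx := sval (~~ neg) x in
  let d := pc (Begin (neg, wd, o)) o xx 0%N 0%N (fun=> 0%R) hd (pos wd 0) in
  if checkx neg xx
  then exists wd' o', preach d
         (pc (NextX (neg, wd', o')) o' xx 0%N 0%N (fun=> 0%R) hd (pos wd' 0))
  else ~ paccepts d.
Proof.
move=> xC hd xx d.
have inP : inb xx 0%N 0%N (fun=> 0%R).
  by apply/and4P; split=> //; [rewrite /xx /sval; case: (neg) => /=; lia|apply/forallP].
have R : preach d (pc (Next (neg, wd, o, tm_start M, initf neg xx)) o xx 0%N 0%N
                      (fun=> 0%R) hd (pos wd 0)).
  apply: preach_step.
  rewrite (@step_mv0 _ (Next (neg, wd, o, tm_start M, initf neg xx))
            _ _ _ _ _ _ _ MStay MStay) //; first exact: preach_refl.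
  rewrite /=; congr (Next (_, _, _), _, _, _).
  (* Position 0 holds the left endmarker, so the letter of cell [x] is at [x.+1]; beyond the word
     the head rests on the right endmarker, which [letter_of] turns into a blank. *)
  apply/ffunP => j; rewrite !ffunE; case: (j == ord0) => //=.
  rewrite /hd /xx; case: (neg) => //=; rewrite /read_input /=.
  case: (ltnP x (size w)) => xw.
    have -> : minn x.+1 (size w).+1 = x.+1 by lia.
    by rewrite /=; elim: (w) (x) xw => //= c s IHs [|i] //= /IHs ->.
  have -> : minn x.+1 (size w).+1 = (size w).+1 by lia.
  by rewrite /= !nth_default ?size_map.
have := @sweep Cap neg wd o (tm_start M) (initf neg xx) xx 0 (fun=> 0%R) hd (add0n _) inP.
rewrite -/(checkx neg xx) /=; case: ifP => _; last by move=> nA /(preach_accepts R).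
by case=> wd1 [o1 R1]; exists wd1, o1; apply: preach_trans R R1.
Qed.

Lemma nextX_step neg wd o (x : nat) hd : x <= Cap ->
  pstep (pc (NextX (neg, wd, o)) o (sval (~~ neg) x) 0%N 0%N (fun=> 0%R) hd (pos wd 0)) =
  if x < Cap then
    pc (Begin (neg, wd, o)) o (sval (~~ neg) x.+1) 0%N 0%N (fun=> 0%R)
       (if neg then hd else minn hd.+1 (size w).+1) (pos wd 0)
  else pc (if neg then Acc else Back (neg, wd, o)) o (sval (~~ neg) x) 0%N 0%N
          (fun=> 0%R) hd (pos wd 0).
Proof.
move=> xC; rewrite (@step_mv _ (Begin (neg, wd, o)) _ _ _ _ _ _ _
   (if neg then MLeft else MRight) MStay MStay (fun=> MStay)
   (fun=> if neg then MRight else MLeft) (if neg then MStay else MRight) MStay) //; last first.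
  by move=> j; case: (neg) => /=; lia.
have -> : tm_move (if neg then MLeft else MRight) (sval (~~ neg) x) = sval (~~ neg) x.+1.
  by rewrite /sval; case: (neg) => /=; lia.
have -> : inb (sval (~~ neg) x.+1) (tm_move MStay 0%N) (tm_move MStay 0%N)
    (fun=> tm_move MStay 0%R) = (x < Cap).
  case: (ltnP x Cap) => xC'; first exact: inb0.
  by apply/negbTE/negP => /and4P[+ _ _ _]; rewrite /sval; case: (neg) => /=; lia.
by case: ifP => _; case: (neg).
Qed.

Lemma neg_loop k x wd o : x + k = Cap ->
  paccepts (pc (NextX (true, wd, o)) o (sval false x) 0%N 0%N (fun=> 0%R)
               (size w).+1 (pos wd 0)) <->
  forall y, x < y <= Cap -> checkx true (sval false y).
Proof.
elim: k x wd o => [|k IH] x wd o xk; rewrite -paccepts_step -[sval false x]/(sval (~~ true) x).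
  rewrite nextX_step ?ifF /=; try lia; split; last by exists 0; rewrite inE.
  by move=> _ y; lia.
rewrite nextX_step ?ifT /=; try lia.
have xC : x.+1 <= Cap by lia.
have := @begin_sweep true wd o x.+1 xC; rewrite -/(sval false x.+1) /=.
case: ifP => [ck [wd' [o' R]]|ck nA]; last first.
  by split=> // /(_ x.+1); rewrite ck => /(_ _)/negP; case; lia.
rewrite (preach_accepts R) (IH x.+1); last by lia.
split=> H y Hy; last by apply: H; lia.
case: (ltngtP x.+1 y) => xy; [by apply: H; lia|by lia|by rewrite -xy].
Qed.

Lemma back_loop x wd o : x <= Cap ->
  preach (pc (Back (false, wd, o)) o (Posz x) 0%N 0%N (fun=> 0%R) (size w).+1 (pos wd 0))
    (pc (NextX (true, wd, o)) o (sval false 0) 0%N 0%N (fun=> 0%R) (size w).+1 (pos wd 0)).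
Proof.
elim: x => [|x IH] xC; apply: preach_step.
  rewrite (@step_mv0 _ (NextX (true, wd, o)) _ _ _ _ _ _ _ MStay MStay).
  - exact: preach_refl.
  - by rewrite /= !sgE.
  - exact: (@inb0 true 0).
rewrite (@step_mv _ (Back (false, wd, o)) _ _ _ _ _ _ _ MLeft MStay MStay
  (fun=> MStay) (fun=> MRight) MStay MStay); last first.
- by move=> j /=; lia.
- by rewrite /= !sgE.
have -> : tm_move MLeft (Posz x.+1) = Posz x by rewrite /=; lia.
by rewrite ifT; [apply: IH; lia|apply: (@inb0 true x); lia].
Qed.

Lemma pos_loop k x wd o : x + k = Cap -> size w <= Cap ->
  paccepts (pc (NextX (false, wd, o)) o (sval true x) 0%N 0%N (fun=> 0%R)
               (minn x.+1 (size w).+1) (pos wd 0)) <->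
  (forall y, x < y <= Cap -> checkx false (sval true y)) /\
  (forall y, 0 < y <= Cap -> checkx true (sval false y)).
Proof.
move=> + wC; elim: k x wd o => [|k IH] x wd o xk; rewrite -paccepts_step -[sval true x]/(sval (~~ false) x).
  rewrite nextX_step ?ifF /=; try lia.
  have -> : minn x.+1 (size w).+1 = (size w).+1 by lia.
  rewrite (preach_accepts (@back_loop x wd o _)); last by lia.
  by rewrite (@neg_loop Cap 0) //; split=> [H|[]//]; split=> // y; lia.
rewrite nextX_step ?ifT /=; try lia.
have xC : x.+1 <= Cap by lia.
have := @begin_sweep false wd o x.+1 xC; rewrite -/(sval true x.+1) /=.
have -> : minn (minn x.+1 (size w).+1).+1 (size w).+1 = minn x.+2 (size w).+1 by lia.
case: ifP => [ck [wd' [o' R]]|ck nA]; last first.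
  by split=> // -[/(_ x.+1)]; rewrite ck => /(_ _)/negP H _; case: H; lia.
rewrite (preach_accepts R) (IH x.+1); last by lia.
split=> -[H1 H2]; split=> // y Hy; last by apply: H1; lia.
case: (ltngtP x.+1 y) => xy; [by apply: H1; lia|by lia|by rewrite -xy].
Qed.

Lemma seek_loop i : 0 < i <= a ->
  preach (pc Seek false 0%N 0%N 0%N (fun=> 0%R) 0 i)
    (pc (Begin (false, false, false)) false 0%N 0%N 0%N (fun=> 0%R) 1 a).
Proof.
move=> ia; have [k kE] : exists k, i + k = a by exists (a - i); lia.
elim: k i ia kE => [|k IH] i ia kE; apply: preach_step.
  have -> : i = a by lia.
  rewrite (@step_mv0 _ (Begin (false, false, false)) _ _ _ _ _ _ _ MRight MStay) //.
  - by rewrite /= (_ : minn 1 _ = 1); [exact: preach_refl|lia].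
  - by rewrite /= marka.
  - exact: (@inb0 true 0).
rewrite (@step_mv0 _ Seek _ _ _ _ _ _ _ MStay MRight) //.
- by apply: IH => /=; lia.
- by rewrite /= (negPf (markN _)) //; lia.
- exact: (@inb0 true 0).
Qed.

Lemma prog_accepts : size w <= Cap ->
  paccepts (cinit reg Init) <->
  (forall y, y <= Cap -> checkx false (sval true y)) /\
  (forall y, 0 < y <= Cap -> checkx true (sval false y)).
Proof.
move=> wC; rewrite cinitE -paccepts_step (@step_mv0 _ Seek _ _ _ _ _ _ _ MStay MRight); first last.
- exact: (@inb0 true 0).
- by rewrite /= mark0.
rewrite (preach_accepts (@seek_loop 1 _)) /=; last by lia.
have := @begin_sweep false false false 0 isT.
have -> : minn 1 (size w).+1 = 1 by lia.
rewrite /= /pos subn0.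
case: ifP => [ck [wd' [o' R]]|ck nA]; last by split=> // -[/(_ 0 isT)]; rewrite ck.
rewrite (preach_accepts R).
have := @pos_loop Cap 0 wd' o' (add0n _) wC.
have -> : minn 1 (size w).+1 = 1 by lia.
rewrite /pos subn0 => E; apply: iff_trans E _.
split=> -[H1 H2]; split=> // y Hy; last by apply: H1; lia.
by case: y Hy => // y Hy; apply: H1; lia.
Qed.

End Run.
End Program.

(** * NP is contained in the class *)

(** The base [n.+2], which is also the base of the counters, is at least 2 even for [n = 0], so
    constants can be absorbed into the exponent. *)
Lemma poly_nat_bound (p : {poly nat}) :
  exists a, forall n, (p.[n])%R <= n.+2 ^ a.
Proof.
elim/poly_ind: p => [|p c [a IH]]; first by exists 0 => n; rewrite horner0.
exists (a.+1 + c) => n; rewrite hornerMXaddC expnD.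
have -> : ((p.[n] * n + c)%R = (p.[n])%R * n + c)%N by [].
have c2 : c < n.+2 ^ c by exact: ltn_expl.
have : (p.[n])%R * n <= n.+2 ^ a * n.+2 by apply: leq_mul => //; lia.
rewrite -expnSr; have : 0 < n.+2 ^ a.+1 by rewrite expn_gt0.
nia.
Qed.

(** All quantities are compared as powers of 2, with [b] the logarithm of [N]. For [e = c * b] the
    product [K * e ^ 2] is at most [2 ^ (2 * b * a + 2 * a + 10 + 2 * b)], which [c = 4 * a + 20]
    beats, while [2 ^ e] stays below a fixed power of [N]. *)
Lemma capacity a : exists2 dg, 0 < dg & forall N K, 1 < N -> K <= N ^ a ->
  exists e, [/\ 0 < e, K * e ^ 2 < 2 ^ e.-1 & 2 ^ e <= N ^ dg - 1].
Proof.
set c := 4 * a + 20; exists c.+1 => // N K N1 KN.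
pose b := trunc_log 2 N; have b0 : 0 < b by rewrite trunc_log_gt0.
have bN : 2 ^ b <= N by apply: trunc_logP => //; lia.
have Nb : N <= 2 ^ (2 * b).
  by apply: leq_trans (ltnW (trunc_log_ltn N (isT : 1 < 2))) _; rewrite leq_exp2l //; lia.
exists (c * b); split; first by rewrite muln_gt0 b0 /c addnS.
  have Ka : K <= 2 ^ (2 * b * a).
    by apply: leq_trans KN _; rewrite expnM; case: (a) => // a'; rewrite leq_exp2r.
  have Kb : b ^ 2 <= 2 ^ (2 * b) by rewrite mulnC expnM leq_exp2r // ltnW // ltn_expl.
  have ca : a + 5 <= 2 ^ (a + 3).
    by elim: (a) => // a' IH; rewrite !addSn expnS; lia.
  have Kc : c ^ 2 <= 2 ^ (2 * a + 10).
    have -> : 2 * a + 10 = (a + 3) * 2 + 4 by lia.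
    by rewrite expnD expnM /c -!mulnn; nia.
  apply: (@leq_ltn_trans (2 ^ (2 * b * a + (2 * a + 10 + 2 * b)))).
    by rewrite expnD expnMn leq_mul // expnD leq_mul.
  by rewrite ltn_exp2l // /c; nia.
have : (2 ^ b) ^ c <= N ^ c by rewrite leq_exp2r // /c addnS.
rewrite -expnM mulnC => le1; have : 2 * N ^ c <= N ^ c.+1 by rewrite expnS leq_mul2r N1 orbT.
have : 0 < N ^ c by rewrite expn_gt0; lia.
by lia.
Qed.

(** * The checks of all cells together certify a computation *)

Section Cert.
Variables (Sigma : finType) (m : nat) (M : ntm Sigma m) (dg : nat) (w : seq Sigma).
Let Cap := (size w).+2 ^ dg - 1.
Local Notation T := 'I_m.+1.

Definition cells_at (c : tm_config M) x : {ffun T -> tape_symbol Sigma (tm_aux M)} :=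
  [ffun j => tm_cells (tm_tapes c j) x].
Definition heads_at (c : tm_config M) (j : T) := tm_pos (tm_tapes c j).

(** All cells follow the same list and so agree on states and head positions. The symbol claimed for
    tape [j] is verified by the check of the cell under head [j], which is in range because every
    check also bounds the heads. *)
Lemma check_sound l c : (forall j, `|heads_at c j|%N <= Cap) ->
  (forall x, `|x|%N <= Cap -> check dg w x (tm_cstate c) (cells_at c x) (heads_at c) l) ->
  exists t, tm_accepts_in t c.
Proof.
elim: l c => [|o l IH] c hC H.
  by exists 0; have := H 0%R isT; rewrite /= orbF.
case: (boolP (tm_cstate c \in tm_accepting M)) => [qa|qa]; first by exists 0.
case: o H => [[r b]|] H; last first.
  by apply: IH hC _ => x /H; rewrite /= (negPf qa).
have H' x : `|x|%N <= Cap -> _ := fun xC => H x xC.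
have {H} H x (xC : `|x|%N <= Cap) := H x xC.
have [b1 b3] : b \in tm_trans (tm_cstate c) r /\
    forall j, `|tm_move (b.2 j).2 (heads_at c j)|%N <= Cap.
  by have := H 0%R isT; rewrite /= (negPf qa) => /and4P[? _ /forallP ? _].
have rE : r = [ffun j => tm_read (tm_tapes c j)].
  apply/ffunP => j; have := H (heads_at c j) (hC j).
  rewrite /= (negPf qa) => /and4P[_ /forallP /(_ j) + _ _].
  by rewrite eqxx !ffunE => /eqP.
pose c' := TMConfig b.1 (fun i => tm_write_move (b.2 i) (tm_tapes c i)).
have [t Ht] : exists t, tm_accepts_in t c'.
  apply: IH => [j|x xC]; first exact: b3.
  have := H x xC; rewrite /= (negPf qa) => /and4P[_ _ _].
  congr (check _ _ _ _ _ _ _); apply/ffunP => j; rewrite !ffunE.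
  by rewrite /= eq_sym; case: eqP => // ->.
by exists t.+1; exists b => //; rewrite -rE.
Qed.

(** The form [pmap id l = s ++ r] allows skips anywhere and arbitrary instructions [r] after
    acceptance. The slack [t] in the bound pays for head moves, at most one cell per step. *)
Lemma check_complete t c : tm_accepts_in t c ->
  exists2 s : seq (instr M), size s = t & forall l r, pmap id l = s ++ r ->
    forall x, (forall j, `|heads_at c j|%N + t <= Cap) ->
    check dg w x (tm_cstate c) (cells_at c x) (heads_at c) l.
Proof.
elim: t c => [|t IH] c /= => [qa|[b bT /IH [s sz H]]].
  by exists [::] => // l r _ x _; case: l => [|o l] /=; rewrite qa.
exists (([ffun i => tm_read (tm_tapes c i)], b) :: s); first by rewrite /= sz.
move=> l r lE x hC; elim: l lE => // -[i|] l IHl /= lE; last by rewrite IHl // orbT.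
case: lE => -> lE; rewrite orbC; apply/orP; left; apply/and4P; split=> //.
- by apply/forallP => j; rewrite !ffunE; apply/implyP => /eqP <-.
- by apply/forallP => j; have := hC j; case: (b.2 j).2 => /=; lia.
- have := H l r lE x; rewrite [X in check _ _ _ _ X](_ : _ =
     [ffun j => if heads_at c j == x then (b.2 j).1 else cells_at c x j]).
    apply=> j; have := hC j; rewrite /heads_at /=; move: (tm_pos _) => z.
    by case: (b.2 j).2 => /=; lia.
  by apply/ffunP => j; rewrite !ffunE /= eq_sym.
Qed.

Lemma prog_decode a (s : seq (instr M)) B : B <= Cap ->
  [seq x <- [seq (a %% i)%N | i <- iota 1 B] | x != 0] = [seq (enum_rank i).+1 | i <- s] ->
  exists r, pmap id (prog M dg w a) = s ++ r.
Proof.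
move=> BC E; exists (pmap (decode M) [seq (a %% i)%N | i <- iota (1 + B) (Cap - B)]).
have pmE (u : seq nat) : pmap id [seq decode M (a %% i)%N | i <- u] =
    pmap (decode M) [seq (a %% i)%N | i <- u].
  by elim: u => //= i u ->.
rewrite /prog -/Cap -(subnKC BC) iotaD pmE map_cat pmap_cat; congr (_ ++ _).
  have -> (u : seq nat) : pmap (decode M) u = pmap (decode M) [seq x <- u | x != 0].
    by elim: u => //= -[|i] u -> //=.
  rewrite E; elim: s {E} => //= i s ->.
  by rewrite insubT // => lt; rewrite /= (_ : Sub _ _ = enum_rank i) ?enum_rankK //; apply: val_inj.
by rewrite addKn.
Qed.

Lemma eq_check x q f P P' l : P =1 P' -> check (M := M) dg w x q f P l = check dg w x q f P' l.
Proof.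
elim: l q f P P' => //= -[[r b]|] l IH q f P P' E; last by rewrite (IH _ _ _ _ E).
congr (_ || [&& _, _, _ & _]).
- by apply: eq_forallb => j; rewrite E.
- by apply: eq_forallb => j; rewrite E.
- rewrite (IH _ _ _ (fun j => tm_move (b.2 j).2 (P' j))); last by move=> j; rewrite E.
  by congr check; apply/ffunP => j; rewrite !ffunE E.
Qed.

(** For the negative phase 0 must be excluded: [initf true] makes the cell blank, whereas cell 0 may
    carry the first letter. *)
Lemma checkxE a neg (y : nat) : neg ==> (0 < y) ->
  checkx M dg w a neg (sval (~~ neg) y) =
  check dg w (sval (~~ neg) y) (tm_cstate (tm_initial M w))
    (cells_at (tm_initial M w) (sval (~~ neg) y)) (heads_at (tm_initial M w)) (prog M dg w a).
Proof.
move=> ny; rewrite /checkx; rewrite (@eq_check _ _ _ _ (heads_at (tm_initial M w))); last first.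
  by move=> j; rewrite /heads_at /=; case: ifP.
congr check; apply/ffunP => j; rewrite !ffunE /=; case: (j == ord0) => //=.
by case: neg ny => //; case: y.
Qed.

End Cert.

Lemma NP_in_R_U_W2 k (Sigma : finType) (L : language Sigma) :
  2 <= k -> NP L -> R_U_W2 k L.
Proof.
move=> k2 [m [M [p [LM Lp]]]].
have [a pa] := poly_nat_bound p.
(* The number [t + #|{: instr M}|.+1] plays the role of [K]: it bounds the number of codes and
   exceeds each of them. The second summand of the exponent absorbs the additive constant. *)
have [dg dg0 Hdg] := capacity (a + #|{: instr M}|.+1).
pose A := @cautomaton Sigma (pstate M) (reg m) (digits dg) (@ptrans Sigma m M)
         (@pov Sigma m M) (Init M) [set Acc M].
exists _, A; split; first by apply/card_gt0P; exists None.
move=> w; set N := (size w).+2; set Cap := N ^ dg - 1.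
have wC : size w <= Cap.
  have : N ^ 1 <= N ^ dg by rewrite leq_exp2l.
  by rewrite expn1 /Cap /N; lia.
split=> [Lw|[mu [_]]].
- have [t tp Ht] := Lp w Lw.
  have [s st ck] := check_complete dg w Ht.
  have [|e [e0 Ke eN]] := Hdg N (t + #|{: instr M}|.+1) isT.
    rewrite expnD; have := leq_trans tp (pa (size w)); rewrite -/N => tN.
    have : #|{: instr M}|.+1 < N ^ #|{: instr M}|.+1 by apply: ltn_expl.
    have : 0 < N ^ a by rewrite expn_gt0.
    nia.
  have [||b [B [b0 Be bE]]] := @residues_encode _ _ [seq (enum_rank i).+1 | i <- s] e0 Ke.
  + by rewrite size_map st leq_addr.
  + apply/allP => c /mapP[i _ ->] /=; rewrite addnS ltnS.
    exact: leq_trans (ltn_ord (enum_rank i)) (leq_addl _ _).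
  have [r rE] := prog_decode (leq_trans Be eN) bE.
  pose mu i : option unit := if (i == 0) || (i == b) then Some tt else None.
  exists mu; split.
    exists [:: 0; b] => // i; rewrite /mu !inE; by case: ifP.
  apply/cautomaton_accepts/(@prog_accepts _ _ M dg w _ b) => //.
  + by rewrite /mu eqxx orbT.
  + by move=> i ib; rewrite /mu ifF //; lia.
  have tC j : `|heads_at (tm_initial M w) j|%N + t <= Cap.
    have -> : heads_at (tm_initial M w) j = 0%R by rewrite /heads_at /=; case: ifP.
    have : 2 ^ e.-1 <= 2 ^ e by rewrite leq_exp2l // leq_pred.
    have : 0 < e ^ 2 by rewrite expn_gt0 e0.
    by rewrite /Cap /=; nia.
  by split=> y Hy; rewrite ?(@checkxE _ _ M dg w b false y isT) ?(@checkxE _ _ M dg w b true y); try lia; apply: ck rE _ tC.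
- move/cautomaton_accepts; set mark := fun c => _ => acc.
  have [m0 exa] := accepts_marks acc.
  (* The least positive mark is chosen, so that no mark lies strictly between 0 and [b]. *)
  have := acc; case: (ex_minnP exa) => b /andP[b0 mb] bmin.
  move/(@prog_accepts _ _ M dg w _ b b0 m0 mb) => H; apply/LM.
  have [||H1 H2] := H; [|exact: wC|].
    by move=> i /andP[i0 ib]; apply/negP => mi; have := bmin i; rewrite i0 mi; lia.
  apply: (@check_sound _ _ M dg w (prog M dg w b)) => [j|x xC].
    by rewrite /heads_at /=; case: ifP.
  case: x xC => y yC.
    by have := H1 y yC; rewrite (@checkxE _ _ M dg w b false y).
  have := H2 y.+1; rewrite (@checkxE _ _ M dg w b true y.+1) //.
  by rewrite NegzE; apply; move: yC; rewrite NegzE; lia.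
Qed.

(** * Multihead automata on a guessed word are in NP *)

(** Input heads are stopped by the definition of their moves, tape heads are not, so the stop is
    decided from the scanned symbol. The verifier also needs this to keep heads within a word that
    is only part of a longer one. *)
Definition clamp (T : Type) (s : input_symbol T) (d : move) : move :=
  match s, d with LeftEnd, MLeft => MStay | RightEnd, MRight => MStay | _, _ => d end.

Section Multihead.
Variables (Gam Q I Ch : finType).
Variable tr : Q -> {ffun I -> input_symbol Gam} -> Ch -> option (Q * {ffun I -> move}).
Variables (q0 : Q) (acc : {set Q}).

Definition nconf := (Q * {ffun I -> nat})%type.

Definition nnext (u : seq Gam) (c : nconf) (a : Q * {ffun I -> move}) : nconf :=
  (a.1, [ffun i => move_head u (a.2 i) (c.2 i)]).

Definition nstep (u : seq Gam) : rel nconf := fun c c' =>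
  [exists ch, if tr c.1 [ffun i => read_input u (c.2 i)] ch is Some a
              then c' == nnext u c a else false].

Definition ninit : nconf := (q0, [ffun=> 0]).

Definition naccepts_in u t c := exists p, [/\ path (nstep u) c p, size p = t &
  (last c p).1 \in acc].

Definition naccepts u := exists t, naccepts_in u t ninit.

Lemma naccepts_inS u t c : naccepts_in u t.+1 c <->
  exists ch a, tr c.1 [ffun i => read_input u (c.2 i)] ch = Some a /\
    naccepts_in u t (nnext u c a).
Proof.
split=> [[[|c' p] [//= /andP[/existsP[ch]]]]|[ch [a [E [p [pp sp ap]]]]]].
  case E : (tr _ _ _) => [a|//] /eqP -> pp [sp] ap.
  by exists ch, a; split=> //; exists p.
exists (nnext u c a :: p); split=> //=; last by rewrite sp.
by rewrite pp andbT; apply/existsP; exists ch; rewrite E.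
Qed.

(** Loops can be cut out of an accepting path, so that it visits distinct configurations. With this
    bound no run of the verifier has to be timed. *)
Lemma naccepts_short u : naccepts u ->
  exists2 t, t <= #|Q| * (size u).+2 ^ #|I| & naccepts_in u t ninit.
Proof.
case=> t [p [pp _ ap]]; case: (shortenP pp) ap => {p t pp} p pp up _ ap.
exists (size p); last by exists p.
have bd c p' : path (nstep u) c p' -> (forall i, c.2 i < (size u).+2) ->
    {in c :: p', forall d : nconf, forall i, d.2 i < (size u).+2}.
  elim: p' c => [|c' p' IH] c /=; first by move=> _ H d; rewrite inE => /eqP ->.
  case/andP=> /existsP[ch]; case: (tr _ _ _) => // a /eqP -> pp' H d.
  rewrite inE => /predU1P[->//|]; apply: IH => // i.
  by rewrite ffunE; have := H i; case: (a.2 i) => /=; lia.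
have {}bd := bd _ _ pp (fun i => ltac:(by rewrite ffunE)).
pose F (d : nconf) : Q * {ffun I -> 'I_(size u).+2} := (d.1, [ffun i => inord (d.2 i)]).
have uF : uniq (map F (ninit :: p)).
  rewrite map_inj_in_uniq // => -[q1 d1] [q2 d2] i1 i2 [-> /ffunP E].
  congr pair; apply/ffunP => i; have := congr1 val (E i); rewrite !ffunE /=.
  by rewrite !inordK; [|exact: (bd _ i2 i)|exact: (bd _ i1 i)].
have := max_card (mem (map F (ninit :: p))); rewrite (card_uniqP uF).
by rewrite size_map card_prod card_ffun card_ord => /ltnW.
Qed.

End Multihead.

(** The guess fixes the length: it would truncate a longer word, and past the end of a shorter one
    the first track is [None]. *)
Fixpoint pad (Sigma G : Type) (w : seq Sigma) (g : seq G) : seq (option Sigma * G) :=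
  if g is b :: g' then (ohead w, b) :: pad (behead w) g' else [::].

Lemma size_pad (Sigma G : Type) (w : seq Sigma) (g : seq G) : size (pad w g) = size g.
Proof. by elim: g w => //= b g IH w; rewrite IH. Qed.

(** * A Turing machine that guesses a padded word and simulates a multihead automaton on it *)

Section Guess.
Variables (Sigma G Q I Ch : finType).
Local Notation Gam := (option Sigma * G)%type.
Variable tr : Q -> {ffun I -> input_symbol Gam} -> Ch -> option (Q * {ffun I -> move}).
Variables (q0 : Q) (acc : {set Q}) (i1 : I).

Definition gaux := option (option Gam).
Definition gst := ('I_3 + Q)%type.
Local Notation P0 := (inl (0%R : 'I_3) : gst).
Local Notation PG := (inl (1%R : 'I_3) : gst).
Local Notation PR := (inl (2%R : 'I_3) : gst).
Local Notation PQ q := (inr q : gst).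
Local Notation sym := (tape_symbol Sigma gaux).
Local Notation m := #|I|.
Local Notation tp i := (lift (ord0 : 'I_m.+1) (enum_rank (i : I))).

Definition gact (q : gst) (f : I -> sym * move) (f0 : sym * move) :
    gst * {ffun 'I_m.+1 -> sym * move} :=
  (q, [ffun a => if unlift ord0 a is Some i then f (enum_val i) else f0]).

Definition gsym (s : sym) : input_symbol Gam :=
  match s with
  | Some (inr None) => LeftEnd
  | Some (inr (Some (Some x))) => Letter x
  | _ => RightEnd
  end.

Definition gletter (s : sym) : option Sigma := if s is Some (inl a) then Some a else None.

(** A tape has a single head, so every head of the automaton gets its own copy of the guessed word,
    and all copies are written at once. Guessing may stop only on a blank of the input, which makes
    the guess cover the word. The copies are rewound in step, so watching the copy of [i1]
    suffices. *)
Definition gtrans (q : gst) (s : {ffun 'I_m.+1 -> sym}) :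
    {set gst * {ffun 'I_m.+1 -> sym * move}} :=
  match q with
  | inl n =>
    match val n with
    | 0 => [set gact PG (fun=> (Some (inr None), MRight)) (s ord0, MStay)]
    | 1 => [set a | [exists g, a == gact PG
                      (fun=> (Some (inr (Some (Some (gletter (s ord0), g)))), MRight))
                      (s ord0, MRight)]
                || (s ord0 == None) &&
                   (a == gact PR (fun=> (Some (inr (Some None)), MLeft)) (s ord0, MStay))]
    | _ => [set if s (tp i1) == Some (inr None)
                then gact (PQ q0) (fun i => (s (tp i), MStay)) (s ord0, MStay)
                else gact PR (fun i => (s (tp i), MLeft)) (s ord0, MStay)]
    end
  | inr q => [set a | [exists ch,
      if tr q [ffun i => gsym (s (tp i))] ch is Some b
      then a == gact (PQ b.1) (fun i => (s (tp i), clamp (gsym (s (tp i))) (b.2 i)))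
                     (s ord0, MStay)
      else false]]
  end.

Definition gntm : ntm Sigma m :=
  @NTM Sigma m gst gaux gtrans P0 [set q | if q is inr q then q \in acc else false].

Definition tc (l : seq gaux) (x : int) : sym :=
  if x is Posz n then nth None [seq Some (inr a) | a <- l] n else None.

Variable w : seq Sigma.

Definition ginv (c : tm_config gntm) (q : gst) (l : seq gaux) (p : I -> nat) (n : nat) :=
  [/\ tm_cstate c = q,
      forall i, tm_pos (tm_tapes c (tp i)) = Posz (p i),
      forall i, tm_cells (tm_tapes c (tp i)) =1 tc l,
      tm_pos (tm_tapes c ord0) = Posz n &
      tm_cells (tm_tapes c ord0) =1 tm_cells (input_tape gntm w)].

Definition gnext (c : tm_config gntm) (a : gst * {ffun 'I_m.+1 -> sym * move}) :
    tm_config gntm :=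
  @TMConfig _ _ gntm a.1 (fun i => tm_write_move (a.2 i) (tm_tapes c i)).

Lemma gnextE c q f f0 :
  [/\ tm_cstate (gnext c (gact q f f0)) = q,
      forall i, tm_tapes (gnext c (gact q f f0)) (tp i) =
                tm_write_move (f i) (tm_tapes c (tp i)) &
      tm_tapes (gnext c (gact q f f0)) ord0 = tm_write_move f0 (tm_tapes c ord0)].
Proof.
by split=> // [i|]; rewrite /= ffunE ?liftK ?enum_rankK // unlift_none.
Qed.

Definition full (u : seq Gam) : seq gaux :=
  None :: rcons [seq Some (Some x) | x <- u] (Some None).

Lemma full_read u n : n < (size u).+2 -> gsym (tc (full u) n) = read_input u n.
Proof.
case: n => // n nu; rewrite /read_input /= map_rcons nth_rcons size_map size_map.
case: (ltngtP n (size u)) => un; last 1 first.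
- by rewrite un /= nth_default ?size_map.
- by elim: u n un {nu} => //= x u IH [|n] //= /IH.
- by exfalso; lia.
Qed.

Lemma ginv_keep c q l p n q' ds d0 (p' : I -> nat) (n' : nat) (s : {ffun 'I_m.+1 -> sym}) :
  ginv c q l p n -> s = [ffun i => tm_read (tm_tapes c i)] ->
  (forall i, tm_move (ds i) (p i) = Posz (p' i)) -> tm_move d0 n = Posz n' ->
  ginv (gnext c (gact q' (fun i => (s (tp i), ds i)) (s ord0, d0))) q' l p' n'.
Proof.
move=> [cq cp cc c0 cc0] -> Hp Hn.
have [E1 E2 E3] := gnextE c q' (fun i => ([ffun i => tm_read (tm_tapes c i)] (tp i), ds i))
   ([ffun i => tm_read (tm_tapes c i)] ord0, d0).
split=> // [i|i x||x]; rewrite ?E2 ?E3 /= ?cp ?c0 //.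
  by rewrite ffunE /tm_read cp; case: (x =P _) => [->|_]; rewrite cc.
by rewrite ffunE /tm_read c0; case: (x =P _) => [->|_]; rewrite cc0.
Qed.

Lemma grun u t c q (hs : {ffun I -> nat}) n : ginv c (PQ q) (full u) hs n ->
  (forall i, hs i < (size u).+2) ->
  tm_accepts_in t c <-> naccepts_in tr acc u t (q, hs).
Proof.
elim: t c q hs => [|t IH] c q hs inv hN.
  case: (inv) => cq _ _ _ _; rewrite /= cq inE; split=> [qa|[[|? ?] [//]]].
  by exists [::].
have [cq cp cc c0 cc0] := inv; rewrite naccepts_inS /= cq.
set s := [ffun i => tm_read (tm_tapes c i)].
have gs i : gsym (s (tp i)) = read_input u (hs i).
  by rewrite ffunE /tm_read cp cc full_read.
have -> : [ffun i => read_input u (hs i)] = [ffun i => gsym (s (tp i))].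
  by apply/ffunP => i; rewrite !ffunE -gs ffunE.
have nx (b : Q * {ffun I -> move}) : ginv (gnext c (gact (PQ b.1) (fun i => (s (tp i), clamp (gsym (s (tp i))) (b.2 i)))
                  (s ord0, MStay))) (PQ b.1) (full u) (nnext u (q, hs) b).2 n /\
            forall i, (nnext u (q, hs) b).2 i < (size u).+2.
  split=> [|i]; last by rewrite ffunE; have := hN i; case: (b.2 i) => /=; lia.
  apply: (ginv_keep _ inv) => // i; rewrite gs ffunE /=.
  have := read_left u (hs i); have := read_right (hN i).
  by case: (read_input u (hs i)) (b.2 i) (hN i) => [||y] [] /=; lia.
split=> [[b]|[ch [b [E H]]]].
  rewrite inE => /existsP[ch]; case E : (tr _ _ _) => [b'|//] /eqP -> H.
  exists ch, b'; split=> //; have [n1 n2] := nx b'.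
  by rewrite -(IH _ _ _ n1 n2).
exists (gact (PQ b.1) (fun i => (s (tp i), clamp (gsym (s (tp i))) (b.2 i))) (s ord0, MStay)).
  by rewrite inE; apply/existsP; exists ch; rewrite E.
by have [n1 n2] := nx b; rewrite (IH _ _ _ n1 n2).
Qed.

Lemma grewind u t c n n0 : ginv c PR (full u) (fun=> n) n0 -> n <= size u ->
  tm_accepts_in t c <->
  exists2 t', t = t' + n.+1 & naccepts_in tr acc u t' (ninit I q0).
Proof.
elim: n t c => [|n IH] t c inv nu; have [cq cp cc c0 cc0] := inv.
all: case: t => [|t]; first by rewrite /= cq inE; split=> // -[t']; lia.
all: rewrite /= cq /=; set s := [ffun i => tm_read (tm_tapes c i)].
  have -> : s (tp i1) == Some (inr None) by rewrite ffunE /tm_read cp cc.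
  have inv' : ginv (gnext c (gact (PQ q0) (fun i => (s (tp i), MStay)) (s ord0, MStay)))
    (PQ q0) (full u) (ninit I q0).2 n0.
    by apply: (ginv_keep _ inv) => // i; rewrite ffunE.
  have H := @grun u t _ q0 _ _ inv' (fun i => ltac:(by rewrite ffunE)).
  split=> [[b]|[t']]; first by rewrite inE => /eqP -> /H; exists t => //; rewrite addn1.
  rewrite addn1 => -[tE] na; eexists; first by rewrite inE.
  by apply/H; rewrite tE.
have -> : (s (tp i1) == Some (inr None)) = false.
  rewrite ffunE /tm_read cp cc /= map_rcons nth_rcons !size_map.
  case: ifP => [nu'|]; last by lia.
  by apply/negbTE/eqP; elim: (u) (n) nu' => //= x u' IHu [|k] //=; apply: IHu.
have inv' : ginv (gnext c (gact PR (fun i => (s (tp i), MLeft)) (s ord0, MStay)))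
    PR (full u) (fun=> n) n0.
  by apply: (ginv_keep _ inv) => // i /=; lia.
have H := IH t _ inv' (ltnW nu).
split=> [[b]|[t']].
  by rewrite inE => /eqP -> /H [t' -> ?]; exists t' => //; lia.
rewrite addnS => -[tE] At; eexists; first by rewrite inE.
by apply/H; exists t'.
Qed.

Definition gpart (v : seq Gam) : seq gaux := None :: [seq Some (Some x) | x <- v].

Lemma input_cell (n : nat) : tm_cells (input_tape gntm w) n = omap inl (ohead (drop n w)).
Proof.
rewrite /=; elim: (w) n => [|x s IH] [|n] //=.
Qed.

Lemma tc_set l (a : gaux) x :
  (if x == Posz (size l) then Some (inr a) else tc l x) = tc (rcons l a) x.
Proof.
case: x => [n|n] //=; rewrite map_rcons nth_rcons size_map eqz_nat.
by case: ltngtP => // ln; rewrite nth_default ?size_map // ltnW.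
Qed.

Lemma gguess_step v c n g : ginv c PG (gpart v) (fun=> (size v).+1) n ->
  ginv (gnext c (gact PG (fun=> (Some (inr (Some (Some (ohead (drop n w), g)))), MRight))
         ([ffun i => tm_read (tm_tapes c i)] ord0, MRight)))
    PG (gpart (rcons v (ohead (drop n w), g)))
    (fun=> (size (rcons v (ohead (drop n w), g))).+1) n.+1.
Proof.
rewrite size_rcons => -[cq cp cc c0 cc0].
have [E1 E2 E3] := gnextE c PG (fun=> (Some (inr (Some (Some (ohead (drop n w), g)))), MRight))
         ([ffun i => tm_read (tm_tapes c i)] ord0, MRight).
split=> // [i|i x||x]; rewrite ?E2 ?E3 /= ?cp ?c0 //; try lia.
  rewrite cc (_ : (size v).+1 = size (gpart v)); last by rewrite /= size_map.
  by rewrite tc_set /gpart map_rcons.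
by rewrite ffunE /tm_read c0; case: (x =P _) => [->|_]; rewrite cc0.
Qed.

Lemma gstop_step v c n : ginv c PG (gpart v) (fun=> (size v).+1) n ->
  ginv (gnext c (gact PR (fun=> (Some (inr (Some None)), MLeft))
         ([ffun i => tm_read (tm_tapes c i)] ord0, MStay)))
    PR (full v) (fun=> size v) n.
Proof.
move=> [cq cp cc c0 cc0].
have [E1 E2 E3] := gnextE c PR (fun=> (Some (inr (Some None)), MLeft))
         ([ffun i => tm_read (tm_tapes c i)] ord0, MStay).
split=> // [i|i x||x]; rewrite ?E2 ?E3 /= ?cp ?c0 //; try lia.
  rewrite cc (_ : (size v).+1 = size (gpart v)); last by rewrite /= size_map.
  by rewrite tc_set.
by rewrite ffunE /tm_read c0; case: (x =P _) => [->|_]; rewrite cc0.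
Qed.

Lemma gguess_sound t v c n : ginv c PG (gpart v) (fun=> (size v).+1) n -> tm_accepts_in t c ->
  exists2 g, size (drop n w) <= size g &
    naccepts tr q0 acc (v ++ pad (drop n w) g).
Proof.
elim: t v c n => [|t IH] v c n inv; have [cq cp cc c0 cc0] := inv.
  by rewrite /= cq inE.
rewrite /= cq /= => -[b]; rewrite inE.
have sE : gletter ([ffun i => tm_read (tm_tapes c i)] ord0) = ohead (drop n w).
  by rewrite ffunE /tm_read c0 cc0 input_cell; case: (ohead _).
rewrite sE => /orP[/existsP[g /eqP ->]|/andP[s0 /eqP ->]].
  case/(IH _ _ _ (gguess_step g inv)) => g' sg na; exists (g :: g').
    by move: sg; rewrite /= !size_drop; lia.
  move: na; rewrite /= cat_rcons -[n.+1]add1n -drop_drop drop1.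
  by [].
case/(grewind _ (gstop_step inv)) => // t' _ na; exists [::].
  move: s0; rewrite ffunE /tm_read c0 cc0 input_cell.
  by case: (drop n w).
by rewrite cats0; exists t'.
Qed.

(** The time is made up of one step per guessed letter, one for the right endmarker, the way back
    over the whole word with one step at the left endmarker, and [t]. *)
Lemma gguess_complete g v c n t : ginv c PG (gpart v) (fun=> (size v).+1) n ->
  size (drop n w) <= size g -> naccepts_in tr acc (v ++ pad (drop n w) g) t (ninit I q0) ->
  tm_accepts_in (t + (size v + size g).+1 + (size g).+1) c.
Proof.
elim: g v c n => [|g gs IH] v c n inv sz na; have [cq cp cc c0 cc0] := inv.
  rewrite addn1 /= cq /=.
  exists (gact PR (fun=> (Some (inr (Some None)), MLeft))
            ([ffun i => tm_read (tm_tapes c i)] ord0, MStay)).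
    rewrite inE; apply/orP; right; rewrite eqxx andbT ffunE /tm_read c0 cc0 input_cell.
    by move: sz; case: (drop n w).
  apply/(grewind _ (gstop_step inv)) => //; exists t; first by rewrite addn0.
  by rewrite cats0 in na.
rewrite addnS /= cq /=.
have sE : gletter ([ffun i => tm_read (tm_tapes c i)] ord0) = ohead (drop n w).
  by rewrite ffunE /tm_read c0 cc0 input_cell; case: (ohead _).
exists (gact PG (fun=> (Some (inr (Some (Some (ohead (drop n w), g)))), MRight))
          ([ffun i => tm_read (tm_tapes c i)] ord0, MRight)).
  by rewrite inE sE; apply/orP; left; apply/existsP; exists g.
have -> : t + (size v + (size gs).+1).+1 + (size gs).+1 =
   t + (size (rcons v (ohead (drop n w), g)) + size gs).+1 + (size gs).+1.
  by rewrite size_rcons; lia.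
apply: IH; [exact: (gguess_step g inv)|by move: sz; rewrite /= !size_drop; lia|].
by rewrite cat_rcons -[n.+1]add1n -drop_drop drop1.
Qed.

Lemma ginit : ginv (gnext (tm_initial gntm w)
    (gact PG (fun=> (Some (inr None), MRight)) ([ffun i => tm_read (tm_tapes (tm_initial gntm w) i)] ord0, MStay)))
  PG (gpart [::]) (fun=> 1) 0.
Proof.
have [E1 E2 E3] := gnextE (tm_initial gntm w) PG (fun=> (Some (inr None), MRight))
  ([ffun i => tm_read (tm_tapes (tm_initial gntm w) i)] ord0, MStay).
split=> // [i|i x||x]; rewrite ?E2 ?E3 //=.
  by rewrite -(tc_set [::]) /=; case: x => [[]|].
by rewrite ffunE /tm_read /=; case: (x =P _) => [->|_].
Qed.

End Guess.

Lemma NP_of_multihead (Sigma G Q I Ch : finType) (i1 : I)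
    (tr : Q -> {ffun I -> input_symbol (option Sigma * G)} -> Ch ->
          option (Q * {ffun I -> move}))
    (q0 : Q) (acc : {set Q}) (L : language Sigma) (p : {poly nat}) :
  (forall w g, size w <= size g -> naccepts tr q0 acc (pad w g) -> L w) ->
  (forall w, L w -> exists g, [/\ size w <= size g, size g <= (p.[size w])%R &
     naccepts tr q0 acc (pad w g)]) ->
  NP L.
Proof.
move=> sound complete.
exists _, (gntm tr q0 acc i1).
exists (#|Q|%:P * (p + 2%:P) ^+ #|I| + p + p + 4%:P)%R.
have compl w : L w -> exists2 t,
    t <= ((#|Q|%:P * (p + 2%:P) ^+ #|I| + p + p + 4%:P).[size w])%R &
    tm_accepts_in t (tm_initial (gntm tr q0 acc i1) w).
  move=> /complete [g [wg gp /naccepts_short [t tb na]]].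
  exists (t + (0 + size g).+1 + (size g).+1).+1.
    have -> : ((#|Q|%:P * (p + 2%:P) ^+ #|I| + p + p + 4%:P).[size w])%R =
        #|Q| * ((p.[size w])%R + 2) ^ #|I| + (p.[size w])%R + (p.[size w])%R + 4.
      rewrite !(hornerD, hornerM, horner_exp, hornerC).
      have expE (x n : nat) : (x ^+ n)%R = x ^ n by elim: n => // n IH; rewrite exprS IH expnS.
      by rewrite expE.
    rewrite size_pad in tb.
    have : (size g).+2 ^ #|I| <= ((p.[size w])%R + 2) ^ #|I|.
      by case: #|I| => // k; rewrite leq_exp2r // addn2.
    by rewrite ?add0n; move: gp tb; move: (p.[size w])%R => z; nia.
  eexists; first by rewrite /= inE.
  by apply: (gguess_complete (ginit tr q0 acc i1 w)); rewrite ?drop0.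
split=> // w; split=> [/compl[t _ Ht]|[t]]; first by exists t.
case: t => [|t]; first by rewrite /= inE.
case=> b; rewrite /= inE => /eqP -> /(gguess_sound (ginit tr q0 acc i1 w))[g].
by rewrite drop0 => ? ?; apply: (sound w g).
Qed.

(** * The verifier for compressed memory contents *)

Section Verifier.
Variables (Sigma : finType) (h : nat) (A : automaton Sigma h) (k : nat).
Local Notation D := (marks A).
Local Notation H := 'I_h.

(* The guessed word describes a memory content: [inl c] is a cell with content
   [c], and [inr i] is a block of blank cells whose length is written in binary,
   most significant digit first, on track [i] of the whole word. *)
Definition csym := (option D + 'I_k)%type.
Definition gsymb := (csym * {ffun 'I_k -> bool})%type.
Local Notation Gam := (option Sigma * gsymb)%type.

(** The direction of a crossing ([true] is to the right), the track with the length of the block,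
    and the state in which each repeated period begins. *)
Definition cross := (bool * 'I_k * state A)%type.

Inductive vstate :=
  | Scan of 'I_k.+1 | Rew | Norm of state A
  | Base of cross & option bool
  | Cyc of cross & option bool & state A & {ffun H -> bool}
  | AdvC of cross & bool | Dbl of cross & bool & bool | Dbl2 of cross & bool
  | Ret of cross.

Definition vcode (q : vstate) :=
  match q with
  | Scan c => inl (inl c) | Rew => inl (inr (inl tt)) | Norm q => inl (inr (inr q))
  | Base X l => inr (inl (inl (X, l)))
  | Cyc X l q z => inr (inl (inr (X, l, q, z)))
  | AdvC X b => inr (inr (inl (X, b, None)))
  | Dbl X b c => inr (inr (inl (X, b, Some c)))
  | Dbl2 X b => inr (inr (inr (X, Some b)))
  | Ret X => inr (inr (inr (X, None)))
  end.

Definition vdecode (c : ('I_k.+1 + (unit + state A)) +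
    (((cross * option bool) + (cross * option bool * state A * {ffun H -> bool})) +
     ((cross * bool * option bool) + (cross * option bool)))) : vstate :=
  match c with
  | inl (inl c) => Scan c | inl (inr (inl _)) => Rew | inl (inr (inr q)) => Norm q
  | inr (inl (inl (X, l))) => Base X l
  | inr (inl (inr (X, l, q, z))) => Cyc X l q z
  | inr (inr (inl (X, b, None))) => AdvC X b
  | inr (inr (inl (X, b, Some c))) => Dbl X b c
  | inr (inr (inr (X, Some b))) => Dbl2 X b
  | inr (inr (inr (X, None))) => Ret X
  end.

Lemma vcodeK : cancel vcode vdecode. Proof. by case. Qed.
HB.instance Definition _ := Finite.copy vstate (can_type vcodeK).

(** [hM] is on the described memory and [hG] on the current digit. [hR] is the remaining distance at
    the current scale, [hS] scratch space for doubling it, [hY] the displacement within a period.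
    [hX] simulates the input heads and [hZ] holds their distances from where the period began, so
    that its closing can be tested. *)
Definition vhead := ('I_5 + (H + H))%type.
Definition hM : vhead := inl (0%R : 'I_5).
Definition hG : vhead := inl (1%R : 'I_5).
Definition hR : vhead := inl (2%R : 'I_5).
Definition hS : vhead := inl (3%R : 'I_5).
Definition hY : vhead := inl (4%R : 'I_5).
Definition hX (j : H) : vhead := inr (inl j).
Definition hZ (j : H) : vhead := inr (inr j).

Definition mkh (T : Type) (m g r s y : T) (x z : {ffun H -> T}) : {ffun vhead -> T} :=
  [ffun i => match i with
   | inl n => match val n with 0 => m | 1 => g | 2 => r | 3 => s | _ => y end
   | inr (inl j) => x j
   | inr (inr j) => z j
   end].

Definition vchoice := ('I_4 + (bool * 'I_k))%type.

Definition st : {ffun H -> move} := [ffun=> MStay].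
Definition vmove m g r s y := mkh m g r s y st st.

Definition ain (s : input_symbol Gam) : input_symbol Sigma :=
  match s with LeftEnd => LeftEnd | Letter (Some a, _) => Letter a | _ => RightEnd end.

Definition cellof (s : input_symbol Gam) : option csym :=
  if s is Letter (_, (c, _)) then Some c else None.

Definition dirv (dir : bool) (v : move) : move :=
  if dir then v else match v with MLeft => MRight | MStay => MStay | MRight => MLeft end.

Definition zmove (sg : bool) (zero : bool) (d : move) : bool * move :=
  match d with
  | MStay => (sg, MStay)
  | MRight => if sg || zero then (true, MRight) else (false, MLeft)
  | MLeft => if sg && ~~ zero then (true, MLeft) else (false, MRight)
  end.

(** A head pushed against the right endmarker would stay there silently and falsify the count it
    represents; such a step is refused. *)
Definition okinc (s : input_symbol Gam) (d : move) : bool :=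
  ~~ (at_right s && (d == MRight)).

(** [Base] is the point between two periods and [Cyc] runs through one. [lvl] is [None] while digits
    are read; at scale 1 it is [Some b], with [b] telling whether [hM] has passed the block. [AdvC]
    advances [hM] and lengthens the remaining distance by the explicit cells that it enters; [Ret]
    brings [hM] back to where the run really is. *)
Definition vtrans (q : vstate) (s : {ffun vhead -> input_symbol Gam}) (ch : vchoice) :
    option (vstate * {ffun vhead -> move}) :=
  let go q := Some (q, vmove MStay MStay MStay MStay MStay) in
  let xs : {ffun H -> input_symbol Sigma} := [ffun j => ain (s (hX j))] in
  let zero i := at_left (s i) in
  match q with
  | Scan c =>
      match s hM with
      | RightEnd => go Rew
      | Letter (_, (inl (Some _), _)) =>
          if c < k then Some (Scan (inord c.+1), vmove MRight MStay MStay MStay MStay)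
          else None
      | _ => Some (Scan c, vmove MRight MStay MStay MStay MStay)
      end
  | Rew =>
      if zero hM then Some (Norm (start A), vmove MRight MStay MStay MStay MStay)
      else Some (Rew, vmove MLeft MStay MStay MStay MStay)
  | Norm q =>
      match ch with
      | inr (dir, i) =>
          if zero hG && (cellof (s hM) == Some (inl None))
          then Some (Base (dir, i, q) None, vmove MStay MRight MStay MStay MStay)
          else None
      | inl n =>
          if n == 0%R then
            if zero hM then Some (Norm q, vmove MRight MStay MStay MStay MStay)
            else if cellof (s hM) is Some (inl c) then
              let: (q', ds, v) := trans q xs c in
              Some (Norm q', mkh v MStay MStay MStay MStay
                               [ffun j => clamp (xs j) (ds j)] st)
            else None
          else Some (Norm q, vmove MStay MLeft MStay MStay MStay)
      end
  | Base X lvl =>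
      let: (dir, i, q) := X in
      if ch is inl n then
        if n == 0%R then Some (Base X lvl, vmove MStay MStay MStay MStay MLeft)
        else if ~~ zero hY then None
        else if n == 1%R then go (Cyc X lvl q [ffun=> true])
        else if n == 2%R :> 'I_4 then
          match lvl with
          | None => match s hG with
                    | Letter (_, (_, t)) =>
                        Some (Dbl X (t i) false, vmove MStay MRight MStay MStay MStay)
                    | RightEnd => go (Base X (Some false))
                    | LeftEnd => None
                    end
          | Some b => Some (AdvC X b, vmove (dirv dir MRight) MStay MStay MStay MStay)
          end
        else if lvl == Some true then go (Ret X) else None
      else None
  | AdvC X b =>
      let: (dir, i, q) := X in
      match cellof (s hM) with
      | Some (inl None) =>
          if okinc (s hR) MRight
          then Some (Base X (Some b), vmove MStay MStay MRight MStay MStay) else None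
      | Some (inr i') =>
          if (i' == i) && ~~ b
          then Some (AdvC X true, vmove (dirv dir MRight) MStay MStay MStay MStay) else None
      | _ => None
      end
  | Cyc X lvl q zs =>
      let: (dir, i, q0) := X in
      if ch is inl n then
        if n == 0%R then
          let: (q', ds, v) := trans q xs None in
          let vd := dirv dir v in
          let dz : {ffun H -> bool * move} :=
            [ffun j => zmove (zs j) (zero (hZ j)) (clamp (xs j) (ds j))] in
          if [&& (vd == MLeft) ==> ~~ zero hY, (vd == MRight) ==> ~~ zero hR,
                 okinc (s hY) vd, okinc (s hR) (dirv false vd) &
                 [forall j, okinc (s (hZ j)) (dz j).2]]
          then Some (Cyc X lvl q' [ffun j => (dz j).1],
                     mkh MStay MStay (dirv false vd) MStay vd
                       [ffun j => clamp (xs j) (ds j)] [ffun j => (dz j).2])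
          else None
        else if (q == q0) && [forall j, zero (hZ j)] then go (Base X lvl) else None
      else None
  | Dbl X b half =>
      if half then
        if okinc (s hS) MRight then
          Some (Dbl X b false, vmove MStay MStay MStay MRight MStay) else None
      else if zero hR then go (Dbl2 X b)
      else if okinc (s hS) MRight then
        Some (Dbl X b true, vmove MStay MStay MLeft MRight MStay) else None
  | Dbl2 X b =>
      if zero hS then
        if ~~ b then go (Base X None)
        else if okinc (s hR) MRight then
          Some (Base X None, vmove MStay MStay MRight MStay MStay) else None
      else if okinc (s hR) MRight then
        Some (Dbl2 X b, vmove MStay MStay MRight MLeft MStay) else None
  | Ret X =>
      let: (dir, i, q) := X in
      if cellof (s hM) == Some (inl None) then
        if zero hR then go (Norm q)
        else Some (Ret X, vmove (dirv dir MLeft) MStay MLeft MStay MStay)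
      else None
  end.

Definition vacc : {set vstate} :=
  [set q | if q is Norm q then q \in accepting A else false].

(** * Runs confined to a blank stretch *)

Section Blank.
Variable w : seq Sigma.

Definition sconf := (state A * {ffun H -> nat})%type.

Definition bstep (s : sconf) : sconf * move :=
  let: (q, ds, v) := trans s.1 [ffun j => read_input w (s.2 j)] None in
  ((q, [ffun j => move_head w (ds j) (s.2 j)]), v).

(** Only the displacement in the direction of the crossing occurs, never the cell itself; this is
    what lets walks be translated and repeated. *)
Inductive walk (dir : bool) (b : nat) (s : sconf) (e : nat) : sconf -> nat -> Prop :=
  | walk_nil : e <= b -> walk dir b s e s e
  | walk_rcons s1 e1 : walk dir b s e s1 e1 ->
      (dirv dir (bstep s1).2 = MLeft -> 0 < e1) ->
      W2_move (dirv dir (bstep s1).2) e1 <= b ->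
      walk dir b s e (bstep s1).1 (W2_move (dirv dir (bstep s1).2) e1).

Lemma walk_le dir b s e s' e' : walk dir b s e s' e' -> e <= b /\ e' <= b.
Proof. by elim=> // s1 e1 _ [? ?]. Qed.

Lemma walk_trans dir b s e s1 e1 s2 e2 :
  walk dir b s e s1 e1 -> walk dir b s1 e1 s2 e2 -> walk dir b s e s2 e2.
Proof. by move=> W1; elim=> // s3 e3 _ IH ? ?; apply: walk_rcons. Qed.

Lemma walk_shift dir b c a s e s' e' : b + a <= c ->
  walk dir b s e s' e' -> walk dir c s (e + a) s' (e' + a).
Proof.
move=> bc; elim=> [eb|s1 e1 W IH H0 H1]; first by apply: walk_nil; lia.
have E : W2_move (dirv dir (bstep s1).2) e1 + a = W2_move (dirv dir (bstep s1).2) (e1 + a).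
  by case: (dirv _ _) H0 => //= H0; have := H0 erefl; lia.
rewrite E; apply: walk_rcons => //; first by move/H0; lia.
by rewrite -E; lia.
Qed.

Lemma walk_repeat dir b s e n : walk dir b s 0 s e -> walk dir (b * n) s 0 s (e * n).
Proof.
move=> W; have [_ eb] := walk_le W.
elim: n => [|n IH]; first by rewrite !muln0; apply: walk_nil.
have W1 : walk dir (b * n.+1) s 0 s (e * n).
  have bc : b * n + 0 <= b * n.+1 by nia.
  by have := walk_shift bc IH; rewrite !addn0.
apply: walk_trans W1 _; rewrite [e * n.+1]mulnS.
have bc : b + e * n <= b * n.+1 by nia.
by have := walk_shift bc W; rewrite add0n.
Qed.

Definition dpos (dir : bool) (c e : nat) := if dir then c + e else c - e.

Variable mu : memory_content D.

Definition areach (s : sconf) (c : nat) :=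
  exists t, iter t (step w mu) (initial A) = Configuration s.1 s.2 c.

(** To the left, [dpos] is a truncated subtraction; [b <= c] excludes truncation and with it the
    loop at cell 0. *)
Lemma walk_run dir b s s' e c : walk dir b s 0 s' e -> areach s c ->
  (forall j, j <= b -> mu (dpos dir c j) = None) -> (~~ dir -> b <= c) ->
  areach s' (dpos dir c e).
Proof.
move=> + ar bl bc; elim=> [_|s1 e1 W IH H0 H1]; first by rewrite /dpos; case: (dir); rewrite ?addn0 ?subn0.
case: IH => t Ht; have [_ e1b] := walk_le W; exists t.+1; rewrite iterS Ht /step /= bl //.
move: H0 H1; rewrite /bstep; case: (trans _ _ _) => [[q ds] v] /= H0 H1.
congr Configuration; move: H0 H1; rewrite /dpos.
case: dir {W ar Ht} bc bl => /= bc bl; case: v => //= H0 H1; try (have := H0 erefl); try (have := bc isT); lia.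
Qed.

End Blank.

Section Sound.
Variables (w : seq Sigma) (g : seq gsymb).
Hypothesis wg : size w <= size g.
Let u := pad w g.
Let cs := [seq x.1 | x <- g].

Lemma pad_nth p : p < size g ->
  exists a, nth RightEnd [seq Letter x | x <- u] p = Letter (a, nth (inl None, [ffun=> false]) g p).
Proof.
rewrite /u; elim: g (w) p => //= x gs IH ws [|p] //=; first by exists (ohead ws).
exact: IH.
Qed.

Lemma pad_read p : p < (size w).+2 -> ain (read_input u p) = read_input w p.
Proof.
rewrite /u /read_input; case: p => //= p; rewrite !ltnS; move: wg.
by elim: g (w) p => [|x gs IH] [|y ws] [|p] //=; apply: IH.
Qed.

Definition digits_of i := [seq x.2 i | x : gsymb <- g].
Definition horner2 (s : seq bool) := foldl (fun a (b : bool) => a.*2 + b) 0 s.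
Definition blen i := horner2 (digits_of i).

Definition width (bl : 'I_k -> nat) (c : csym) : seq (option D) :=
  match c with inl c => [:: c] | inr i => nseq (bl i) None end.
Definition expand bl (s : seq csym) := flatten (map (width bl) s).
Definition emb bl s p := size (expand bl (take p s)).

Lemma emb0 bl s : emb bl s 0 = 0. Proof. by rewrite /emb take0. Qed.

Lemma embS bl s p c : p < size s -> nth (inl None) s p = c ->
  emb bl s p.+1 = emb bl s p + size (width bl c).
Proof.
move=> ps <-; rewrite /emb (take_nth (inl None)) // -cats1 /expand map_cat flatten_cat.
by rewrite size_cat /= cats0.
Qed.

Lemma nth_expand bl s p c j : p < size s -> nth (inl None) s p = c ->
  j < size (width bl c) ->
  nth None (expand bl s) (emb bl s p + j) = nth None (width bl c) j.
Proof.
move=> ps E js; rewrite -{1}(cat_take_drop p s) (drop_nth (inl None)) // E.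
rewrite /expand map_cat flatten_cat nth_cat -/(expand _ _) -/(emb bl s p) ltnNge leq_addr /=.
by rewrite addKn nth_cat js.
Qed.

Let bl := blen.
Let mu x := nth None (expand bl cs) x.
Let cpos m := emb bl cs m.-1.
Let cellat m := if m is p.+1 then onth cs p else None.

Lemma cellofE m : cellof (read_input u m) = cellat m.
Proof.
rewrite /read_input; case: m => //= p; rewrite onthE.
case: (ltnP p (size g)) => pg; last by rewrite !nth_default ?size_map ?size_pad.
have [a ->] := pad_nth pg; rewrite (nth_map (inl None)) ?size_map //.
by rewrite (nth_map (inl None, [ffun=> false])) //=; case: (nth _ _ _).
Qed.

Lemma cellat_step m c : cellat m = Some c ->
  emb bl cs m = cpos m + size (width bl c) /\
  forall j, j < size (width bl c) -> mu (cpos m + j) = nth None (width bl c) j.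
Proof.
case: m => //= p E; have pc : p < size cs by rewrite -onthTE E.
have Ep : nth (inl None) cs p = c by rewrite -odflt_onth E.
by split=> [|j]; [exact: embS|exact: nth_expand].
Qed.

Definition mkb (c : csym) := if c is inl (Some _) then true else false.

Lemma U_mu : count mkb cs <= k -> U k mu.
Proof.
move=> ck; exists [seq i <- iota 0 (size (expand bl cs)) | isSome (mu i)].
  apply: leq_trans ck; rewrite size_filter.
  have -> : count (fun i => isSome (mu i)) (iota 0 (size (expand bl cs))) =
            count isSome (expand bl cs).
    by rewrite -[in RHS](mkseq_nth None (expand bl cs)) count_map.
  rewrite /expand; elim: cs => //= c s IH; rewrite count_cat leq_add //.
  by case: c => [[]|i] //=; rewrite count_nseq.
move=> i; rewrite mem_filter mem_iota add0n; rewrite /mu.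
by case: (ltnP i (size (expand bl cs))) => [_|le]; [case: nth|rewrite nth_default].
Qed.

Local Notation conf q m gg r s y x z := ((q, mkh m gg r s y x z) : nconf _ _).
Let xb (x : {ffun H -> nat}) := forall j, x j < (size w).+2.
Let z0 : {ffun H -> nat} := [ffun=> 0].

(** [c0] is the cell where the crossing began, [D] the distance described by what has been read, and
    [D - r] the part covered. While digits are read, walks are asserted at every scale [K], since
    the number of digits still to come is open; at the end [K = 1] is used. *)
Definition base_inv (X : cross) (lvl : option bool) (x : {ffun H -> nat}) (r m gg : nat) : Prop :=
  let: (dir, i, q) := X in
  exists c0 D, [/\ areach w mu (q, x) c0, r <= D &
    match lvl with
    | None => [/\ 0 < gg, cellat m = Some (inl None), cpos m = c0,
                D = horner2 (take gg.-1 (digits_of i)) &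
                forall K, walk w dir (D * K) (q, x) 0 (q, x) ((D - r) * K)]
    | Some b => let e := if b then D else D - bl i in
       [/\ ~~ b -> bl i <= D, forall j, j <= e -> mu (dpos dir c0 j) = None,
           cellat m = Some (inl None) /\ cpos m = dpos dir c0 e, ~~ dir -> e <= c0 &
           walk w dir D (q, x) 0 (q, x) (D - r)]
    end].

(** For [Norm] the claim on the cell is conditional: on a block symbol [hM] determines no cell, and
    no further step can be simulated from there. Position 0 stands for cell 0, because the loop at
    cell 0 is simulated by stepping onto the left endmarker and back. *)
Definition vinv_at (q : vstate) (m gg r s y : nat) (x z : {ffun H -> nat}) : Prop :=
  match q with
  | Scan c => [/\ r = 0, s = 0 & y = 0] /\ [/\ x = z0, z = z0 &
                count mkb (take m.-1 cs) = c]
  | Rew => [/\ r = 0, s = 0 & y = 0] /\ [/\ x = z0, z = z0 & count mkb cs <= k]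
  | Norm q => [/\ r = 0, s = 0, y = 0, z = z0 & count mkb cs <= k] /\
      exists2 c1, areach w mu (q, x) c1 &
        m = 0 \/ (exists c, cellat m = Some (inl c)) -> c1 = cpos m
  | Base X lvl => [/\ s = 0, z = z0, count mkb cs <= k & base_inv X lvl x r m gg]
  | Cyc X lvl q zs => [/\ s = 0, count mkb cs <= k & exists xs : {ffun H -> nat},
      [/\ base_inv X lvl xs (r + y) m gg, xb xs,
          forall j, if zs j then x j = xs j + z j else x j + z j = xs j &
          walk w X.1.1 (r + y) (X.2, xs) 0 (q, x) y]]
  | AdvC (dir, i, q) b => [/\ s = 0, y = 0, z = z0, count mkb cs <= k &
      exists c0 D, let e := if b then D else D - bl i in
      [/\ areach w mu (q, x) c0, r <= D, walk w dir D (q, x) 0 (q, x) (D - r) &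
      [/\ ~~ b -> bl i <= D, forall j, j <= e -> mu (dpos dir c0 j) = None,
          ~~ dir -> e <= c0 &
          if dir then 0 < m /\ cpos m = c0 + e + 1 else emb bl cs m = c0 - e]]]
  | Dbl X b half => [/\ y = 0, z = z0, count mkb cs <= k & exists r0,
      [/\ base_inv X None x r0 m gg.-1, nth false (digits_of X.1.2) gg.-2 = b, 1 < gg <= (size g).+1,
          r + half <= r0 & (r0 - r).*2 = s + half]]
  | Dbl2 X b => [/\ y = 0, z = z0, count mkb cs <= k & exists r0,
      [/\ base_inv X None x r0 m gg.-1, nth false (digits_of X.1.2) gg.-2 = b, 1 < gg <= (size g).+1 &
          r + s = r0.*2]]
  | Ret (dir, i, q) => [/\ s = 0, y = 0, z = z0, count mkb cs <= k &
      exists ct, areach w mu (q, x) ct /\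
      (cellat m = Some (inl None) -> if dir then cpos m = ct + r else cpos m + r = ct)]
  end.

Definition vinv (c : nconf vstate vhead) : Prop :=
  exists m gg r s y x z, [/\ c.2 = mkh m gg r s y x z, m < (size g).+2, xb x &
    vinv_at c.1 m gg r s y x z].

Lemma vinvI q m gg r s y x z : m < (size g).+2 -> xb x ->
  vinv_at q m gg r s y x z -> vinv (q, mkh m gg r s y x z).
Proof. by move=> *; do 7!eexists; split=> //; assumption. Qed.

Lemma vinv_init : vinv (ninit vhead (Scan ord0)).
Proof.
exists 0, 0, 0, 0, 0, z0, z0; split=> //=.
- by apply/ffunP => -[[[|[|[|[|[|]]]]] //= ?]|[j|j]]; rewrite !ffunE.
- by move=> j; rewrite ffunE.
- by split=> //; split=> //; rewrite take0.
Qed.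

Lemma nnext_mkh q m gg r s y x z q' dm dg dr ds dy (dx dz : {ffun H -> move}) :
  nnext u (q, mkh m gg r s y x z) (q', mkh dm dg dr ds dy dx dz) =
  (q' : vstate, mkh (move_head u dm m) (move_head u dg gg) (move_head u dr r)
     (move_head u ds s) (move_head u dy y)
     [ffun j => move_head u (dx j) (x j)] [ffun j => move_head u (dz j) (z j)]).
Proof.
congr pair; apply/ffunP => -[[[|[|[|[|[|]]]]] //= ?]|[j|j]]; rewrite !ffunE //.
Qed.

Lemma move_st (x : {ffun H -> nat}) : [ffun j => move_head u (st j) (x j)] = x.
Proof. by apply/ffunP => j; rewrite !ffunE. Qed.

Lemma szu : size u = size g. Proof. exact: size_pad. Qed.

Lemma okincE p d : okinc (read_input u p) d -> move_head u d p = W2_move d p.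
Proof.
case: d => //=; rewrite /okinc eqxx andbT /read_input.
case: p => [|p] /=; first by rewrite minnSS min0n.
case: (ltnP p (size u)) => pu; first by rewrite minnSS (minn_idPl pu).
by rewrite nth_default ?size_map.
Qed.

Lemma xmove (x : {ffun H -> nat}) (ds : {ffun H -> move}) : xb x ->
  [ffun j => move_head u (clamp (read_input w (x j)) (ds j)) (x j)] =
  [ffun j => move_head w (ds j) (x j)].
Proof.
move=> xbx; apply/ffunP => j; rewrite !ffunE; have := xbx j.
have := read_left w (x j); have := read_right (xbx j).
by case: (read_input w (x j)) (ds j) => [||a] [] //=; rewrite ?szu; lia.
Qed.

Lemma xb_move (x : {ffun H -> nat}) (ds : {ffun H -> move}) : xb x ->
  xb [ffun j => move_head w (ds j) (x j)].
Proof. by move=> xbx j; rewrite ffunE; have := xbx j; case: (ds j) => /=; lia. Qed.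

(** At scale [K], the walk known so far is prolonged by [K] copies of the period. Their excursions
    fit because one period stays within the distance [r + y] that remained. *)
Lemma base_cycle X lvl x r y m gg : base_inv X lvl x (r + y) m gg ->
  walk w X.1.1 (r + y) (X.2, x) 0 (X.2, x) y -> base_inv X lvl x r m gg.
Proof.
case: X => [[dir i] q] [c0 [E [ar rD Hl]]] /= W; exists c0, E; split=> //; first by lia.
have cyc K : walk w dir (E * K) (q, x) 0 (q, x) ((E - (r + y)) * K) ->
    walk w dir (E * K) (q, x) 0 (q, x) ((E - r) * K).
  move=> W0; have bc : (r + y) * K + (E - (r + y)) * K <= E * K by nia.
  have := walk_trans W0 (_ : walk w dir (E * K) _ _ _ ((E - r) * K)); apply.
  have := walk_shift bc (walk_repeat K W); rewrite add0n.
  by have -> : y * K + (E - (r + y)) * K = (E - r) * K by nia.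
case: lvl Hl => [b|]; last by case=> ? ? ? ? HK; split=> // K; apply: cyc.
case=> ? ? ? ? W1; split=> //; have := cyc 1; rewrite !muln1; exact.
Qed.

Lemma vinv_step c c' : vinv c -> nstep vtrans u c c' -> vinv c'.
Proof.
move=> [m [gg [r [s [y [x [z [E mg xbx]]]]]]]].
case: c E => q hs /= E; rewrite {}E {hs} => inv /existsP[ch].
set sy := [ffun i => read_input u (mkh m gg r s y x z i)].
have [sM sG sR sS sY] : [/\ sy hM = read_input u m, sy hG = read_input u gg,
   sy hR = read_input u r, sy hS = read_input u s & sy hY = read_input u y].
  by split; rewrite !ffunE.
have sX j : sy (hX j) = read_input u (x j) by rewrite !ffunE.
have sZ j : sy (hZ j) = read_input u (z j) by rewrite !ffunE.
have xsE : [ffun j => ain (sy (hX j))] = [ffun j => read_input w (x j)].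
  by apply/ffunP => j; rewrite !ffunE /= pad_read.
have szc : size cs = size g by rewrite /cs size_map.
have cellm c : cellat m = Some c -> 0 < m <= size g.
  by case: (m) => //= p E; rewrite -szc -onthTE E.
have mem d : move_head u d m < (size g).+2 by case: d => /=; rewrite ?szu; lia.
case: q inv => [c||q|X lvl|X lvl q zs|X b|X b half|X b|X] inv /=.
- case: inv => -[r0 s0 y0] [x0 zz cE]; rewrite sM.
  have := cellofE m; case Em : (read_input u m) => [||[a [cc t]]] /= cm.
  + move=> /eqP ->; rewrite nnext_mkh !move_st; apply: vinvI => //.
    split; split=> //; have m0 : m = 0.
      by apply/eqP; rewrite -(read_left u) Em.
    by rewrite m0 take0 in cE *; rewrite -cE /= (_ : (minn 1 _).-1 = 0) ?take0 // minnSS min0n.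
  + move=> /eqP ->; rewrite nnext_mkh !move_st; apply: vinvI => //.
    split; split=> //; have mE : m = (size g).+1.
      by apply/eqP; rewrite -szu -(@read_right _ u m) ?Em // szu.
    by move: cE; rewrite mE /= -szc take_size => ->; rewrite -ltnS.
  + have /andP[m0 mg'] := cellm _ (esym cm).
    have cE' : count mkb (take m cs) = c + mkb cc.
      move: cm m0 cE; case: (m) => //= p E _ <-.
      have pc : p < size cs by rewrite -onthTE -E.
      rewrite (take_nth (inl None)) // -cats1 count_cat /= addn0.
      by rewrite -odflt_onth -E.
    have mE : minn m.+1 (size u).+1 = m.+1 by rewrite szu; lia.
    have fin (cn : 'I_k.+1) : cn = c + mkb cc :> nat ->
        vinv (nnext u (Scan c, mkh m gg r s y x z) (Scan cn, vmove MRight MStay MStay MStay MStay)).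
      move=> cnE; rewrite nnext_mkh !move_st /= mE; apply: vinvI => //.
      by split; split=> //; rewrite cE'.
    case: cc cE' {cm Em} fin => [[o|]|i] cE' fin; last 2 first.
    * by move=> /eqP ->; apply: fin; rewrite addn0.
    * by move=> /eqP ->; apply: fin; rewrite addn0.
    by case: ifP => // ck /eqP ->; apply: fin; rewrite inordK ?addn1.
- case: inv => -[r0 s0 y0] [x0 zz ck]; rewrite sM (read_left u) /=.
  case: eqP => [m0|_] /eqP ->; rewrite nnext_mkh !move_st; apply: vinvI => //.
  split; first by split.
  rewrite /=; have -> : minn m.+1 (size u).+1 = 1 by rewrite m0 minnSS min0n.
  by exists 0; [exists 0; rewrite x0|rewrite /cpos /= emb0].
- case: inv => -[r0 s0 y0 zz ck] [c1 ar1 c1E]; case: ch => [n|[dir i]]; last first.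
    case: ifP => // /andP[g0 cm] /eqP ->; rewrite nnext_mkh !move_st; apply: vinvI => //.
    split=> //=; move: g0 cm; rewrite sG sM (read_left u) cellofE => /eqP g0 /eqP cm.
    exists (cpos m), 0; split=> //; first by rewrite -c1E //; right; exists None.
      by rewrite r0.
    rewrite g0; split=> //; first by lia.
      by rewrite (_ : (minn 1 _).-1 = 0) ?take0 // minnSS min0n.
    by move=> K; rewrite !mul0n; apply: walk_nil.
  case: ifP => _; last first.
    by move=> /eqP ->; rewrite nnext_mkh !move_st; apply: vinvI => //; split=> //; exists c1.
  rewrite sM (read_left u) cellofE; case: (m =P 0) => [m0|mn0].
    move=> /eqP ->; rewrite nnext_mkh !move_st; apply: vinvI => //.
    split=> //; exists c1 => // _; rewrite c1E; last by left.
    by rewrite m0 /cpos /= minnSS min0n.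
  case cm : (cellat m) => [[c|//]|//]; rewrite xsE.
  have [mE mc] := cellat_step cm; have := mc 0 isT; rewrite addn0 /= => {}mc.
  have [t Ht] := ar1; rewrite (c1E (or_intror (ex_intro _ c cm))) in Ht.
  case Et : (trans q _ c) => [[q' ds] v] /eqP ->; rewrite nnext_mkh !move_st.
  rewrite (_ : [ffun j => move_head u (_ j) (x j)] = [ffun j => move_head w (ds j) (x j)]); last first.
    by rewrite -xmove //; apply/ffunP => j; rewrite !ffunE.
  apply: vinvI => //; first exact: xb_move.
  split=> //; exists (W2_move v (cpos m)).
    by exists t.+1; rewrite iterS Ht /step /= mc Et.
  move=> posm.
  have /andP[m1 m2] := cellm _ cm.
  case: v {Et} posm => //= [posm|posm]; last first.
    by rewrite (_ : minn m.+1 (size u).+1 = m.+1) /cpos /=; [rewrite mE addn1|rewrite szu; lia].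
  case: (m) m1 cm posm mE => // -[|p] _ cm posm mE; first by rewrite /cpos /= emb0.
  case: posm => // -[c2 cm']; have [mE' _] := cellat_step cm'.
  by rewrite /cpos /= in mE' *; rewrite mE' /= addn1.
- case: X inv => [[dir i] q] [s0 zz ck bi]; case: ch => // n.
  case: ifP => _.
    by move=> /eqP ->; rewrite nnext_mkh !move_st; apply: vinvI.
  rewrite sY (read_left u); case: (y =P 0) => //= y0; case: ifP => _.
    move=> /eqP ->; rewrite nnext_mkh !move_st; apply: vinvI => //=; split=> //.
    exists x; rewrite y0 addn0; split=> //; last by apply: walk_nil.
    by move=> j; rewrite !ffunE zz ffunE addn0.
  case: ifP => _; last first.
    case: (lvl =P Some true) bi => // -> bi /eqP ->; rewrite nnext_mkh !move_st; apply: vinvI => //.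
    case: bi => c0 [E [ar rD [_ bk [cm cmE] Ec W]]]; split=> //.
    (* The front is at distance [E] from the start and [r] remains, so the run itself has come as
       far as [E - r]. *)
    exists (dpos dir c0 (E - r)); split.
      exact: walk_run W ar bk Ec.
    by move=> _ /=; rewrite cmE /dpos; case: (dir) Ec => /= Ec; [|have := Ec isT]; lia.
  case: lvl bi => [b|] bi.
    move=> /eqP ->; rewrite nnext_mkh !move_st; apply: vinvI => //=; split=> //.
    case: bi => c0 [E [ar rD [bE bk [cm cmE] Ec W]]]; exists c0, E; split=> //; split=> //.
    have /andP[m0 m1] := cellm _ cm; have [mE _] := cellat_step cm.
    rewrite /= in mE; move: cmE; rewrite /dpos; case: (dir) => /= cmE; last by rewrite -cmE.
    rewrite (_ : minn m.+1 (size u).+1 = m.+1); last by rewrite szu; lia.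
    by split=> //; rewrite /cpos /= mE cmE.
  rewrite sG; case Eg : (read_input u gg) => [||[a [cc t]]] //; last first.
    have g1 : 0 < gg by case: bi => c0 [E [_ _ []]].
    have ggs : gg <= size g.
      rewrite leqNgt; apply/negP => lt; move: Eg; rewrite /read_input.
      by case: (gg) lt => //= p lt; rewrite nth_default ?size_map ?szu.
    have Et : t i = nth false (digits_of i) gg.-1.
      move: Eg; rewrite /read_input; case: (gg) g1 ggs => //= p _ pg.
      have [a' ->] := pad_nth pg; rewrite /digits_of (nth_map (inl None, [ffun=> false])) //.
      by case: (nth _ _ _) => c1 t1 [_ _ ->].
    move=> /eqP ->; rewrite nnext_mkh !move_st; apply: vinvI => //=.
    rewrite (_ : minn gg.+1 (size u).+1 = gg.+1); last by rewrite szu; lia.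
    split=> //; exists r; split=> //=; first by lia.
      by rewrite addn0.
    by rewrite subnn s0.
  move=> /eqP ->; rewrite nnext_mkh !move_st; apply: vinvI => //=; split=> //.
  case: bi => c0 [E [ar rD [g1 cm cE EE W]]]; exists c0, E.
  have EB : E = bl i.
    rewrite EE take_oversize // size_map.
    have := @read_right _ u gg; rewrite Eg szu /= => rr.
    rewrite leqNgt; apply/negP => lt; have := rr ltac:(lia); lia.
  split=> //; rewrite -EB subnn; split=> //.
  + by move=> j; rewrite leqn0 => /eqP ->; rewrite /dpos addn0 subn0 if_same -cE;
      have [_ /(_ 0 isT)] := cellat_step cm; rewrite addn0.
  + by rewrite /dpos addn0 subn0 if_same.
  + by have := W 1; rewrite !muln1.
- case: X inv => [[dir i] q1] [s0 ck [xs [bi xbs zE W]]]; case: ch => // n.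
  case: ifP => _; last first.
    case: ifP => // /andP[/eqP qE /forallP zz] /eqP ->.
    rewrite nnext_mkh !move_st; apply: vinvI => //=.
    have z00 : z = z0 by apply/ffunP => j; have := zz j; rewrite sZ (read_left u) ffunE => /eqP.
    have xE : x = xs.
      by apply/ffunP => j; have := zE j; rewrite z00 ffunE !addn0; case: ifP.
    split=> //; rewrite xE in W *; apply: base_cycle bi _; rewrite /= in W *.
    by rewrite qE in W.
  rewrite xsE; case Et : (trans q _ _) => [[q' ds] v].
  case: ifP => // /and5P[]; rewrite sY sR !(read_left u) => gY gR okY okR /forallP okZ /eqP ->.
  rewrite nnext_mkh.
  rewrite (_ : [ffun j => move_head u (_ j) (x j)] = [ffun j => move_head w (ds j) (x j)]); last first.
    by rewrite -xmove //; apply/ffunP => j; rewrite !ffunE.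
  rewrite (okincE okY) (okincE okR).
  set vd := dirv dir v in gY gR okY okR *.
  apply: vinvI => //; first exact: xb_move.
  have bE : bstep w (q, x) = ((q', [ffun j => move_head w (ds j) (x j)]), v).
    by rewrite /bstep /= Et.
  have ry : W2_move (dirv false vd) r + W2_move vd y = r + y.
    by case: (vd) gY gR => //= gY gR; lia.
  split=> //; exists xs; rewrite ry; split=> //; last first.
    have := walk_rcons W; rewrite bE /=; apply; rewrite -/vd.
      by move=> vE; move: gY; rewrite vE eqxx lt0n.
    by rewrite -ry leq_addl.
  move=> j; have := okZ j; rewrite !ffunE /= !(read_left u).
  have := zE j; have := xbx j.
  have := read_left w (x j); have := read_right (xbx j).
  move=> rr rl xj zj ok.
  have zmE := okincE ok; rewrite zmE {ok zmE}.
  by case: (zs j) zj (read_input w (x j)) rr rl (ds j) => zj [||a] /= rr rl [] /=;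
    case: (z j =P 0) => /= z1; lia.
- case: X inv => [[dir i] q] [s0 y0 zz ck [c0 [E [ar rD W [bE bk Ec cmE]]]]].
  rewrite sM cellofE; case cm : (cellat m) => [[[//|]|i']|] //; last first.
    case: ifP => // /andP[/eqP ii /negPf b0]; move: bE bk Ec cmE; rewrite b0 {b0 b} => bE bk Ec cmE /eqP ->.
    have /andP[m0 m1] := cellm _ cm; have [mE mc] := cellat_step cm.
    rewrite /= size_nseq ii in mE mc; have {}bE := bE isT.
    rewrite nnext_mkh !move_st; apply: vinvI => //=; split=> //; exists c0, E; split=> //.
    case: dir Ec cmE bk W => /= Ec cmE bk W.
      case: cmE => _ cmE; split=> // [j jE|].
        case: (leqP j (E - bl i)) => jj; first exact: bk.
        rewrite /dpos (_ : c0 + j = cpos m + (j - (E - bl i) - 1)); last by rewrite cmE; lia.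
        by rewrite mc ?nth_nseq ?if_same //; lia.
      rewrite (_ : minn m.+1 (size u).+1 = m.+1); last by rewrite szu; lia.
      by split=> //; rewrite /cpos /= mE cmE; lia.
    have {}Ec := Ec isT; rewrite cmE in mE.
    split=> // [j jE||]; try (rewrite /cpos in mE; lia).
    case: (leqP j (E - bl i)) => jj; first exact: bk.
    rewrite /dpos (_ : c0 - j = cpos m + (E - j)); last by lia.
    by rewrite mc ?nth_nseq ?if_same //; lia.
  case: ifP => // ok /eqP ->; rewrite sR in ok.
  have /andP[m0 m1] := cellm _ cm; have [mE mc] := cellat_step cm.
  have := mc 0 isT; rewrite addn0 /= => {}mc; rewrite /= in mE.
  rewrite nnext_mkh !move_st (okincE ok); apply: vinvI => //=; split=> //.
  set e := if b then E else E - bl i in bk Ec cmE.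
  have eE : (if b then E.+1 else E.+1 - bl i) = e.+1.
    by rewrite /e; case: (b) bE => //= bE; have := bE isT; lia.
  exists c0, E.+1; split=> //; rewrite eE.
  have cE : cpos m = dpos dir c0 e.+1 /\ (~~ dir -> e.+1 <= c0).
    rewrite /dpos; case: (dir) cmE Ec => /= [[_ cmE]|cmE] Ec; first by split=> //; lia.
    by have := Ec isT; lia.
  case: cE => cE1 cE2; split=> //.
  + by move=> b0; have := bE b0; lia.
  + move=> j; rewrite leq_eqVlt => /predU1P[->|jE]; last exact: bk.
    by rewrite -cE1.
  + by have bc : E + 0 <= E.+1; [lia|have := walk_shift bc W; rewrite !addn0 subSS].
- case: inv => y0 zz ck [r0 [bi bE gE rr0 sE]]; case: half rr0 sE => rr0 sE.
    rewrite sS; case: ifP => // ok /eqP ->; rewrite nnext_mkh !move_st (okincE ok).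
    apply: vinvI => //; split=> //=; exists r0; split=> //; lia.
  rewrite sR (read_left u); case: (r =P 0) => rz.
    move=> /eqP ->; rewrite nnext_mkh !move_st; apply: vinvI => //=; split=> //; exists r0; split=> //; lia.
  rewrite sS; case: ifP => // ok /eqP ->; rewrite nnext_mkh !move_st (okincE ok).
  apply: vinvI => //; split=> //=; exists r0; split=> //; lia.
- case: inv => y0 zz ck [r0 [bi bE gE sE]]; rewrite sS (read_left u).
  case: (s =P 0) => sz; last first.
    rewrite sR; case: ifP => // ok /eqP ->; rewrite nnext_mkh !move_st (okincE ok).
    by apply: vinvI => //; split=> //=; exists r0; split=> //; lia.
  have rE : r = r0.*2 by lia.
  have nb : base_inv X None x (r + b) m gg.
    move: bi bE; case: X => [[dir i] q] [c0 [E [ar rD [g1 cm cE EE W]]]] bE.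
    exists c0, (E.*2 + b); rewrite rE; split=> //; first by case: (b); lia.
    split=> //; first by lia.
      have -> : gg.-1 = gg.-2.+1 by lia.
      rewrite (take_nth false); last by rewrite size_map; lia.
      by rewrite /horner2 -cats1 foldl_cat /= bE -/(horner2 _) -EE.
    (* Scale [K] after doubling is scale [2 * K] before it; the new digit only adds room, and it
       enters the distance and the remainder alike. *)
    move=> K; have bc : E * (2 * K) + 0 <= (E.*2 + b) * K by nia.
    have := walk_shift bc (W (2 * K)); rewrite !addn0.
    by have -> : (E - r0) * (2 * K) = (E.*2 + b - (r0.*2 + b)) * K by nia.
  case: (b) nb => /= nb.
    rewrite sR; case: ifP => // ok /eqP ->; rewrite nnext_mkh !move_st (okincE ok).
    by apply: vinvI => //; split=> //=; rewrite -addn1.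
  move=> /eqP ->; rewrite nnext_mkh !move_st; apply: vinvI => //; split=> //=.
  by rewrite addn0 in nb.
- case: X inv => [[dir i] q] [s0 y0 zz ck [ct [ar cmE]]].
  rewrite sM cellofE; case: eqP => // cm; have {}cmE := cmE cm.
  have /andP[m0 m1] := cellm _ cm; have [mE _] := cellat_step cm; rewrite /= in mE.
  rewrite sR (read_left u); case: (r =P 0) => rz.
    move=> /eqP ->; rewrite nnext_mkh !move_st; apply: vinvI => //=; split=> //.
    by exists ct => // _; case: (dir) cmE; lia.
  move=> /eqP ->; rewrite nnext_mkh !move_st; apply: vinvI => //=; split=> //.
  exists ct; split=> //; case: dir cmE => /= cmE cm'.
    have [mE' _] := cellat_step cm'; rewrite /= in mE'.
    by have : cpos m = emb bl cs m.-1 by []; rewrite mE' cmE; lia.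
  move: cm'; rewrite (_ : minn m.+1 (size u).+1 = m.+1); last by rewrite szu; lia.
  by move=> _; rewrite {1}/cpos /= mE; lia.
Qed.

Lemma vsound : naccepts vtrans (Scan ord0) vacc u ->
  exists mu' : memory_content D, U k mu' /\ run_accepts w mu'.
Proof.
case=> t [p [pp _ ap]].
have : vinv (last (ninit vhead (Scan ord0)) p).
  elim: p (ninit vhead (Scan ord0)) vinv_init pp {ap} => //= c p IH c0 i0 /andP[st pp].
  exact: IH (vinv_step i0 st) pp.
case: (last _ _) ap => q hs; rewrite inE; case: q => // q qa.
case=> m [gg [r [s [y [x [z [/= _ mg xbx [[_ _ _ _ ck] [c1 [t' Ht] _]]]]]]]]].
by exists mu; split; [exact: U_mu|exists t'; rewrite Ht].
Qed.

End Sound.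
End Verifier.

(** * Runs on blank memory *)

Lemma ex_argmin (f : nat -> int) n : exists2 i, i <= n & forall j, j <= n -> (f i <= f j)%R.
Proof.
elim: n => [|n [i iN Hi]]; first by exists 0 => // j; rewrite leqn0 => /eqP ->.
case: (lerP (f i) (f n.+1)) => le.
  by exists i; [lia|move=> j; rewrite leq_eqVlt => /predU1P[->|/Hi]].
exists n.+1 => // j; rewrite leq_eqVlt => /predU1P[->//|/Hi]; lia.
Qed.

Section Orbit.
Variables (Sigma : finType) (h : nat) (A : automaton Sigma h) (w : seq Sigma).
Local Notation H := 'I_h.
Local Notation sconf := (sconf A).
Variables (dir : bool).

Definition orbit (s : sconf) t : sconf := iter t (fun s => (bstep w s).1) s.
Definition vel (s : sconf) := dirv dir (bstep w s).2.
Fixpoint disp (s : sconf) t : int :=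
  if t is t'.+1 then tm_move (vel (orbit s t')) (disp s t') else 0%R.

Definition nsmall := #|{: state A * {ffun H -> 'I_(size w).+2}}|.
Local Notation P := nsmall.

Lemma orbitD s t i : orbit s (t + i) = orbit (orbit s t) i.
Proof. by rewrite /orbit addnC iterD. Qed.

Lemma dispD s t i : disp s (t + i) = (disp s t + disp (orbit s t) i)%R.
Proof.
elim: i => [|i IH]; first by rewrite addn0 addr0.
by rewrite addnS /= IH orbitD; case: (vel _) => /=; lia.
Qed.

Lemma disp_step s t : (disp s t.+1 <= disp s t + 1)%R.
Proof. by rewrite /=; case: (vel _) => /=; lia. Qed.

Lemma disp_hit s t (a : nat) : (Posz a <= disp s t)%R -> exists2 t', t' <= t & disp s t' = a.
Proof.
elim: t => [|t IH]; first by rewrite /= => ?; exists 0 => //=; lia.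
move=> le; case: (lerP (Posz a) (disp s t)) => [/IH[t' ? ?]|lt]; first by exists t' => //; lia.
by exists t.+1 => //; have := disp_step s t; lia.
Qed.

Lemma orbit_bound (s : sconf) t : (forall j, s.2 j < (size w).+2) -> forall j, (orbit s t).2 j < (size w).+2.
Proof.
move=> sb; elim: t => [|t IH] j; first exact: sb.
rewrite /orbit iterS -/(orbit s t) /bstep; case: (trans _ _ _) => [[q ds] v] /=.
by rewrite ffunE; have := IH j; case: (ds j) => /=; lia.
Qed.

(* First visits of more levels than there are small configurations repeat a
   small configuration; rotating the period to start at its lowest point makes
   it never go below its starting level. *)
Lemma escape (s : sconf) t1 : (forall j, s.2 j < (size w).+2) -> (Posz P <= disp s t1)%R ->
  exists v T (d : nat), [/\ v <= t1, 0 < d <= P, orbit s (v + T) = orbit s v,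
    disp (orbit s v) T = d & [/\
    (forall i, i <= T -> (0 <= disp (orbit s v) i)%R),
    (forall i, i <= T -> (disp s (v + i) <= Posz (P + P)%N)%R) & 0 < T]].
Proof.
move=> sb Y1.
have ex (a : nat) : a <= P -> exists t, disp s t == a.
  by move=> aP; case: (@disp_hit s t1 a) => [|t _ E]; [lia|exists t; rewrite E].
pose phi (a : 'I_P.+1) := ex_minn (ex a (ltn_ord a)).
have phiE a : disp s (phi a) = Posz a by rewrite /phi; case: ex_minnP => t /eqP.
have phi_min (a : 'I_P.+1) t : disp s t = Posz a -> phi a <= t.
  by move=> E; rewrite /phi; case: ex_minnP => t' _; apply; rewrite E.
have phi_lt (a : 'I_P.+1) t : t < phi a -> (disp s t < Posz a)%R.
  move=> lt; case: (ltrP (disp s t) (Posz a)) => // /disp_hit[t' tt /phi_min]; lia.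
pose F (a : 'I_P.+1) : state A * {ffun H -> 'I_(size w).+2} :=
  ((orbit s (phi a)).1, [ffun j => inord ((orbit s (phi a)).2 j)]).
have : ~~ injectiveb F.
  by apply/injectiveP => /leq_card; rewrite card_ord ltnn.
case/injectivePn=> a0 [b0 nab Fab].
wlog lt : a0 b0 nab Fab / a0 < b0 => [wl|].
  case: (ltngtP a0 b0) => ab; [exact: (wl a0 b0)|by apply: (wl b0 a0); rewrite // eq_sym|].
  by case/eqP: nab; apply: val_inj.
have sE : orbit s (phi a0) = orbit s (phi b0).
  case: Fab => E1 /ffunP E2; rewrite [LHS]surjective_pairing [RHS]surjective_pairing E1; congr pair.
  apply/ffunP => j; have := congr1 val (E2 j); rewrite !ffunE /= !inordK //; exact: orbit_bound.
have := phiE a0; have := phiE b0; have := phi_lt b0; have := phi_lt a0; move: sE.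
move: (phi a0) (phi b0) => ta tb sE lta ltb Yb Ya.
have tab : ta < tb.
  rewrite ltnNge; apply/negP => le; case: (ltngtP ta tb) => // [|lt'|e]; first by lia.
    by have := lta _ lt'; rewrite Yb; lia.
  by move: Ya; rewrite e Yb; lia.
have tb1 : tb <= t1.
  by rewrite leqNgt; apply/negP => /ltb; have := ltn_ord b0; lia.
pose T := tb - ta.
have perS t : ta <= t -> orbit s (t + T) = orbit s t.
  move=> le; have -> : t + T = tb + (t - ta) by rewrite /T; lia.
  have -> : t = ta + (t - ta) by lia.
  by rewrite [LHS]orbitD [RHS]orbitD -sE; congr orbit; lia.
have perY t : ta <= t -> disp s (t + T) = (disp s t + Posz (b0 - a0)%N)%R.
  move=> le; have -> : t + T = tb + (t - ta) by rewrite /T; lia.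
  have -> : disp s t = disp s (ta + (t - ta)) by congr disp; lia.
  by rewrite !dispD -sE Ya Yb; lia.
have [i iT imin] := ex_argmin (fun i => disp s (ta + i)) T.-1.
have T0 : 0 < T by rewrite /T; lia.
exists (ta + i), T, (b0 - a0); split.
- by rewrite /T in iT; lia.
- by have := ltn_ord b0; lia.
- by apply: perS; lia.
- by have := dispD s (ta + i) T; rewrite perY; [lia|lia].
have low j : j <= T -> (disp s (ta + i) <= disp s (ta + i + j))%R.
  move=> jT; case: (ltnP (i + j) T) => ij.
    by have := imin (i + j); rewrite addnA; apply; lia.
  have -> : ta + i + j = ta + (i + j - T) + T by lia.
  rewrite perY; last by lia.
  by have := imin (i + j - T); rewrite /=; lia.
split=> // j jT.
  by have := low j jT; rewrite [X in (_ <= X)%R]dispD; lia.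
(* Before the first visit of level [b0] the displacement is at most [P]. The rotated period ends
   less than one period later, which adds at most another [P]. *)
have up t : t <= tb -> (disp s t <= P)%R.
  rewrite leq_eqVlt => /predU1P[->|/ltb]; first by rewrite Yb; have := ltn_ord b0; lia.
  by have := ltn_ord b0; lia.
case: (leqP (ta + i + j) tb) => le; first by have := up _ le; lia.
have -> : ta + i + j = (ta + (i + j - T)) + T by rewrite /T in iT *; lia.
rewrite perY; last by lia.
have : (disp s (ta + (i + j - T)) <= P)%R by apply: up; rewrite /T in iT *; lia.
by have := ltn_ord b0; lia.
Qed.

Lemma orbit_walk s i b : (forall j, j <= i -> (0 <= disp s j <= Posz b)%R) ->
  walk w dir b s 0 (orbit s i) `|disp s i|%N.
Proof.
elim: i => [|i IH] Hb; first by apply: walk_nil.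
have {}IH := IH (fun j ji => Hb j (leqW ji)).
have := Hb i (leqnSn i); have := Hb i.+1 (leqnn _).
have -> : disp s i.+1 = tm_move (vel (orbit s i)) (disp s i) by [].
move=> H1 H2.
have -> : `|tm_move (vel (orbit s i)) (disp s i)|%N = W2_move (vel (orbit s i)) `|disp s i|%N.
  by case: (vel _) H1 => /=; lia.
apply: (@walk_rcons _ _ _ _ dir b s 0 _ _ IH).
  by move=> E; move: H1; rewrite /vel E /=; lia.
by rewrite -/(vel _); case: (vel _) H1 => /=; lia.
Qed.

Lemma orbit_period s T n : orbit s T = s -> orbit s (n * T) = s.
Proof. by move=> E; elim: n => // n IH; rewrite mulSn orbitD E. Qed.

Lemma disp_period s T n : orbit s T = s -> disp s (n * T) = (disp s T * Posz n)%R.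
Proof.
move=> E; elim: n => [|n IH]; first by rewrite mulr0.
by rewrite mulSn dispD E IH; lia.
Qed.

End Orbit.

(** * Crossing a block *)

Section MachineRun.
Variables (Sigma : finType) (h : nat) (A : automaton Sigma h) (k : nat).
Local Notation H := 'I_h.
Variables (w : seq Sigma) (g : seq (gsymb A k)).
Hypothesis wg : size w <= size g.
Let u := pad w g.
Let cs := [seq x.1 | x <- g].
Local Notation tr := (@vtrans Sigma h A k).
Local Notation vs := (vstate A k).
Let z0 : {ffun H -> nat} := [ffun=> 0].
Let xb (x : {ffun H -> nat}) := forall j, x j < (size w).+2.

Definition mreach (c c' : nconf vs (vhead h)) :=
  exists p, path (nstep tr u) c p /\ last c p = c'.

Lemma mreach_refl c : mreach c c. Proof. by exists [::]. Qed.

Lemma mreach_trans c1 c2 c3 : mreach c1 c2 -> mreach c2 c3 -> mreach c1 c3.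
Proof.
move=> [p1 [pp1 <-]] [p2 [pp2 <-]]; exists (p1 ++ p2).
by rewrite cat_path last_cat pp1 pp2.
Qed.

Lemma mreach_step (c : nconf vs (vhead h)) ch a c' : tr c.1 [ffun i => read_input u (c.2 i)] ch = Some a ->
  mreach (nnext u c a) c' -> mreach c c'.
Proof.
move=> E [p [pp <-]]; exists (nnext u c a :: p); split=> //=; rewrite pp andbT.
by apply/existsP; exists ch; rewrite E.
Qed.

Lemma szpad : size u = size g. Proof. exact: size_pad. Qed.

Lemma okincI p d : p <= size g -> okinc (read_input u p) d.
Proof.
move=> pg; rewrite /okinc read_right; last by rewrite szpad; lia.
by rewrite szpad /=; have -> : (p == (size g).+1) = false by lia.
Qed.

Lemma incE p d : p <= size g -> move_head u d p = W2_move d p.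
Proof. by move=> pg; apply: okincE; apply: okincI. Qed.

Definition rd m gg r s y (x z : {ffun H -> nat}) : {ffun vhead h -> input_symbol _} :=
  [ffun i => read_input u (mkh m gg r s y x z i)].

Section Reads.
Variables (m gg r s y : nat) (x z : {ffun H -> nat}).
Local Notation sy := (rd m gg r s y x z).
Lemma rdM : sy (hM h) = read_input u m. Proof. by rewrite !ffunE. Qed.
Lemma rdG : sy (hG h) = read_input u gg. Proof. by rewrite !ffunE. Qed.
Lemma rdR : sy (hR h) = read_input u r. Proof. by rewrite !ffunE. Qed.
Lemma rdS : sy (hS h) = read_input u s. Proof. by rewrite !ffunE. Qed.
Lemma rdY : sy (hY h) = read_input u y. Proof. by rewrite !ffunE. Qed.
Lemma rdZ j : sy (hZ j) = read_input u (z j). Proof. by rewrite !ffunE. Qed.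
Lemma rdX : xb x -> [ffun j => ain (sy (hX j))] = [ffun j => read_input w (x j)].
Proof. by move=> xbx; apply/ffunP => j; rewrite !ffunE /= pad_read. Qed.
End Reads.
Definition rdE := (rdM, rdG, rdR, rdS, rdY, rdZ).

Lemma mstep (q q' : vs) m gg r s y x z ch dm dg dr ds dy (dx dz : {ffun H -> move}) c' :
  tr q (rd m gg r s y x z) ch = Some (q', mkh dm dg dr ds dy dx dz) ->
  mreach (q', mkh (move_head u dm m) (move_head u dg gg) (move_head u dr r)
     (move_head u ds s) (move_head u dy y)
     [ffun j => move_head u (dx j) (x j)] [ffun j => move_head u (dz j) (z j)]) c' ->
  mreach (q, mkh m gg r s y x z) c'.
Proof.
by move=> E R; apply: (@mreach_step (q, mkh m gg r s y x z) ch _ c' E); rewrite nnext_mkh.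
Qed.

Lemma mstep0 (q q' : vs) m gg r s y x z ch dm dg dr ds dy c' :
  tr q (rd m gg r s y x z) ch = Some (q', vmove h dm dg dr ds dy) ->
  mreach (q', mkh (move_head u dm m) (move_head u dg gg) (move_head u dr r)
     (move_head u ds s) (move_head u dy y) x z) c' ->
  mreach (q, mkh m gg r s y x z) c'.
Proof. by move=> E R; apply: (mstep E); rewrite !move_st. Qed.

Lemma read_mem p c : onth cs p = Some c -> cellof (read_input u p.+1) = Some c.
Proof. by move=> E; rewrite (cellofE w g). Qed.

Section Cross.
Variables (dir : bool) (i : 'I_k) (q : state A) (x : {ffun H -> nat}).
Hypothesis xbx : xb x.
Variables (ym d : nat).
Hypotheses (Wk : walk w dir ym (q, x) 0 (q, x) d) (d0 : 0 < d).
Hypothesis ymg : 6 * ym + 6 <= size g.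
Local Notation X := ((dir, i, q) : cross A k).

Lemma d_le : d <= ym. Proof. by have [] := walk_le Wk. Qed.

(** [hR] and [hY] move in opposite directions, so within the period [hR] may sink by [ym], although
    the net loss is only [d]; hence [ym <= r]. *)
Lemma run_cycle lvl m gg r : ym <= r <= size g ->
  mreach (Base X lvl, mkh m gg r 0 0 x z0) (Base X lvl, mkh m gg (r - d) 0 0 x z0).
Proof.
move=> /andP[yr rg].
have cyc s' e : walk w dir ym (q, x) 0 s' e -> xb s'.2 /\ exists zs z,
    mreach (Base X lvl, mkh m gg r 0 0 x z0) (Cyc X lvl s'.1 zs, mkh m gg (r - e) 0 e s'.2 z) /\
    forall j, if zs j : bool then s'.2 j = x j + z j else s'.2 j + z j = x j.
  elim=> [_|s1 e1 W [xb1 [zs [z [R zE]]]] H0 H1].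
    split=> //; exists [ffun=> true], z0; split=> [|j]; last by rewrite !ffunE addn0.
    apply: (mstep0 (ch := inl 1%R) (q' := Cyc X lvl q [ffun=> true])
      (dm := MStay) (dg := MStay) (dr := MStay) (ds := MStay) (dy := MStay)) => /=.
      by rewrite !rdE.
    by rewrite subn0; apply: mreach_refl.
  have [_ e1b] := walk_le W.
  move: H0 H1; rewrite /bstep; case Et : (trans _ _ _) => [[q' ds] v] /= H0 H1.
  split; first by move=> j; rewrite ffunE; have := xb1 j; case: (ds j) => /=; lia.
  pose dz : {ffun H -> bool * move} :=
    [ffun j => zmove (zs j) (z j == 0) (clamp (read_input w (s1.2 j)) (ds j))].
  (* Two positions of one input head differ by at most [(size w).+1], so the distance fits, and at
     the extreme value it cannot grow. *)
  have zkey j : z j <= size g /\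
     (if (dz j).1 then move_head w (ds j) (s1.2 j) = x j + W2_move (dz j).2 (z j)
      else move_head w (ds j) (s1.2 j) + W2_move (dz j).2 (z j) = x j) \/
     (dz j).2 <> MRight /\
     (if (dz j).1 then move_head w (ds j) (s1.2 j) = x j + W2_move (dz j).2 (z j)
      else move_head w (ds j) (s1.2 j) + W2_move (dz j).2 (z j) = x j).
    have := zE j; have := xb1 j; have := xbx j.
    have := read_left w (s1.2 j); have := read_right (xb1 j); move: wg; rewrite ffunE.
    by case: (zs j) (read_input w (s1.2 j)) (ds j) => [] [||a] [] /=; case: (z j =P 0) => /= ?;
      (try by left; lia); (try by right; split=> //; lia); lia.
  have zmv j : okinc (read_input u (z j)) (dz j).2 /\
      (if (dz j).1 then move_head w (ds j) (s1.2 j) = x j + move_head u (dz j).2 (z j)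
      else move_head w (ds j) (s1.2 j) + move_head u (dz j).2 (z j) = x j).
    have ok : okinc (read_input u (z j)) (dz j).2.
      case: (zkey j) => -[H _]; first exact: okincI.
      by rewrite /okinc; case: (dz j).2 H; rewrite ?andbF.
    by split=> //; rewrite (okincE ok); case: (zkey j) => -[].
  exists [ffun j => (dz j).1], [ffun j => move_head u (dz j).2 (z j)].
  split; last by move=> j; have [_] := zmv j; rewrite !ffunE.
  apply: mreach_trans R _; set vd := dirv dir v in H0 H1 *.
  apply: (mstep (ch := inl 0%R) (q' := Cyc X lvl q' [ffun j => (dz j).1])
      (dm := MStay) (dg := MStay) (dr := dirv false vd) (ds := MStay) (dy := vd)
      (dx := [ffun j => clamp (read_input w (s1.2 j)) (ds j)]) (dz := [ffun j => (dz j).2])) => /=.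
    rewrite rdX // Et -/vd !rdE !read_left.
    have -> : [ffun j => zmove (zs j) (at_left (rd m gg (r - e1) 0 e1 s1.2 z (hZ j)))
               (clamp ([ffun j0 => read_input w (s1.2 j0)] j) (ds j))] = dz.
      by apply/ffunP => j; rewrite !ffunE /= read_left.
    rewrite ifT; first by congr (Some (_, _)); apply/ffunP => -[n|[j|j]]; rewrite !ffunE.
    apply/and5P; split.
    - by apply/implyP => /eqP /H0; lia.
    - by apply/implyP => /eqP vE; move: H1; rewrite vE /=; lia.
    - by apply: okincI; have := ymg; lia.
    - by apply: okincI; lia.
    - by apply/forallP => j; rewrite rdZ; case: (zmv j).
  rewrite !incE; try (have := ymg; lia).
  rewrite (_ : [ffun j => move_head u (_ j) (s1.2 j)] = [ffun j => move_head w (ds j) (s1.2 j)]); last first.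
    by rewrite -(xmove wg ds xb1); apply/ffunP => j; rewrite !ffunE.
  have -> : W2_move (dirv false vd) (r - e1) = r - W2_move vd e1.
    by case: (vd) H0 H1 => //= H0 H1; try have := H0 erefl; lia.
  rewrite (_ : [ffun j => move_head u ([ffun j => (dz j).2] j) (z j)] = [ffun j => move_head u (dz j).2 (z j)]).
    exact: mreach_refl.
  by apply/ffunP => j; rewrite !ffunE.
have [_ [zs [z [R zE]]]] := cyc _ _ Wk; rewrite /= in R zE.
have zz : z = z0.
  apply/ffunP => j; have := zE j; rewrite [z0 j]ffunE.
  by move: (x j) (z j) => a b; case: (zs j); lia.
apply: mreach_trans R _; rewrite zz.
apply: (mstep0 (ch := inl 1%R) (q' := Base X lvl)
      (dm := MStay) (dg := MStay) (dr := MStay) (ds := MStay) (dy := MStay)) => /=.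
  rewrite eqxx ifT //; apply/forallP => j; by rewrite rdZ read_left ffunE.
have yreset e : mreach (Base X lvl, mkh m gg (r - d) 0 e x z0) (Base X lvl, mkh m gg (r - d) 0 0 x z0).
  elim: e => [|e IH]; first exact: mreach_refl.
  by apply: (mstep0 (ch := inl 0%R) (q' := Base X lvl)
      (dm := MStay) (dg := MStay) (dr := MStay) (ds := MStay) (dy := MLeft)).
exact: yreset.
Qed.

Lemma reduce_to lvl m gg r0 r : ym <= r0 -> r0 <= r <= size g -> r = r0 %[mod d] ->
  mreach (Base X lvl, mkh m gg r 0 0 x z0) (Base X lvl, mkh m gg r0 0 0 x z0).
Proof.
move=> yr0; have [n] := ubnP r; elim: n r => // n IH r rn /andP[r0r rg] E.
case: (ltngtP r0 r) r0r => // [lt _|->]; last by move=> _; apply: mreach_refl.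
have ge : r0 + d <= r.
  have /eqP E' := E; move: E'; rewrite eqn_mod_dvd; last by lia.
  by move/dvdn_leq => H; have := H ltac:(lia); lia.
apply: mreach_trans (run_cycle lvl m gg _) _; first by lia.
apply: IH; [by have := d0; lia|by lia|].
by rewrite -E -[in RHS](subnK (_ : d <= r)) ?modnDr //; lia.
Qed.

(** Since a period needs room [ym], whole periods bring the remainder below [ym], not necessarily
    below [d]. *)
Lemma reduce_lt lvl m gg r : r <= size g -> exists2 r', r' < ym /\ r' = r %[mod d] &
  mreach (Base X lvl, mkh m gg r 0 0 x z0) (Base X lvl, mkh m gg r' 0 0 x z0).
Proof.
have [n] := ubnP r; elim: n r => // n IH r rn rg.
case: (ltnP r ym) => ry; first by exists r => //; apply: mreach_refl.
have dy := d_le; case: (IH (r - d)) => [||r' [r'y r'E] R]; [by have := d0; lia|by lia|].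
exists r'; first by split=> //; rewrite r'E -[in RHS](subnK (_ : d <= r)) ?modnDr //; lia.
by apply: mreach_trans (run_cycle lvl m gg _) R; lia.
Qed.

Lemma double m gg r (b : bool) : r.*2.+1 <= size g ->
  mreach (Dbl X b false, mkh m gg r 0 0 x z0) (Base X None, mkh m gg (r.*2 + b) 0 0 x z0).
Proof.
move=> rg.
have l1 r1 s1 : r1.*2 + s1 <= size g ->
    mreach (Dbl X b false, mkh m gg r1 s1 0 x z0) (Dbl2 X b, mkh m gg 0 (s1 + r1.*2) 0 x z0).
  elim: r1 s1 => [|r1 IH] s1 rs.
    apply: (mstep0 (ch := inl 0%R) (q' := Dbl2 X b) (dm := MStay) (dg := MStay)
      (dr := MStay) (ds := MStay) (dy := MStay)); first by rewrite /= !rdE.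
    by rewrite addn0; apply: mreach_refl.
  apply: (mstep0 (ch := inl 0%R) (q' := Dbl X b true) (dm := MStay) (dg := MStay)
      (dr := MLeft) (ds := MRight) (dy := MStay)).
    by rewrite /= !rdE !read_left okincI //; lia.
  rewrite !(@incE _ MRight) /=; try lia.
  apply: (mstep0 (ch := inl 0%R) (q' := Dbl X b false) (dm := MStay) (dg := MStay)
      (dr := MStay) (ds := MRight) (dy := MStay)).
    by rewrite /= rdS okincI //; lia.
  rewrite !(@incE _ MRight) /=; try lia.
  by rewrite (_ : s1 + r1.+1.*2 = s1.+2 + r1.*2); [apply: IH; lia|lia].
have l2 s1 r1 : r1 + s1 < size g ->
    mreach (Dbl2 X b, mkh m gg r1 s1 0 x z0) (Base X None, mkh m gg (r1 + s1 + b) 0 0 x z0).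
  elim: s1 r1 => [|s1 IH] r1 rs.
    case: (b).
      apply: (mstep0 (ch := inl 0%R) (q' := Base X None) (dm := MStay) (dg := MStay)
        (dr := MRight) (ds := MStay) (dy := MStay)).
        by rewrite /= !rdE okincI //; lia.
      by rewrite (@incE _ MRight) ?addn0 ?addn1 //=; [apply: mreach_refl|lia].
    apply: (mstep0 (ch := inl 0%R) (q' := Base X None) (dm := MStay) (dg := MStay)
        (dr := MStay) (ds := MStay) (dy := MStay)); first by rewrite /= !rdE.
    by rewrite !addn0; apply: mreach_refl.
  apply: (mstep0 (ch := inl 0%R) (q' := Dbl2 X b) (dm := MStay) (dg := MStay)
      (dr := MRight) (ds := MLeft) (dy := MStay)).
    by rewrite /= !rdE !read_left okincI //; lia.
  rewrite (@incE _ MRight) /=; last by lia.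
  by rewrite (_ : r1 + s1.+1 = r1.+1 + s1); [apply: IH; lia|lia].
apply: mreach_trans (l1 _ _ _) _; first by lia.
by have := l2 r.*2 0; rewrite !add0n; apply; lia.
Qed.

(** After each digit the doubled remainder is below [2 * ym], and whole periods take it below [ym]
    again without changing it modulo [d]. This is how a length of [size g] bits is handled by
    heads. *)
Lemma run_digits m : exists2 r, r < ym /\ r = blen g i %[mod d] &
  mreach (Base X None, mkh m 1 0 0 0 x z0) (Base X (Some false), mkh m (size g).+1 r 0 0 x z0).
Proof.
have ym0 : 0 < ym by have := d_le; have := d0; lia.
have [r rE R] : exists2 r, r < ym /\ r = horner2 (take (size g) (digits_of g i)) %[mod d] &
   mreach (Base X None, mkh m 1 0 0 0 x z0) (Base X None, mkh m (size g).+1 r 0 0 x z0).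
  have : size g <= size g by [].
  elim: {1 3 4}(size g) => [|n IH] ng; first by exists 0; [rewrite take0|exact: mreach_refl].
  have [r [ry rE] R] := IH (ltnW ng).
  have sz : size (digits_of g i) = size g by rewrite size_map.
  pose b := nth false (digits_of g i) n.
  have [r' [r'y r'E] R'] := @reduce_lt None m n.+2 (r.*2 + b) ltac:(case: (b); have := ymg; lia).
  exists r'.
    split=> //; rewrite r'E (take_nth false) ?sz // -cats1 /horner2 foldl_cat /= -/(horner2 _).
    by rewrite -/b -modnDml -muln2 -modnMml rE modnMml muln2 modnDml.
  apply: mreach_trans R _; apply: mreach_trans _ R'; apply: mreach_trans _ (@double m n.+2 r b _); last first.
    by have := ymg; lia.
  apply: (mstep0 (ch := inl 2%R) (q' := Dbl X b false) (dm := MStay) (dg := MRight)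
      (dr := MStay) (ds := MStay) (dy := MStay)).
    rewrite /= !rdE /read_input /=; have [a ->] := pad_nth w ng.
    rewrite /b /digits_of (nth_map (inl None, [ffun=> false])) //.
    by case: (nth _ _ _).
  by rewrite (@incE _ MRight) /=; [exact: mreach_refl|lia].
exists r; first by move: rE; rewrite take_oversize ?size_map.
apply: mreach_trans R _.
apply: (mstep0 (ch := inl 2%R) (q' := Base X (Some false)) (dm := MStay) (dg := MStay)
      (dr := MStay) (ds := MStay) (dy := MStay)); last exact: mreach_refl.
by rewrite /= !rdE /read_input /= nth_default ?size_map ?szpad.
Qed.

(* [near j] and [far j] are the positions at distance [j] from the block, before
   and behind it in the direction of the crossing. *)
Variables (bx : nat) (Bp : nat).
Definition near j := if dir then bx - j else bx + j.
Definition far j := if dir then bx + j else bx - j.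
Hypothesis bxE : onth cs bx = Some (inr i).
Hypothesis nearE : forall j, 0 < j <= Bp -> onth cs (near j) = Some (inl None).
Hypothesis farE : forall j, 0 < j <= Bp -> onth cs (far j) = Some (inl None).
Hypothesis bxB : Bp <= bx.

Lemma onth_lt p c : onth cs p = Some c -> p < size g.
Proof. by move=> E; have := onthTE cs p; rewrite E size_map /= => <-. Qed.

Lemma adv_cell m b m' r : move_head u (dirv dir MRight) m.+1 = m'.+1 ->
  onth cs m' = Some (inl None) -> r < size g ->
  mreach (Base X (Some b), mkh m.+1 (size g).+1 r 0 0 x z0)
         (Base X (Some b), mkh m'.+1 (size g).+1 r.+1 0 0 x z0).
Proof.
move=> mE cm rg.
apply: (mstep0 (ch := inl 2%R) (q' := AdvC X b) (dm := dirv dir MRight) (dg := MStay)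
      (dr := MStay) (ds := MStay) (dy := MStay)); first by rewrite /= !rdE.
rewrite mE; apply: (mstep0 (ch := inl 2%R) (q' := Base X (Some b)) (dm := MStay) (dg := MStay)
      (dr := MRight) (ds := MStay) (dy := MStay)).
  by rewrite /= !rdE (read_mem cm) okincI // ltnW.
by rewrite (@incE _ MRight) /=; [exact: mreach_refl|exact: ltnW].
Qed.

Lemma adv_near j r : 0 < j <= Bp -> r + j <= size g ->
  mreach (Base X (Some false), mkh (near j).+1 (size g).+1 r 0 0 x z0)
         (Base X (Some false), mkh (near 1).+1 (size g).+1 (r + j - 1) 0 0 x z0).
Proof.
elim: j r => // j IH r jB rg; case: (posnP j) => [->|j0].
  by rewrite addn1 subn1; apply: mreach_refl.
apply: mreach_trans (@adv_cell _ _ (near j) r _ _ _) _; last 1 first.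
- by rewrite (_ : r + j.+1 - 1 = r.+1 + j - 1); [apply: IH; lia|lia].
- have lt := onth_lt (nearE jB); have := bxB; move: lt; rewrite /near; case: (dir) => lt bB.
    by rewrite (@incE _ MRight) /=; lia.
  by rewrite /=; lia.
- by apply: nearE; lia.
- by lia.
Qed.

Lemma adv_far j r : 0 < j <= Bp -> r + j <= size g ->
  mreach (Base X (Some false), mkh (near 1).+1 (size g).+1 r 0 0 x z0)
         (Base X (Some true), mkh (far j).+1 (size g).+1 (r + j) 0 0 x z0).
Proof.
have blt := onth_lt bxE.
elim: j => // j IH jB rg; case: (posnP j) => [j0|j0]; last first.
  apply: mreach_trans (IH _ _) _; try lia; rewrite addnS.
  apply: adv_cell; [|by apply: farE; lia|lia].
  have flt : far j < size g by apply: (@onth_lt _ (inl None)); apply: farE; lia.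
  rewrite /far in flt *; move: flt; case: (dir) => flt.
    by rewrite (@incE _ MRight) /=; lia.
  by rewrite /=; have := bxB; lia.
rewrite j0 addn1.
have n1 : move_head u (dirv dir MRight) (near 1).+1 = bx.+1.
  have := bxB; rewrite /near; case: (dir) => bB; last by rewrite /=; lia.
  by rewrite (@incE _ MRight) /=; lia.
have f1 : move_head u (dirv dir MRight) bx.+1 = (far 1).+1.
  have := bxB; rewrite /far; case: (dir) => bB; last by rewrite /=; lia.
  by rewrite (@incE _ MRight) /=; lia.
apply: (mstep0 (ch := inl 2%R) (q' := AdvC X false) (dm := dirv dir MRight) (dg := MStay)
      (dr := MStay) (ds := MStay) (dy := MStay)); first by rewrite /= !rdE.
rewrite n1; apply: (mstep0 (ch := inl 2%R) (q' := AdvC X true) (dm := dirv dir MRight) (dg := MStay)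
      (dr := MStay) (ds := MStay) (dy := MStay)).
  by rewrite /= !rdE (read_mem bxE) eqxx.
rewrite f1; apply: (mstep0 (ch := inl 2%R) (q' := Base X (Some true)) (dm := MStay) (dg := MStay)
      (dr := MRight) (ds := MStay) (dy := MStay)).
  rewrite /= !rdE (read_mem (farE _)); last by lia.
  by rewrite okincI //; lia.
by rewrite (@incE _ MRight) /=; [exact: mreach_refl|lia].
Qed.

Lemma retreat j r : 0 < j -> j + r <= Bp ->
  mreach (Ret X, mkh (far (j + r)).+1 (size g).+1 r 0 0 x z0)
         (Norm k q, mkh (far j).+1 (size g).+1 0 0 0 x z0).
Proof.
move=> j0; elim: r => [|r IH] jB.
  rewrite addn0; apply: (mstep0 (ch := inl 0%R) (q' := Norm k q) (dm := MStay) (dg := MStay)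
      (dr := MStay) (ds := MStay) (dy := MStay)); last exact: mreach_refl.
  by rewrite /= !rdE (read_mem (farE _)) ?eqxx //; lia.
apply: (mstep0 (ch := inl 0%R) (q' := Ret X) (dm := dirv dir MLeft) (dg := MStay)
      (dr := MLeft) (ds := MStay) (dy := MStay)).
  by rewrite /= !rdE (read_mem (farE _)) ?eqxx //= ?read_left //; lia.
have -> : move_head u (dirv dir MLeft) (far (j + r.+1)).+1 = (far (j + r)).+1.
  have := bxB; have flt : far (j + r.+1) < size g.
    by apply: (@onth_lt _ (inl None)); apply: farE; lia.
  move: flt; rewrite /far; case: (dir) => flt bB; first by rewrite /=; lia.
  by rewrite (@incE _ MRight) /=; lia.
by apply: IH; lia.
Qed.

(** The way from the near cell to the far cell has length [jn + jf - 1 + blen g i], a whole number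
    of periods. Since a period needs [ym] cells of room, [hM] goes on to [far (jf + ym)], whole
    periods leave exactly [ym], and [Ret] steps back. *)
Lemma cross_block gg jn jf : 0 < jn <= Bp -> 0 < jf -> jf + ym <= Bp ->
  jn + jf + 2 * ym <= size g -> d %| jn + jf - 1 + blen g i ->
  mreach (Norm k q, mkh (near jn).+1 gg 0 0 0 x z0)
         (Norm k q, mkh (far jf).+1 (size g).+1 0 0 0 x z0).
Proof.
move=> jnB jf0 jfB szB dv.
have wind : mreach (Norm k q, mkh (near jn).+1 gg 0 0 0 x z0)
                   (Norm k q, mkh (near jn).+1 0 0 0 0 x z0).
  elim: gg => [|n IH]; first exact: mreach_refl.
  by apply: (mstep0 (ch := inl 1%R) (q' := Norm k q) (dm := MStay) (dg := MLeft)
      (dr := MStay) (ds := MStay) (dy := MStay)).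
apply: mreach_trans wind _.
have [r [ry rE] R] := run_digits (near jn).+1.
apply: (mstep0 (ch := inr (dir, i)) (q' := Base X None) (dm := MStay) (dg := MRight)
      (dr := MStay) (ds := MStay) (dy := MStay)).
  by rewrite /= !rdE (read_mem (nearE jnB)) eqxx.
rewrite (@incE _ MRight) //=; apply: mreach_trans R _.
apply: mreach_trans (adv_near (r := r) jnB _) _; first by lia.
apply: mreach_trans (@adv_far (jf + ym) _ _ _) _; try by have := d_le; have := d0; lia.
apply: mreach_trans (@reduce_to _ _ _ ym _ _ _ _) _ => //.
- by lia.
- apply/eqP; rewrite eqn_mod_dvd; last by lia.
  have -> : r + jn - 1 + (jf + ym) - ym = r + (jn + jf - 1) by lia.
  by rewrite /dvdn -modnDml rE modnDml addnC.
apply: (mstep0 (ch := inl 3%R) (q' := Ret X) (dm := MStay) (dg := MStay)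
      (dr := MStay) (ds := MStay) (dy := MStay)); first by rewrite /= !rdE.
exact: retreat.
Qed.

End Cross.
End MachineRun.

(** * Following the run of the automaton *)

Section RealRun.
Variables (Sigma : finType) (h : nat) (A : automaton Sigma h) (k : nat).
Local Notation H := 'I_h.
Variables (w : seq Sigma) (g : seq (gsymb A k)).
Hypothesis wg : size w <= size g.
Let u := pad w g.
Let cs := [seq x.1 | x <- g].
Variables (mu : memory_content (marks A)) (tl : 'I_k -> nat).
Local Notation P := (nsmall A w).
(** [escape] completes a period within displacement [2 * P], so a run over [W] cells contains one.
    [B] has room for a departure at distance at most [W], an arrival before [W + P] with a swing of
    [2 * P] beyond it, and [W] cells between the arrival and the next block. *)
Let W := 2 * P + 1.
Let B := 8 * P + 8.
Hypothesis tl0 : forall i, 0 < tl i.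
Hypothesis muE : forall c, mu c = nth None (expand tl cs) c.
Hypothesis padE : forall b i, onth cs b = Some (inr i) -> B <= b /\
  forall j, 0 < j <= B -> onth cs (b + j) = Some (inl None) /\ onth cs (b - j) = Some (inl None).
Hypothesis tailB : B < size cs.
Hypothesis tailE : forall j, 0 < j <= B -> onth cs (size cs - j) = Some (inl None).
Hypothesis modE : forall i d, 0 < d <= P -> blen g i = tl i %[mod d].
Hypothesis sizeB : 40 * P + 40 <= size g.

Let E p := emb tl cs p.
Let rc t := iter t (step w mu) (initial A).
Let sm t : sconf A := (cstate (rc t), cheads (rc t)).
Let cell t := ccell (rc t).

Lemma szcs : size cs = size g. Proof. exact: size_map. Qed.

Lemma E_step p c : onth cs p = Some c -> E p.+1 = E p + size (width tl c) /\
  forall j, j < size (width tl c) -> mu (E p + j) = nth None (width tl c) j.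
Proof.
move=> Ep; have pc : p < size cs by rewrite -onthTE Ep.
have Ec : nth (inl None) cs p = c by rewrite -odflt_onth Ep.
by split=> [|j js]; [exact: embS|rewrite muE; exact: nth_expand].
Qed.

Lemma E_cell p c : onth cs p = Some (inl c) -> E p.+1 = (E p).+1 /\ mu (E p) = c.
Proof. by case/E_step => -> /(_ 0 isT); rewrite addn0 addn1. Qed.

Lemma E_lt p q : p < q <= size cs -> E p < E q.
Proof.
elim: q => // q IH /andP[pq qs].
have lt : E q < E q.+1.
  have : onth cs q = (q < size cs) :> bool by rewrite onthTE.
  rewrite qs; case Eq : (onth cs q) => [c|//] _; have [-> _] := E_step Eq.
  by case: (c) => [//|i] /=; rewrite ?addn1 // size_nseq; have := tl0 i; lia.
move: pq; rewrite ltnS leq_eqVlt => /predU1P[-> //|pq].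
by apply: ltn_trans lt; apply: IH; lia.
Qed.

Lemma E_inj p q : p <= size cs -> q <= size cs -> E p = E q -> p = q.
Proof.
move=> ps qs e; case: (ltngtP p q) => // lt.
  by have := @E_lt p q; rewrite e; lia.
by have := @E_lt q p; rewrite e; lia.
Qed.

Lemma E_ge p : p <= size cs -> p <= E p.
Proof.
elim: p => // p IH ps; have := @E_lt p p.+1; have := IH (ltnW ps); lia.
Qed.

Lemma E_end c : E (size cs) <= c -> mu c = None.
Proof. by rewrite /E /emb take_size muE => le; rewrite nth_default. Qed.

Definition pp t := index (cell t) [seq E p | p <- iota 0 (size cs)].
Definition isc p := if onth cs p is Some (inl _) then true else false.
(** [pp] alone is not reliable: [index] also finds the first cell of a block, and it returns
    [size cs] for cells that are not found. *)
Definition on_cell t := isc (pp t) && (cell t == E (pp t)).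

Lemma isc_lt p : isc p -> p < size cs.
Proof. by rewrite /isc -onthTE; case: (onth _ _). Qed.

Lemma ppI t p : isc p -> cell t = E p -> pp t = p /\ on_cell t.
Proof.
move=> ip cE; have pl := isc_lt ip.
have pE : pp t = p.
  rewrite /pp cE; have -> : E p = nth 0 [seq E p | p <- iota 0 (size cs)] p.
    by rewrite (nth_map 0) ?size_iota // nth_iota.
  have szE : size [seq E p | p <- iota 0 (size cs)] = size cs by rewrite (size_map E) size_iota.
  rewrite index_uniq ?szE //.
  rewrite map_inj_in_uniq ?iota_uniq // => a b; rewrite !mem_iota => a1 b1.
  by apply: E_inj; lia.
by rewrite /on_cell pE ip cE eqxx.
Qed.

Lemma smS t : exists ds, [/\ trans (sm t).1 [ffun j => read_input w ((sm t).2 j)] (mu (cell t)) =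
    ((sm t.+1).1, ds, (trans (sm t).1 [ffun j => read_input w ((sm t).2 j)] (mu (cell t))).2),
   (sm t.+1).2 = [ffun j => move_head w (ds j) ((sm t).2 j)] &
   cell t.+1 = W2_move (trans (sm t).1 [ffun j => read_input w ((sm t).2 j)] (mu (cell t))).2 (cell t)].
Proof.
rewrite /sm /cell /rc iterS -/(rc t) /step /=.
by case: (trans _ _ _) => [[q ds] v]; exists ds.
Qed.

Lemma sm_bound t j : (sm t).2 j < (size w).+2.
Proof.
elim: t j => [|t IH] j; first by rewrite ffunE.
have [ds [_ -> _]] := smS t; rewrite ffunE.
by have := IH j; case: (ds j) => /=; lia.
Qed.

Lemma sm_blank t : mu (cell t) = None -> 0 < cell t ->
  sm t.+1 = (bstep w (sm t)).1 /\ Posz (cell t.+1) = tm_move (bstep w (sm t)).2 (cell t).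
Proof.
move=> mc c0; have [ds] := smS t; rewrite mc /bstep.
case: (trans _ _ _) => [[q ds'] v] [E1 E2 E3].
have [Eq Eds] : q = (sm t.+1).1 /\ ds' = ds by case: E1.
split; last by rewrite E3; case: (v) => /=; lia.
by apply: injective_projections; rewrite ?E2 ?Eds ?Eq.
Qed.

Definition pz (dir : bool) (c d : int) : int := (if dir then c + d else c - d)%R.

Lemma follow dir t0 n : (forall i, i < n ->
    exists c : nat, [/\ 0 < c, mu c = None & Posz c = pz dir (cell t0) (disp w dir (sm t0) i)]) ->
  forall i, i <= n -> sm (t0 + i) = orbit w (sm t0) i /\
    Posz (cell (t0 + i)) = pz dir (cell t0) (disp w dir (sm t0) i).
Proof.
move=> Hn; elim=> [|i IH] lin.
  by rewrite addn0; split=> //; rewrite /pz /=; case: dir {Hn} => /=; lia.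
have [S1 S2] := IH (ltnW lin); have [c [c0 mc cE]] := Hn i lin.
have cc : cell (t0 + i) = c by rewrite -cE in S2; case: S2.
have [] := @sm_blank (t0 + i); rewrite ?cc // addnS => -> ->.
rewrite S1; split=> //; rewrite cE /= /vel /pz.
by case: (dir); case: (bstep _ _).2 => /=; lia.
Qed.

(** The right end of the description is treated like a block without a far side, as the memory is
    blank from there on. *)
Definition isend (dir : bool) b := (exists i, onth cs b = Some (inr i)) \/ (dir /\ b = size cs).

Local Notation cfg t gg :=
  ((Norm k (sm t).1, mkh (pp t).+1 gg 0 0 0 (sm t).2 [ffun=> 0]) : nconf (vstate A k) (vhead h)).
Local Notation mreach := (@mreach Sigma h A k w g).

Lemma norm_step t gg c m' : onth cs (pp t) = Some (inl c) -> cell t = E (pp t) ->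
  move_head u (trans (sm t).1 [ffun j => read_input w ((sm t).2 j)] c).2 (pp t).+1 = m' ->
  mreach (cfg t gg) (Norm k (sm t.+1).1, mkh m' gg 0 0 0 (sm t.+1).2 [ffun=> 0]).
Proof.
move=> Ep cE mE; have [_ mc] := E_cell Ep; rewrite -cE in mc.
have [ds [E1 E2 E3]] := smS t; rewrite mc in E1 E3.
apply: (mstep (ch := inl 0%R) (q' := Norm k (sm t.+1).1)
  (dm := (trans (sm t).1 [ffun j => read_input w ((sm t).2 j)] c).2)
  (dg := MStay) (dr := MStay) (ds := MStay) (dy := MStay)
  (dx := [ffun j => clamp (read_input w ((sm t).2 j)) (ds j)]) (dz := st h)).
  rewrite /= !rdE (read_left u) /= (read_mem _ Ep) (rdX wg); last exact: sm_bound.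
  rewrite {1}E1; congr (Some (_, _)); apply/ffunP => -[n|[j|j]]; rewrite !ffunE //.
rewrite mE move_st E2.
rewrite (_ : [ffun j => move_head u (_ j) ((sm t).2 j)] = [ffun j => move_head w (ds j) ((sm t).2 j)]).
  exact: mreach_refl.
by rewrite -(xmove wg ds (sm_bound t)); apply/ffunP => j; rewrite !ffunE.
Qed.

Lemma sim_step t : on_cell t ->
  (on_cell t.+1 /\ (forall gg, mreach (cfg t gg) (cfg t.+1 gg)) /\
     pp t.+1 <= (pp t).+1 /\ pp t <= (pp t.+1).+1) \/
  (~~ on_cell t.+1 /\ exists dir b, [/\ isend dir b, pp t = near dir b 1 &
     Posz (cell t.+1) = pz dir (cell t) 1]).
Proof.
case/andP=> ip /eqP cE; have pl := isc_lt ip.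
move: (ip); rewrite /isc; case Ep : (onth cs (pp t)) => [[c|//]|//] _.
have [ES mc] := E_cell Ep.
have [ds [_ _ E3]] := smS t; have mcc : mu (cell t) = c by rewrite cE.
rewrite mcc in E3.
have NS gg m' := @norm_step t gg c m' Ep cE.
case: (trans _ _ c).2 E3 NS => /= E3 NS.
- case: (posnP (pp t)) => [p0|p0].
    have c1 : cell t.+1 = E 0 by rewrite E3 cE p0 /E emb0.
    have i0 : isc 0 by rewrite -p0.
    have [pe et] := ppI i0 c1; left; split=> //; rewrite pe; split; last by lia.
    move=> gg; apply: mreach_trans (NS gg 0 _) _; first by rewrite p0.
    apply: (mstep0 (ch := inl 0%R) (q' := Norm k (sm t.+1).1) (dm := MRight)
      (dg := MStay) (dr := MStay) (ds := MStay) (dy := MStay)); first by rewrite /= !rdE.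
    by rewrite (incE wg) //=; apply: mreach_refl.
  have pt : (pp t).-1 < size cs by lia.
  have : onth cs (pp t).-1 = ((pp t).-1 < size cs) :> bool by rewrite onthTE.
  rewrite pt; case Eq : (onth cs (pp t).-1) => [[c'|i]|//] _; last first.
    right; have c1 : (cell t.+1).+1 = E (pp t).
      by have := E_ge (ltnW pl); rewrite E3 cE; lia.
    split.
      apply/negP => /andP[i1 /eqP c2]; have [e2 _] : E (pp t.+1).+1 = (E (pp t.+1)).+1 /\ True.
        move: (i1); rewrite /isc; case Eq1 : (onth cs (pp t.+1)) => [[c3|//]|//] _.
        by have [] := E_cell Eq1.
      have := @E_inj (pp t.+1).+1 (pp t); have := isc_lt i1; rewrite e2 -c2 c1.
      move=> l1 /(_ _ _ erefl) e; have pe : (pp t.+1).+1 = pp t by apply: e; lia.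
      by move: i1; rewrite /isc -[pp t.+1]/((pp t.+1).+1.-1) pe Eq.
    exists false, (pp t).-1; split; first by left; exists i.
      by rewrite /near; lia.
    by rewrite /pz cE; lia.
  have [ES' _] := E_cell Eq; rewrite prednK // in ES'.
  have c1 : cell t.+1 = E (pp t).-1 by rewrite E3 cE ES'.
  have i0 : isc (pp t).-1 by rewrite /isc Eq.
  have [pe et] := ppI i0 c1; left; split=> //; rewrite pe; split; last by lia.
  by move=> gg; apply: mreach_trans (NS gg _ erefl) _; rewrite prednK //; apply: mreach_refl.
- have c1 : cell t.+1 = E (pp t) by rewrite E3 cE.
  have [pe et] := ppI ip c1; left; split=> //; rewrite pe; split; last by lia.
  by move=> gg; apply: mreach_trans (NS gg _ erefl) _; apply: mreach_refl.
- have c1 : cell t.+1 = E (pp t).+1 by rewrite E3 cE ES.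
  have ndir : near true (pp t).+1 1 = pp t by rewrite /near subn1.
  have exit : (forall c', onth cs (pp t).+1 <> Some (inl c')) -> ~~ on_cell t.+1.
    move=> nc; apply/negP => /andP[i1 /eqP c2].
    have pe : pp t.+1 = (pp t).+1.
      by apply: E_inj; [have := isc_lt i1; lia|lia|rewrite -c2 c1].
    by move: i1; rewrite /isc pe; case Eq : (onth _ _) nc => [[c'|]|] // /(_ c').
  have : onth cs (pp t).+1 = ((pp t).+1 < size cs) :> bool by rewrite onthTE.
  case Eq : (onth cs (pp t).+1) => [[c'|i]|] lt.
  + have i0 : isc (pp t).+1 by rewrite /isc Eq.
    have [pe et] := ppI i0 c1; left; split=> //; rewrite pe; split; last by lia.
    move=> gg; apply: mreach_trans (NS gg _ erefl) _.
    have {}lt : (pp t).+1 < size cs by rewrite -lt.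
    rewrite (_ : minn _ _ = (pp t).+2); first exact: mreach_refl.
    by rewrite /u (szpad w g) -szcs; lia.
  + right; split; first by apply: exit => c'; rewrite Eq.
    exists true, (pp t).+1; split=> //; first by left; exists i.
    by rewrite /pz c1 cE ES; lia.
  + right; split; first by apply: exit => c'; rewrite Eq.
    exists true, (pp t).+1; split=> //; last by rewrite /pz c1 cE ES; lia.
    have {}lt : ((pp t).+1 < size cs) = false by rewrite -lt.
    by right; split=> //; lia.
Qed.

Lemma near_cell dir b j : isend dir b -> 0 < j <= B ->
  onth cs (near dir b j) = Some (inl None).
Proof.
move=> eb jB; rewrite /near; case: eb => [[i bi]|[-> ->]]; last exact: tailE.
by have [_ /(_ j jB) []] := padE bi; case: dir.
Qed.

Lemma end_le dir b : isend dir b -> B <= b <= size cs.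
Proof.
case=> [[i bi]|[_ ->]]; last by have := tailB; lia.
by have [? _] := padE bi; have : b < size cs; [rewrite -onthTE bi|lia].
Qed.

(** The cell just behind the border in direction [dir] is the origin: near cells have negative
    coordinates, and the far cells of a block [i] start at [tl i]. *)
Definition base (dir : bool) b : int := if dir then Posz (E b) else (Posz (E b.+1) - 1)%R.

Lemma near_pos dir b j : isend dir b -> 0 < j <= B ->
  Posz (E (near dir b j)) = pz dir (base dir b) (- Posz j)%R.
Proof.
move=> eb; have /andP[bB bs] := end_le eb; elim: j => // j IH jB.
have [E1 _] := E_cell (near_cell eb jB).
case: (posnP j) => [j0|j0].
  subst j; move: E1; rewrite /near /base /pz; case: (dir) => /= E1.
    by move: E1; rewrite (_ : (b - 1).+1 = b); lia.
  by rewrite addn1; lia.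
have {}IH := IH ltac:(lia); have [E0 _] := E_cell (near_cell eb (j := j) ltac:(lia)).
move: IH E1 E0; rewrite /near /base /pz; case: (dir) => /= IH E1 E0.
  by move: E1; rewrite (_ : (b - j.+1).+1 = b - j); lia.
by rewrite addnS E0; lia.
Qed.

Lemma far_pos dir b i j : onth cs b = Some (inr i) -> 0 < j <= B ->
  onth cs (far dir b j) = Some (inl None) /\
  Posz (E (far dir b j)) = pz dir (base dir b) (Posz (tl i) - 1 + Posz j)%R.
Proof.
move=> bi jB; have eb : isend (~~ dir) b by left; exists i.
have -> : far dir b j = near (~~ dir) b j by rewrite /near /far; case: (dir).
split; first exact: near_cell; rewrite near_pos // /base /pz.
have [-> _] := E_step bi; rewrite /= size_nseq.
by case: (dir) => /=; lia.
Qed.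

Lemma zone dir b (xi : int) : isend dir b -> (- Posz W <= xi)%R ->
  (forall i, onth cs b = Some (inr i) -> (xi < Posz (tl i + B) - 1)%R) ->
  exists c : nat, [/\ 0 < c, mu c = None & Posz c = pz dir (base dir b) xi].
Proof.
move=> eb xW xB; have /andP[bB bs] := end_le eb.
case: (ltrP xi 0) => x0.
  have jB : 0 < `|xi|%N <= B by rewrite /W /B in xW *; lia.
  exists (E (near dir b `|xi|%N)); have [_ ->] := E_cell (near_cell eb jB).
  split=> //; last by rewrite near_pos //; congr pz; lia.
  apply: leq_trans (E_ge _); rewrite /near.
    by rewrite /W /B in xW bB; case: (dir); lia.
  have : near dir b `|xi|%N < size cs by rewrite -onthTE near_cell.
  exact: ltnW.
case: (eb) => [[i bi]|[dT bE]]; last first.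
  exists (E b + `|xi|%N); split; last by rewrite dT /pz /base; lia.
    by have := E_ge bs; rewrite /B in bB; lia.
  by apply: E_end; rewrite bE leq_addr.
have {}xB := xB i bi; have [ES mS] := E_step bi; rewrite /= size_nseq in ES mS.
case: (ltrP xi (Posz (tl i))) => xt.
  exists (if dir then E b + `|xi|%N else E b + (tl i - 1 - `|xi|%N)); split.
  - by have := E_ge bs; rewrite /B in bB; case: (dir); lia.
  - by case: (dir); rewrite mS ?nth_nseq ?if_same //; lia.
  - by rewrite /pz /base ES; case: (dir); lia.
pose j := `|xi|%N - (tl i - 1); have jB : 0 < j <= B by have := tl0 i; rewrite /j; lia.
have [fc fp] := far_pos dir bi jB; have [_ mf] := E_cell fc.
exists (E (far dir b j)); split=> //; last by rewrite fp; congr pz; have := tl0 i; rewrite /j; lia.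
apply: leq_trans (E_ge _); last by apply: ltnW; rewrite -onthTE fc.
by have := tl0 i; rewrite /far; case: (dir); rewrite /j; lia.
Qed.

Variable tacc : nat.
Hypothesis acc_t : (sm tacc).1 \in accepting A.
Hypothesis acc_min : forall t, (sm t).1 \in accepting A -> tacc <= t.

(** An acceptance within the periodic stretch would also occur at the corresponding time of its
    first period, against the minimality of [tacc]. *)
Lemma periodic_not_acc t2 T n : 0 < T -> orbit w (sm t2) T = sm t2 -> t2 + T <= tacc ->
  (forall i, i <= n -> sm (t2 + i) = orbit w (sm t2) i) ->
  (forall i, i <= T -> sm (t2 + i) = orbit w (sm t2) i) -> t2 + n < tacc.
Proof.
move=> T0 per tT Hn HT; rewrite ltnNge; apply/negP => le.
have [i iE] : exists i, tacc = t2 + i by exists (tacc - t2); lia.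
have : (sm (t2 + i %% T)).1 \in accepting A.
  rewrite HT; last by apply: ltnW; rewrite ltn_mod.
  move: acc_t; rewrite iE Hn; last by lia.
  by rewrite {1}(divn_eq i T) orbitD orbit_period.
by move/acc_min; have := ltn_pmod i T0; lia.
Qed.

Definition dist a b := (a - b) + (b - a).
Definition safe p := forall dir b, isend dir b -> W <= dist p b.

Lemma reach_along t n gg : (forall i, i <= n -> on_cell (t + i)) ->
  mreach (cfg t gg) (cfg (t + n) gg).
Proof.
elim: n => [|n IH] Hn; first by rewrite addn0; apply: mreach_refl.
apply: mreach_trans (IH _) _; first by move=> i ni; apply: Hn; lia.
have := Hn n.+1 (leqnn _); rewrite addnS => e1.
case: (sim_step (Hn n (leqnSn n))) => [[_ [R _]]|[]]; first exact: R.
by rewrite e1.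
Qed.

Lemma disp_bounds dir (s : sconf A) T d y n : 0 < T -> orbit w s T = s ->
  disp w dir s T = Posz d ->
  (forall i, i <= T -> (0 <= disp w dir s i <= Posz y)%R) ->
  forall i, i <= n * T -> (0 <= disp w dir s i <= Posz (n * d + y)%N)%R.
Proof.
move=> T0 per dE Hy i iN; rewrite (divn_eq i T) dispD orbit_period // disp_period // dE.
have := Hy (i %% T) (ltnW (ltn_pmod i T0)).
have qn : i %/ T <= n by rewrite -(mulnK n T0) leq_div2r.
have : d * (i %/ T) <= n * d by rewrite mulnC leq_mul2r qn orbT.
by rewrite -PoszM; move: (d * (i %/ T)) (n * d) => a b; lia.
Qed.

(** [t0] is the last time at distance at least [W]. Positions change by at most one and never equal
    [b], so after [t0] the run stays on the side from which it leaves. *)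
Lemma approach dir b t tm : isend dir b -> t <= tm -> (forall i, t <= i <= tm -> on_cell i) ->
  pp tm = near dir b 1 -> W <= dist (pp t) b ->
  exists2 t0, t <= t0 <= tm & pp t0 = near dir b W /\
    forall i, t0 <= i <= tm -> exists2 j, 0 < j <= W & pp i = near dir b j.
Proof.
move=> eb ttm Hex ptm; have /andP[bB bs] := end_le eb.
have WB : W < B by rewrite /W /B; lia.
have nb p : isc p -> p <> b.
  move=> ip pb; move: ip; rewrite pb /isc; case: (eb) => [[i ->]//|[_ ->]].
  by rewrite onth_default.
move=> Wt; pose Q i := (t <= i <= tm) && (W <= dist (pp i) b).
have exQ : exists i, Q i by exists t; rewrite /Q leqnn ttm.
have bdQ i : Q i -> i <= tm by case/andP => /andP[].
case: (ex_maxnP exQ bdQ) => t0 /andP[t0m Wt0] t0max.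
have ltW i : t0 < i <= tm -> dist (pp i) b < W.
  move=> ti; rewrite ltnNge; apply/negP => Wi.
  by have := t0max i; rewrite /Q Wi andbT; lia.
have down m : m <= tm - t0 -> exists2 j, 0 < j <= W & pp (tm - m) = near dir b j.
  elim: m => [|m IH] mt; first by exists 1; rewrite ?subn0 // /W; lia.
  have [j jW pj] := IH (ltnW mt).
  have jlt : j < W.
    have := ltW (tm - m) ltac:(lia); rewrite pj /dist /near.
    by case: (dir); lia.
  have iS : tm - m = (tm - m.+1).+1 by lia.
  have ei := Hex (tm - m.+1) ltac:(lia).
  have pb : pp (tm - m.+1) <> b by apply: nb; case/andP: ei.
  have [l1 l2] : pp (tm - m) <= (pp (tm - m.+1)).+1 /\ pp (tm - m.+1) <= (pp (tm - m)).+1.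
    rewrite iS; case: (sim_step ei) => [[_ [_]]//|[]].
    by rewrite -iS (Hex (tm - m)) //; lia.
  exists (dist (pp (tm - m.+1)) b).
    by move: l1 l2; rewrite pj /near /dist; case: (dir); lia.
  by move: l1 l2; rewrite pj /near /dist; case: (dir); lia.
exists t0 => //.
have H i : t0 <= i <= tm -> exists2 j, 0 < j <= W & pp i = near dir b j.
  move=> ti; have [j jW pj] := down (tm - i) ltac:(lia); exists j => //.
  by rewrite -pj; congr pp; lia.
split=> //; have [j jW pj] := H t0 ltac:(lia).
rewrite [LHS]pj; congr (near _ _ _); move: Wt0; rewrite pj /dist /near.
by case: (dir); lia.
Qed.

(** Induction on the time left. When the run leaves the explicit cells, its last [W] cells contain a
    period with drift; the induction resumes after enough periods to reach a safe cell beyond the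
    block. Off the right end the period would go on forever, which contradicts acceptance. *)
Lemma main_accept n t gg : tacc = t + n -> on_cell t -> safe (pp t) ->
  exists2 c, mreach (cfg t gg) c & c.1 \in vacc A k.
Proof.
have [N] := ubnP n; elim: N n t gg => // N IH n t gg nN tE ext sf.
case: (boolP [forall i : 'I_n.+1, on_cell (t + i)]) => [/forallP allex|].
  exists (cfg tacc gg); last by rewrite inE.
  rewrite tE; apply: reach_along => i ni.
  by have := allex (Ordinal (ni : i < n.+1)).
rewrite negb_forall => /existsP[i0 ni0].
have exn : exists i, ~~ on_cell (t + i) by exists i0.
case: (ex_minnP exn) => te0 nex temin.
have te_n : te0 <= n by apply: leq_trans (temin _ ni0) _; rewrite -ltnS.
have exb i : i < te0 -> on_cell (t + i).
  by move=> lt; apply/negPn/negP => /temin; lia.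
case: te0 nex temin te_n exb => [|m]; first by rewrite addn0 ext.
rewrite addnS => nex temin te_n exb; set tm := t + m in nex *.
have exm : on_cell tm by apply: exb.
have [[e1 _]|[_ [dir [b [eb ptm ctm]]]]] := sim_step exm; first by rewrite e1 in nex.
have /andP[bB bs] := end_le eb.
have Hex i : t <= i <= tm -> on_cell i.
  by move=> H; have := exb (i - t); rewrite subnKC; [apply; rewrite /tm in H; lia|lia].
have [|t0 t0m [pt0 Hnear]] := @approach dir b t tm eb _ Hex ptm (sf dir b eb).
  by rewrite /tm leq_addr.
have cellE i : t0 <= i <= tm -> cell i = E (pp i).
  by move=> H; have /andP[_ /eqP] := Hex i ltac:(lia).
have WB : 0 < W <= B by rewrite /W /B; lia.
have c0 : Posz (cell t0) = pz dir (base dir b) (- Posz W)%R.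
  by rewrite cellE ?pt0 ?near_pos //; lia.
have [t1 t1E] : exists t1, tm.+1 = t0 + t1 by exists (tm.+1 - t0); lia.
have fol i : i <= t1 -> sm (t0 + i) = orbit w (sm t0) i /\
    Posz (cell (t0 + i)) = pz dir (cell t0) (disp w dir (sm t0) i).
  elim: i => [|i IHi] it1.
    by rewrite addn0; split=> //; rewrite /pz /=; case: (dir); lia.
  have [S1 S2] := IHi (ltnW it1).
  have [j jW pj] := Hnear (t0 + i) ltac:(lia).
  have cj : cell (t0 + i) = E (near dir b j) by rewrite cellE ?pj //; lia.
  have jB : 0 < j <= B by lia.
  have [_ mj] := E_cell (near_cell eb jB).
  have cpos : 0 < cell (t0 + i).
    rewrite cj; apply: leq_trans (E_ge _); last by apply: ltnW; rewrite -onthTE near_cell.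
    by rewrite /near; move: bB; rewrite /B; move: jW; rewrite /W; case: (dir); lia.
  have [] := @sm_blank (t0 + i); rewrite ?cj ?mj -?cj // addnS => -> ->.
  rewrite S1; split=> //; rewrite S2 /= /vel /pz.
  by case: (dir); case: (bstep _ _).2 => /=; lia.
have Dge i : i < t1 -> (0 <= disp w dir (sm t0) i)%R.
  move=> it; have [_ S2] := fol i (ltnW it).
  have [j jW pj] := Hnear (t0 + i) ltac:(lia).
  move: S2; rewrite cellE ?pj ?near_pos ?c0 //; try lia.
  by rewrite /pz; case: (dir); lia.
have D1 : disp w dir (sm t0) t1 = Posz W.
  have [_] := fol t1 (leqnn _); rewrite -t1E ctm cellE ?ptm ?near_pos ?c0 //; try lia.
  by rewrite /pz; case: (dir); lia.
have [v [T [d [vt1 dP per dd [Tlow Tup T0]]]]] :=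
  @escape _ _ _ w dir (sm t0) t1 (sm_bound t0) ltac:(rewrite D1 /W; lia).
(* Up to the end of the period the displacement is at most [2 * P], but at [t1] it is [W]; so the
   period ends on explicit cells. *)
have vT : v + T < t1.
  rewrite ltnNge; apply/negP => le; have := Tup (t1 - v) ltac:(lia).
  by rewrite subnKC // D1 /W; lia.
pose t2 := t0 + v; pose s2 := sm t2.
have s2E : s2 = orbit w (sm t0) v by have [] := fol v (ltnW (leq_ltn_trans (leq_addr _ _) vT)).
rewrite -s2E in dd Tlow.
have per2 : orbit w s2 T = s2 by rewrite s2E -orbitD.
have smT i : i <= T -> sm (t2 + i) = orbit w s2 i.
  move=> iT; have [] := fol (v + i) ltac:(lia).
  by rewrite /t2 -addnA => -> _; rewrite orbitD -s2E.
have [jn jnW pn] := Hnear t2 ltac:(rewrite /t2; lia).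
have jnB : 0 < jn <= B by lia.
have c2 : Posz (cell t2) = pz dir (base dir b) (- Posz jn)%R.
  by rewrite cellE ?pn ?near_pos // /t2; lia.
have ybd i : i <= T -> (0 <= disp w dir s2 i <= Posz (P + P)%N)%R.
  move=> iT; rewrite Tlow //=; have := Tup i iT; rewrite dispD -s2E.
  by have := Dge v ltac:(lia); lia.
have tT : t2 + T <= tacc by rewrite tE /t2 /tm in t1E te_n *; lia.
have R1 : mreach (cfg t gg) (cfg t2 gg).
  have [i2 i2E] : exists i2, t2 = t + i2 by exists (t2 - t); rewrite /t2; lia.
  by rewrite i2E; apply: reach_along => i ii; apply: Hex; rewrite /t2 in i2E; lia.
have folZ n' : (forall i, i < n' -> forall i', onth cs b = Some (inr i') ->
      (- Posz jn + disp w dir s2 i < Posz (tl i' + B) - 1)%R) ->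
    (forall i, i < n' -> (0 <= disp w dir s2 i)%R) ->
    forall i, i <= n' -> sm (t2 + i) = orbit w s2 i /\
      Posz (cell (t2 + i)) = pz dir (cell t2) (disp w dir s2 i).
  move=> Hup Hlo; apply: follow => i ii.
  have [||c [cc0 mc ce]] := @zone dir b (- Posz jn + disp w dir s2 i)%R eb; last 1 first.
  - exists c; split=> //; rewrite ce c2 /pz /s2; by case: (dir); lia.
  - by have := Hlo i ii; lia.
  - by move=> i'; apply: Hup.
case: (eb) => [[ib bi]|[_ bE]]; last first.
  exfalso; have lt : t2 + tacc < tacc; last by lia.
  apply: (@periodic_not_acc t2 T tacc T0 per2 tT _ smT) => i ii.
  have [] := folZ tacc _ _ i ii => //.
    by move=> i' _ ib bi; have : b < size cs; [rewrite -onthTE bi|lia].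
  move=> i' _; have := disp_bounds (n := i') T0 per2 dd ybd (i := i') ltac:(nia); lia.
(* The quotient [(tl ib - 1 + W + jn) / d] rounded up: the least number of periods that leads at
   least [W] cells beyond the block. *)
pose J := (tl ib - 1 + W + jn + d - 1) %/ d.
have d0 : 0 < d by lia.
have JE := divn_eq (tl ib - 1 + W + jn + d - 1) d; rewrite -/J in JE.
have Jm := ltn_pmod (tl ib - 1 + W + jn + d - 1) d0.
have tl1 := tl0 ib.
pose jf := J * d + 1 - jn - tl ib.
have jfE : W <= jf < W + d /\ jf + jn + tl ib = J * d + 1 by rewrite /jf; lia.
have J0 : 0 < J by rewrite lt0n; apply/eqP => J0; move: jfE; rewrite J0; lia.
have yb := disp_bounds (n := J) T0 per2 dd ybd.
have fJ := folZ (J * T) _ _.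
have {fJ} fJ i : i <= J * T -> sm (t2 + i) = orbit w s2 i /\
      Posz (cell (t2 + i)) = pz dir (cell t2) (disp w dir s2 i).
  apply: fJ => i1 i1J; last by have := yb i1 (ltnW i1J); lia.
  move=> i'; rewrite bi => -[<-]; have := yb i1 (ltnW i1J); rewrite /B; move: jfE; rewrite /W; lia.
pose t3 := t2 + J * T.
have [s3 c3] := fJ (J * T) (leqnn _); rewrite -/t3 in s3 c3.
rewrite orbit_period // in s3; rewrite disp_period // dd c2 in c3.
have jfB : 0 < jf <= B by rewrite /B; move: jfE; rewrite /W; lia.
have [fc fp] := far_pos dir bi jfB.
have c3E : cell t3 = E (far dir b jf).
  apply/eqP; rewrite -eqz_nat c3 fp /pz; case: (dir); apply/eqP; lia.
have [p3 ex3] := @ppI t3 _ (ltac:(by rewrite /isc fc) : isc (far dir b jf)) c3E.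
have lt3 : t3 < tacc.
  by apply: (@periodic_not_acc t2 T _ T0 per2 tT _ smT) => i ii; case: (fJ i ii).
have sf3 : safe (pp t3).
  move=> dir' b' eb'; rewrite p3.
  have /andP[bB' bs'] := end_le eb'.
  have [_ pb] := padE bi.
  have far_ne j : 0 < j <= B -> b' <> b + j /\ b' <> b - j.
    move=> jB; have [q1 q2] := pb j jB; split=> e; case: eb' => [[i' bi']|[_ be]].
    - by rewrite -e bi' in q1.
    - by rewrite -e be onth_default in q1.
    - by rewrite -e bi' in q2.
    - by rewrite -e be onth_default in q2.
  case: (b' =P b) => [->|nbb].
    by rewrite /dist /far; case: (dir); move: bB jfB; lia.
  have dB : B < dist b b'.
    rewrite ltnNge; apply/negP => dle; case: (ltngtP b b') => lb; last by case: nbb.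
      by have [+ _] := far_ne (b' - b) ltac:(rewrite /dist in dle; lia); lia.
    by have [_ +] := far_ne (b - b') ltac:(rewrite /dist in dle; lia); lia.
  move: dB jfE bB; rewrite /dist /far /W /B; case: (dir); lia.
have R2 : mreach (cfg t2 gg) (cfg t3 (size g).+1).
  rewrite p3 pn s3.
  have Wk : walk w dir (P + P) s2 0 s2 d.
    by have := orbit_walk ybd; rewrite per2 dd.
  rewrite [s2]surjective_pairing in Wk.
  apply: (@cross_block _ _ _ _ _ _ wg dir ib _ _ (sm_bound t2) (P + P) d Wk d0 _ b B bi) => //.
  - by move: sizeB; lia.
  - by move=> j jB; apply: near_cell.
  - by move=> j jB; have [] := far_pos dir bi jB.
  - by lia.
  - by move: jfE; rewrite /B /W; lia.
  - by move: sizeB jfE jnW; rewrite /W; lia.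
  - have dvd : d %| jn + jf - 1 + tl ib.
      by rewrite (_ : jn + jf - 1 + tl ib = J * d); [rewrite dvdn_mull|lia].
    by rewrite /dvdn -modnDmr (modE ib dP) modnDmr.
have [n3 n3E] : exists n3, tacc = t3 + n3 by exists (tacc - t3); lia.
have t23 : t < t3 by rewrite /t3 /t2; nia.
have [c Rc ac] := IH n3 t3 (size g).+1 ltac:(lia) n3E ex3 sf3.
by exists c => //; apply: mreach_trans R1 (mreach_trans R2 Rc).
Qed.

Lemma start_accept gg :
  exists2 c, mreach (Norm k (start A), mkh 1 gg 0 0 0 [ffun=> 0] [ffun=> 0]) c &
    c.1 \in vacc A k.
Proof.
have i0 : isc 0.
  rewrite /isc; case E0 : (onth cs 0) => [[c|i]|] //; first by have [+ _] := padE E0; rewrite /B; lia.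
  by have := onthTE cs 0; rewrite E0 (leq_ltn_trans _ tailB).
have [p0 e0] := ppI i0 (esym (emb0 tl cs) : cell 0 = E 0).
have [|c R ac] := @main_accept tacc 0 gg erefl e0; last by exists c; rewrite // p0 in R *.
move=> dir b eb; rewrite p0.
by have /andP[bB _] := end_le eb; rewrite /dist /W; rewrite /B in bB; lia.
Qed.

End RealRun.

(** * The class is contained in NP *)

Fixpoint binary n v : seq bool :=
  if n is n'.+1 then rcons (binary n' v./2) (odd v) else [::].

Lemma size_binary n v : size (binary n v) = n.
Proof. by elim: n v => //= n IH v; rewrite size_rcons IH. Qed.

Lemma horner2_binary n v : v < 2 ^ n -> horner2 (binary n v) = v.
Proof.
elim: n v => [|n IH] v vn; first by move: vn; rewrite expn0; case: v.
rewrite /horner2 /= -cats1 foldl_cat /= -/(horner2 _) IH; last first.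
  by move: vn; rewrite expnS -{1}(odd_double_half v); lia.
by rewrite -{3}(odd_double_half v) addnC.
Qed.

Lemma fact_le_pow n : n`! <= 2 ^ (n * n).
Proof.
have : n`! <= n ^ n.
  elim: n => // n IH; rewrite factS expnS leq_mul2l /=; apply: leq_trans IH _.
  by case: n => // n; rewrite leq_exp2r.
move/leq_trans; apply; rewrite expnM; case: n => // n.
by rewrite leq_exp2r // ltnW // ltn_expl.
Qed.

(** * The compressed description of a given memory content *)

Section Construct.
Variables (Sigma : finType) (h : nat) (A : automaton Sigma h) (k' : nat).
Local Notation k := k'.+1.
Local Notation D := (marks A).
Local Notation cs_t := (csym A k).
Variables (B tail : nat).

(** A long gap keeps [B] explicit blanks on both sides of its block, where periods can be found
    before a crossing and the run resumed after it. *)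
Definition gapc (i a : nat) : seq cs_t :=
  if a <= 2 * B then nseq a (inl None)
  else nseq B (inl None) ++ inr (inord i) :: nseq B (inl None).

Fixpoint comp (i : nat) (ms : seq (nat * D)) : seq cs_t :=
  if ms is (a, d) :: ms' then gapc i a ++ inl (Some d) :: comp i.+1 ms'
  else nseq tail (inl None).

Definition unms (ms : seq (nat * D)) : seq (option D) :=
  flatten [seq nseq p.1 None ++ [:: Some p.2] | p <- ms].

(** The maximum with 1 matters only for tracks without a block, since block lengths are required to
    be positive on every track. *)
Definition tlen (ms : seq (nat * D)) (j : 'I_k) : nat :=
  maxn 1 (nth 0 [seq p.1 | p <- ms] j - 2 * B).

Lemma expand_nseq tl a : expand tl (nseq a (inl None : cs_t)) = nseq a None.
Proof. by elim: a => //= a; rewrite /expand /= => ->. Qed.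

Lemma expand_cat tl (s1 s2 : seq cs_t) : expand tl (s1 ++ s2) = expand tl s1 ++ expand tl s2.
Proof. by rewrite /expand map_cat flatten_cat. Qed.

Lemma expand_comp ms0 i ms : drop i ms0 = ms -> i + size ms <= k ->
  expand (tlen ms0) (comp i ms) = unms ms ++ nseq tail None.
Proof.
elim: ms i => [|[a d] ms IH] i dE sz; first exact: expand_nseq.
rewrite /= expand_cat -[inl (Some d) :: _]cat1s expand_cat IH; last 2 first.
- by rewrite -[i.+1]add1n -drop_drop dE /= drop0.
- by move: sz; rewrite /=; lia.
have -> : expand (tlen ms0) (gapc i a) = nseq a None.
  rewrite /gapc; case: ifP => aB; first exact: expand_nseq.
  rewrite expand_cat -[inr _ :: _]cat1s expand_cat !expand_nseq.
  have -> : expand (tlen ms0) [:: inr (inord i) : cs_t] = nseq (a - 2 * B) None.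
    rewrite /expand /= cats0; congr nseq; rewrite /tlen inordK; last by move: sz => /=; lia.
    have -> : nth 0 [seq p.1 | p <- ms0] i = a.
      have -> : nth 0 [seq p.1 | p <- ms0] i = nth 0 (drop i [seq p.1 | p <- ms0]) 0.
        by rewrite nth_drop addn0.
      by rewrite -map_drop dE.
    lia.
  by rewrite -!nseqD; congr nseq; lia.
by rewrite /unms /= -!catA.
Qed.

Definition padded (s : seq cs_t) := forall b i, onth s b = Some (inr i) -> B <= b /\
  forall j, 0 < j <= B -> onth s (b + j) = Some (inl None) /\ onth s (b - j) = Some (inl None).

Lemma padded_cat s1 s2 : padded s1 -> padded s2 -> padded (s1 ++ s2).
Proof.
move=> p1 p2 b i; rewrite onth_cat; case: ifP => bs1 Eb.
  have [bB Hj] := p1 b i Eb; split=> // j jB; have [j1 j2] := Hj j jB.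
  by rewrite !onth_cat -!onthTE j1 j2.
have [bB Hj] := p2 _ i Eb; split=> [|j jB]; first by lia.
have [j1 j2] := Hj j jB; rewrite !onth_cat !ifF; try lia.
by split; [rewrite -j1|rewrite -j2]; congr onth; lia.
Qed.

Lemma padded_nseq n c : padded (nseq n (inl c)).
Proof. by move=> b i; rewrite onth_nseq; case: ifP. Qed.

Lemma padded_gap i a : padded (gapc i a).
Proof.
rewrite /gapc; case: ifP => _; first exact: padded_nseq.
have nE (c : cs_t) n : onth (c :: nseq B (inl None)) n.+1 =
    if n < B then Some (inl None) else None by rewrite -onth_nseq.
move=> b i'; rewrite onth_cat size_nseq onth_nseq; case: (ltnP b B) => // bB.
case Eb : (b - B) => [|n]; last by rewrite nE; case: ifP.
have {}bB : b = B by lia.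
move=> _; rewrite bB; split=> // j jB; rewrite !onth_cat size_nseq !onth_nseq.
have e1 : (B + j < B) = false by lia.
have e2 : B - j < B by lia.
by rewrite e1 e2 addKn; case: j jB {e1 e2} => // j jB; rewrite nE ifT.
Qed.

Lemma padded_comp i ms : padded (comp i ms).
Proof.
elim: ms i => [|[a d] ms IH] i; first exact: padded_nseq.
rewrite /=; apply: padded_cat; first exact: padded_gap.
by rewrite -cat1s; apply: padded_cat => //; apply: (@padded_nseq 1).
Qed.

Lemma comp_tail i ms : exists2 s, comp i ms = s ++ nseq tail (inl None) &
  size s <= size ms * (2 * B + 2).
Proof.
elim: ms i => [|[a d] ms IH] i; first by exists [::].
have [s sE sz] := IH i.+1; exists (gapc i a ++ inl (Some d) :: s); first by rewrite /= sE -catA.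
rewrite size_cat /= mulSn.
rewrite addnS -addSn; apply: leq_add => //.
by rewrite /gapc; case: ifP => aB; rewrite ?size_cat /= ?size_nseq; lia.
Qed.

Lemma count_comp i ms : count (@mkb _ _ A k) (comp i ms) = size ms.
Proof.
elim: ms i => [|[a d] ms IH] i /=; first by rewrite count_nseq.
rewrite count_cat /= IH /gapc; case: ifP => _; rewrite ?count_cat /= !count_nseq /=; lia.
Qed.

End Construct.

Lemma split_marks (D : Type) (l : seq (option D)) : exists ms r,
  l = flatten [seq nseq p.1 None ++ [:: Some p.2] | p : nat * D <- ms] ++ nseq r None /\
  size ms = count isSome l.
Proof.
elim: l => [|[d|] l [ms [r [lE sz]]]]; first by exists [::], 0.
  by exists ((0, d) :: ms), r; rewrite /= -lE sz add1n.
case: ms lE sz => [|[a d] ms] lE sz; first by exists [::], r.+1; rewrite /= -sz lE.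
by exists ((a.+1, d) :: ms), r; split; [rewrite lE|exact: sz].
Qed.

Section ScanRun.
Variables (Sigma : finType) (h : nat) (A : automaton Sigma h) (k : nat).
Local Notation H := 'I_h.
Variables (w : seq Sigma) (g : seq (gsymb A k)).
Hypothesis wg : size w <= size g.
Let u := pad w g.
Let cs := [seq x.1 | x <- g].
Hypothesis ck : count (@mkb _ _ A k) cs <= k.
Let z0 : {ffun H -> nat} := [ffun=> 0].
Local Notation mreach := (@mreach Sigma h A k w g).
Local Notation cf q m := ((q, mkh m 0 0 0 0 z0 z0) : nconf (vstate A k) (vhead h)).

Lemma scan_run : mreach (ninit (vhead h) (Scan A ord0)) (cf (Norm k (start A)) 1).
Proof.
have -> : ninit (vhead h) (Scan A (ord0 : 'I_k.+1)) = cf (Scan A ord0) 0.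
  by congr pair; apply/ffunP => -[[[|[|[|[|[|]]]]] //= ?]|[j|j]]; rewrite !ffunE.
have scan n : n <= size g ->
    mreach (cf (Scan A ord0) 0) (cf (Scan A (inord (count (@mkb _ _ A k) (take n cs)))) n.+1).
  elim: n => [|n IH] ng.
    apply: (mstep0 (ch := inl 0%R) (q' := Scan A ord0) (dm := MRight)
      (dg := MStay) (dr := MStay) (ds := MStay) (dy := MStay)); first by rewrite /= !rdE.
    rewrite (incE wg) //= take0 /=; rewrite (_ : inord 0 = ord0); first exact: mreach_refl.
    by apply: val_inj; rewrite /= inordK.
  apply: mreach_trans (IH (ltnW ng)) _.
  have szc : size cs = size g by rewrite size_map.
  have cE : count (@mkb _ _ A k) (take n.+1 cs) =
      count (@mkb _ _ A k) (take n cs) + mkb (nth (inl None) cs n).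
    by rewrite (take_nth (inl None)) ?szc // -cats1 count_cat /= addn0.
  have le n' : count (@mkb _ _ A k) (take n' cs) <= k.
    by apply: leq_trans ck; rewrite -{2}(cat_take_drop n' cs) count_cat leq_addr.
  apply: (mstep0 (ch := inl 0%R)
      (q' := Scan A (inord (count (@mkb _ _ A k) (take n.+1 cs)))) (dm := MRight)
      (dg := MStay) (dr := MStay) (ds := MStay) (dy := MStay)); last first.
    by rewrite (incE wg) //=; apply: mreach_refl.
  rewrite /= !rdE /read_input /=; have [a ->] := pad_nth w ng.
  move: cE (le n.+1) (le n); rewrite /cs (nth_map (inl None, [ffun=> false])) //.
  case: (nth _ g n) => [[[o|]|i] t] /= cE l1 l2; last 2 first.
  - by rewrite cE addn0.
  - by rewrite cE addn0.
  by rewrite inordK // ifT ?cE ?addn1 //; rewrite cE in l1; lia.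
apply: mreach_trans (scan _ (leqnn _)) _.
apply: (mstep0 (ch := inl 0%R) (q' := Rew A k) (dm := MStay)
      (dg := MStay) (dr := MStay) (ds := MStay) (dy := MStay)).
  by rewrite /= !rdE /read_input /= nth_default ?size_map ?size_pad.
rewrite /=; elim: (size g).+1 => [|n IH].
  apply: (mstep0 (ch := inl 0%R) (q' := Norm k (start A)) (dm := MRight)
      (dg := MStay) (dr := MStay) (ds := MStay) (dy := MStay)); first by rewrite /= !rdE.
  by rewrite (incE wg) //=; apply: mreach_refl.
apply: (mstep0 (ch := inl 0%R) (q' := Rew A k) (dm := MLeft)
      (dg := MStay) (dr := MStay) (ds := MStay) (dy := MStay)); last exact: IH.
by rewrite /= !rdE (read_left _).
Qed.

End ScanRun.

Lemma vcomplete (Sigma : finType) (h : nat) (A : automaton Sigma h) k'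
    (w : seq Sigma) (mu : memory_content (marks A)) :
  U k'.+1 mu -> run_accepts w mu ->
  let P := nsmall A w in
  exists g : seq (gsymb A k'.+1), [/\ size w <= size g,
    size g <= k'.+1 * (16 * P + 18) + (48 * P + P * P + size w + 64) &
    naccepts (@vtrans Sigma h A k'.+1) (Scan A ord0) (vacc A k'.+1) (pad w g)].
Proof.
move=> [s sk smu] racc P.
pose N := (\max_(i <- s) i).+1.
have muN x : N <= x -> mu x = None.
  move=> Nx; case E : (mu x) => [c|//]; have xs : x \in s by apply: smu; rewrite E.
  have le : x <= \max_(i <- s) i := @leq_bigmax_seq _ s predT id x xs isT.
  by move: (leq_trans Nx le); rewrite ltnn.
have [ms [r [lE szm]]] := split_marks (mkseq mu N).
have szk : size ms <= k'.+1.
  rewrite szm; apply: leq_trans sk; rewrite count_map -size_filter.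
  apply: uniq_leq_size; first by rewrite filter_uniq ?iota_uniq.
  by move=> i; rewrite mem_filter /= => /andP[mi _]; apply: smu; case: (mu i) mi.
(* The description is as long as its tracks: [P * P] provides enough binary digits for numbers below
   [P!], [size w] covers the word, and the rest serves the padding and the counters. *)
pose B := 8 * P + 8; pose tail := 48 * P + P * P + size w + 64.
pose cs := @comp _ _ A k' B tail 0 ms.
have [pre csE prez] := @comp_tail _ _ A k' B tail 0 ms; rewrite -/cs in csE.
have szcs : size cs = size pre + tail by rewrite csE size_cat size_nseq.
pose tl := @tlen _ _ A k' B ms.
(* Reduction modulo [P!] preserves the length modulo every [d <= P], so one stored number serves all
   drifts that can occur. *)
pose bits i := binary (size cs) (tl i %% P`!).
pose g : seq (gsymb A k'.+1) :=
  mkseq (fun p => (nth (inl None) cs p, [ffun i => nth false (bits i) p])) (size cs).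
have gcs : [seq x.1 | x <- g] = cs by rewrite -map_comp; apply: mkseq_nth.
have szg : size g = size cs by rewrite size_mkseq.
have wg : size w <= size g by rewrite szg szcs /tail; lia.
exists g; split=> //.
  rewrite szg szcs -/tail leq_add2r; apply: leq_trans prez _; apply: leq_mul => //.
  by rewrite /B; lia.
have dig i : digits_of g i = bits i.
  rewrite /digits_of /g /mkseq -map_comp -[RHS](mkseq_nth false) size_binary.
  by apply: eq_map => p /=; rewrite ffunE.
case: racc => t0 Ht0.
have exA : exists t, cstate (iter t (step w mu) (initial A)) \in accepting A by exists t0.
case: (ex_minnP exA) => tacc Hacc Hmin.
have [c R ac] : exists2 c, mreach w g (Norm k'.+1 (start A), mkh 1 0 0 0 0 [ffun=> 0] [ffun=> 0]) c &
    c.1 \in vacc A k'.+1.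
  apply: (@start_accept _ _ A k'.+1 w g wg mu tl _ _ _ _ _ _ _ tacc Hacc Hmin).
  - by move=> i; rewrite /tl /tlen; lia.
  - move=> x; rewrite gcs /cs /tl expand_comp ?drop0 ?add0n //.
    have nc (l : seq (option (marks A))) n : nth None (l ++ nseq n None) x = nth None l x.
      rewrite nth_cat; case: ltnP => // le; rewrite nth_nseq if_same nth_default //.
    rewrite nc -(nc _ r) -lE; case: (ltnP x N) => xN; first by rewrite nth_mkseq.
    by rewrite nth_default ?size_mkseq ?muN.
  - by move=> b i; rewrite gcs; apply: padded_comp.
  - by rewrite gcs szcs /tail; lia.
  - move=> j jB; rewrite gcs csE onth_cat size_cat size_nseq ifF; last by rewrite /tail; lia.
    by rewrite onth_nseq ifT //; rewrite /tail; lia.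
  - move=> i d dP; rewrite /blen dig /bits horner2_binary.
      by rewrite modn_dvdm // dvdn_fact.
    apply: leq_trans (ltn_pmod _ (fact_gt0 _)) _; apply: leq_trans (fact_le_pow _) _.
    by rewrite leq_exp2l // szcs /tail; lia.
  - by rewrite szg szcs /tail /P; lia.
have [|p [pp lp]] := mreach_trans (scan_run wg _) R; first by rewrite gcs count_comp.
by exists (size p), p; rewrite lp.
Qed.

Lemma R_U_W2_in_NP k (Sigma : finType) (L : language Sigma) :
  0 < k -> R_U_W2 k L -> NP L.
Proof.
case: k => // k' _ [h [A [_ HL]]].
pose Pp : {poly nat} := (#|state A|%:P * ('X + 2%:P) ^+ h)%R.
pose p : {poly nat} := (k'.+1%:P * (16%:P * Pp + 18%:P) +
  (48%:P * Pp + Pp * Pp + 'X + 64%:P))%R.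
apply: (@NP_of_multihead Sigma _ _ _ _ (hM h) (@vtrans Sigma h A k'.+1) (Scan A ord0)
  (vacc A k'.+1) L p) => [w g wg /(vsound wg)|w /HL[mu [Umu acc]]].
  by move=> H; apply/HL.
have [g [wg szg na]] := vcomplete Umu acc; exists g; split=> //.
apply: leq_trans szg _.
have PE : nsmall A w = (Pp.[size w])%R.
  rewrite /nsmall card_prod card_ffun !card_ord /Pp !(hornerM, horner_exp, hornerD, hornerC, hornerX).
  have expE (x n : nat) : (x ^+ n)%R = x ^ n by elim: n => // n IH; rewrite exprS IH expnS.
  by rewrite expE -addn2.
rewrite /p {p}; clearbody Pp.
by rewrite !(hornerD, hornerM, hornerC, hornerX) -PE.
Qed.

Theorem theorem6 (k : nat) (hk : 2 <= k) (Sigma : finType)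
  (L : language Sigma) : R_U_W2 k L <-> NP L.
Proof.
split; first by apply: R_U_W2_in_NP; apply: ltnW.
exact: NP_in_R_U_W2.
Qed.
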